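(* Let $m$ be fixed, let $\boldsymbol U=(U_1,\dots,U_m)$ have copula $C$ and exact uniform$(0,1)$ margins, and let $\boldsymbol w$ be a fixed weight vector with $w_i>0$ and $\sum_iw_i=1$. For every $I\subseteq[m]$ with $|I|\ge2$, suppose the marginal copula of $(U_i)_{i\in I}$ has a density $c_I$, and that for some $u_0\in(0,1)$ and constants $M_I<\infty$, $$\operatorname*{ess\,sup}_{\boldsymbol u_I\in(0,1)^I,\ \min_{i\in I}u_i\le u_0}c_I(\boldsymbol u_I)\le M_I .$$ For each pair $i<j$, assume that the finite limit $$\lambda_{ij}=\lim_{s\downarrow0}\operatorname*{ess\,sup}_{0<u,v\le s}c_{ij}(u,v)=\lim_{s\downarrow0}\operatorname*{ess\,inf}_{0<u,v\le s}c_{ij}(u,v)$$ exists. For $S\in\{R,T\}$ put $c_R=1$, $c_T=2/\pi$. Then, for both $S=R$ (reciprocal) and $S=T$ (positive Half-Cauchy), as $t\to\infty$ and $\alpha\downarrow0$, $$\overline F^S_{C}(t)-\overline F^S_{\Pi}(t)=2c_S^2\sum_{i<j}(\lambda_{ij}-1)w_iw_j\,\frac{\log t}{t^2}+o\!\left(\frac{\log t}{t^2}\right),$$ $$\operatorname{Cal}^S_{C}(\alpha)=2\sum_{i<j}(\lambda_{ij}-1)w_iw_j\,\alpha^2\log(1/\alpha)+o\{\alpha^2\log(1/\alpha)\}.$$ If in addition $\int_0^{u_0}\omega_{ij}(s)\,s^{-1}\,ds<\infty$ for all $i<j$, where $\omega_{ij}(s)=\operatorname*{ess\,sup}_{0<u,v\le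 s}|c_{ij}(u,v)-\lambda_{ij}|$, then the two final remainders are respectively $O(t^{-2})$ and $O(\alpha^2)$, and $$q^S_{C}(\alpha)-q^S_{\Pi}(\alpha)=2c_S\sum_{i<j}(\lambda_{ij}-1)w_iw_j\log(1/\alpha)+O(1).$$
   Context: $[m]=\{1,\dots,m\}$; $c_{ij}=c_{\{i,j\}}$. The aggregates are $R=\sum_iw_i/U_i$ and $T=\sum_iw_i\cot(\pi U_i/2)$. $\overline F^S_C(t)$ and $\overline F^S_\Pi(t)$ denote $\Pr(S>t)$ when $\boldsymbol U$ has copula $C$ and when the $U_i$ are independent uniform$(0,1)$ (copula $\Pi$), respectively, with the same weights; $q^S_C(\alpha)$ and $q^S_\Pi(\alpha)$ are the corresponding upper $\alpha$-quantiles; and $\operatorname{Cal}^S_C(\alpha)=\overline F^S_C\{q^S_\Pi(\alpha)\}-\alpha$ is the size distortion when the independence critical value is used. *)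

(* Defs.v *)
From HB Require Import structures.
From mathcomp Require Import all_boot all_order all_algebra.
From mathcomp Require Import all_classical all_reals all_analysis.
From mathcomp Require Import measurable_realfun ess_sup_inf.

Set Implicit Arguments.
Unset Strict Implicit.
Unset Printing Implicit Defensive.

Import Order.TTheory GRing.Theory Num.Theory.
Import numFieldNormedType.Exports.

Local Open Scope classical_set_scope.
Local Open Scope ring_scope.

(* These let the Landau notations of the library be used at +oo and 0^'+. *)
Canonical pinfty_filter_on (R : realType) : filter_on R :=
  FilterType (@pinfty_nbhs R) _.
Canonical at_right_filter_on (R : realType) (x : R) : filter_on R :=
  FilterType (at_right x) _.

Section product_step.
Context d (T : measurableType d) (R : realType) (n : nat).
Variable m1 : {sigma_finite_measure set T -> \bar R}.
Variable m2 : {sigma_finite_measure set (n.-tuple T) -> \bar R}.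

Definition tuple_cons (p : T * n.-tuple T) : n.+1.-tuple T :=
  [tuple of p.1 :: p.2].

Lemma measurable_tuple_cons : measurable_fun [set: T * n.-tuple T] tuple_cons.
Proof. exact: measurable_cons. Qed.

Definition cons_measure : set (n.+1.-tuple T) -> \bar R :=
  pushforward (m1 \x m2)%E tuple_cons.

Let cons_measure0 : cons_measure set0 = 0%E.
Proof. by rewrite /cons_measure /pushforward preimage_set0 measure0. Qed.

Let cons_measure_ge0 A : (0 <= cons_measure A)%E.
Proof. by rewrite /cons_measure /pushforward. Qed.

Let cons_measure_sigma_additive : semi_sigma_additive cons_measure.
Proof.
move=> F mF tF mUF; rewrite /cons_measure /pushforward preimage_bigcup.
have mt A : measurable A -> measurable (tuple_cons @^-1` A).
  by move=> mA; rewrite -[X in measurable X]setTI; exact: measurable_tuple_cons.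
apply: measure_semi_sigma_additive.
- by move=> k; exact: mt.
- apply/trivIsetP => /= i j _ _ ij; rewrite -preimage_setI.
  by move/trivIsetP : tF => /(_ _ _ _ _ ij) ->//; rewrite preimage_set0.
- by rewrite -preimage_bigcup; exact: mt.
Qed.

HB.instance Definition _ := isMeasure.Build _ _ _ cons_measure
  cons_measure0 cons_measure_ge0 cons_measure_sigma_additive.

Let cons_measure_sigma_finite : sigma_finite setT cons_measure.
Proof.
have /sigma_finiteP[F [TF ndF Foo]] := sigma_finiteT m1.
have /sigma_finiteP[G [TG ndG Goo]] := sigma_finiteT m2.
pose g (x : n.+1.-tuple T) := (thead x, [tuple of behead x]).
have mg : measurable_fun [set: n.+1.-tuple T] g.
  apply: measurable_fun_pair; first exact: measurable_tnth.
  exact: measurable_behead.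
have gK : g \o tuple_cons = id.
  by apply/funext => -[a b]; rewrite /g/=; congr pair; apply: val_inj.
exists (fun k => g @^-1` (F k `*` G k)).
  rewrite -preimage_bigcup (_ : \bigcup_k _ = setT) ?preimage_setT//.
  rewrite -subTset => -[x y] _.
  have [[i _ Fx] [j _ Gy]] : (\bigcup_k F k) x /\ (\bigcup_k G k) y.
    by rewrite -TF -TG.
  exists (maxn i j) => //; split => /=.
  - by move: x Fx; exact/subsetPset/ndF/leq_maxl.
  - by move: y Gy; exact/subsetPset/ndG/leq_maxr.
move=> k; have [mF Fk] := Foo k; have [mG Gk] := Goo k; split.
  by rewrite -[X in measurable X]setTI; apply: mg => //; exact: measurableX.
rewrite /cons_measure /pushforward -comp_preimage gK preimage_id.
by rewrite product_measure1E// lte_mul_pinfty// ge0_fin_numE.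
Qed.

HB.instance Definition _ := Measure_isSigmaFinite.Build _ _ _ cons_measure
  cons_measure_sigma_finite.

End product_step.

Fixpoint prod_measure d (T : measurableType d) (R : realType)
    (mu : {sigma_finite_measure set T -> \bar R}) (n : nat) :
    {sigma_finite_measure set (n.-tuple T) -> \bar R} :=
  if n is k.+1 then cons_measure mu (prod_measure mu k)
  else @dirac _ (0.-tuple T) [tuple] R.

Lemma prod_measure_setT d (T : measurableType d) (R : realType)
    (P : probability T R) (n : nat) : prod_measure P n setT = 1%E.
Proof.
elim: n => [|n ih] /=; first exact: diracT.
rewrite /cons_measure /pushforward preimage_setT -setXTT product_measure1E//.
by rewrite ih mule1; exact: probability_setT.
Qed.

(* measurableTypeR R is R with its Borel sigma-algebra, as carried by
   lebesgue_measure and uniform_prob. *)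
Definition lebesgue (R : realType) (n : nat) :
    {sigma_finite_measure set (n.-tuple (measurableTypeR R)) -> \bar R} :=
  prod_measure (@lebesgue_measure R) n.

(* The law of n independent uniform(0,1) variables. *)
Definition indep_copula (R : realType) (n : nat) :
    set (n.-tuple (measurableTypeR R)) -> \bar R :=
  prod_measure (uniform_prob (@ltr01 R)) n.
Arguments indep_copula : clear implicits.

HB.instance Definition _ (R : realType) (n : nat) :=
  Measure.on (indep_copula R n).

HB.instance Definition _ (R : realType) (n : nat) :=
  @Measure_isProbability.Build _ _ R (indep_copula R n)
    (prod_measure_setT (uniform_prob (@ltr01 R)) n).

Inductive statistic := Reciprocal | HalfCauchy.

Section statistics.
Context (R : realType).
Local Notation RB := (measurableTypeR R).

Definition cot (x : R) : R := cos x / sin x.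

Definition transform (S : statistic) (u : RB) : R :=
  match S with
  | Reciprocal => u^-1
  | HalfCauchy => cot (pi * u / 2)
  end.

Let measurable_inv : measurable_fun [set: R] (@GRing.inv R).
Proof.
have E : [set: R] = [set x : R | x != 0] `|` [set 0].
  by apply/esym; rewrite -subTset => x _ /=; case: (eqVneq x 0) => ?; [right|left].
have m0 : measurable [set 0 : R] by exact: measurable_set1.
have mN0 : measurable [set x : R | x != 0].
  rewrite (_ : [set _ | _] = ~` [set 0]); first exact: measurableC.
  by apply/seteqP; split => x /= /eqP.
rewrite E; apply/measurable_funU => //; split; last exact: measurable_fun_set1.
apply: open_continuous_measurable_fun; first exact: open_neq.
by move=> x; rewrite inE /= => x0; exact: inv_continuous.
Qed.

Lemma measurable_transform S : measurable_fun [set: RB] (transform S).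
Proof.
case: S => //=; rewrite /transform /cot.
have mu : measurable_fun [set: R] (fun u : R => pi * u / 2).
  by apply: measurable_funM => //; exact: measurable_funM.
have mc : measurable_fun [set: R] (@cos R).
  by apply: continuous_measurable_fun; exact: continuous_cos.
have ms : measurable_fun [set: R] (@sin R).
  by apply: continuous_measurable_fun; exact: continuous_sin.
have : measurable_fun [set: R] (fun u : R => cos (pi * u / 2) / sin (pi * u / 2)).
  apply: measurable_funM; first exact: (measurableT_comp mc mu).
  exact: (measurableT_comp measurable_inv (measurableT_comp ms mu)).
exact.
Qed.

Definition aggregate (m : nat) (S : statistic) (w : 'I_m -> R)
    (u : m.-tuple RB) : R := \sum_(i < m) w i * transform S (tnth u i).

Let measurable_aggregate m S (w : 'I_m -> R) :
  measurable_fun [set: m.-tuple RB] (aggregate S w).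
Proof.
apply: measurable_sum => i; apply: measurable_funM => //.
apply: (measurableT_comp (measurable_transform S)).
exact: measurable_tnth.
Qed.

HB.instance Definition _ m S (w : 'I_m -> R) :=
  isMeasurableFun.Build _ _ _ _ (aggregate S w) (measurable_aggregate S w).

Definition scale_const (S : statistic) : R :=
  match S with Reciprocal => 1 | HalfCauchy => 2 / pi end.

(* Pr(S > t) when the random vector has law C; with uniform margins, C is
   the copula viewed as a probability measure. *)
Definition survival (m : nat) (S : statistic) (w : 'I_m -> R)
    (C : probability (m.-tuple RB) R) (t : R) : R :=
  fine (ccdf (aggregate S w : {RV C >-> R}) t).

Definition upper_quantile (F : R -> R) (alpha : R) : R :=
  inf [set t | F t <= alpha].

Definition quantile (m : nat) (S : statistic) (w : 'I_m -> R)
    (C : probability (m.-tuple RB) R) (alpha : R) : R :=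
  upper_quantile (survival S w C) alpha.

Definition calibration (m : nat) (S : statistic) (w : 'I_m -> R)
    (C : probability (m.-tuple RB) R) (alpha : R) : R :=
  survival S w C (quantile S w (indep_copula R m) alpha) - alpha.

Definition unit_cube (n : nat) : set (n.-tuple RB) :=
  [set x | forall k, 0 < tnth x k < 1].

(* The subvector indexed by I, listed in increasing order of the indices. *)
Definition marginal (m : nat) (I : {set 'I_m}) (u : m.-tuple RB) :
    #|I|.-tuple RB := [tuple tnth u (enum_val k) | k < #|I|].

(* nu has Lebesgue density c on the open unit cube and no mass outside it. *)
Definition is_density (n : nat) (nu : set (n.-tuple RB) -> \bar R)
    (c : n.-tuple RB -> R) : Prop :=
  [/\ measurable_fun (@unit_cube n) c,
      forall x, unit_cube x -> 0 <= c x &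
      forall A, measurable A ->
        nu A = (\int[lebesgue R n]_(x in A `&` @unit_cube n) (c x)%:E)%E].

(* Giving f the value -oo (resp. +oo) outside D makes these the essential
   supremum (resp. infimum) of f over D. *)
Definition ess_sup_on (n : nat) (D : set (n.-tuple RB))
    (f : n.-tuple RB -> R) : \bar R :=
  ess_sup (lebesgue R n) (patch (cst -oo%E) D (EFin \o f)).

Definition ess_inf_on (n : nat) (D : set (n.-tuple RB))
    (f : n.-tuple RB -> R) : \bar R :=
  ess_inf (lebesgue R n) (patch (cst +oo%E) D (EFin \o f)).

Definition min_le (n : nat) (s : R) : set (n.-tuple RB) :=
  [set x | unit_cube x /\ exists k, tnth x k <= s].

Definition corner (n : nat) (s : R) : set (n.-tuple RB) :=
  [set x | forall k, 0 < tnth x k <= s].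

Definition osc (n : nat) (c : n.-tuple RB -> R) (l s : R) : \bar R :=
  ess_sup_on (corner s) (fun x => `|c x - l|).

End statistics.

(* Main.v *)
(** Up to an additive error of at most 1, the aggregate S is the sum of the ratios
    X_i = c w_i / U_i with c = c_S.  Since c_{[m]} is bounded where min_i U_i <= u0,
    every event contained there has probability O(Pi) under C, so it is enough to
    discard events under independence.  Outside an event of Pi-probability O(t^-2),
    {S > t} is the disjoint union of the events {X_i > t}, of exact probability
    c w_i / t, and of the events E_ij = {X_i, X_j <= t < X_i + X_j}, i < j.  Under
    independence E_ij has probability 2 c^2 w_i w_j log t / t^2 + O(t^-2), its
    logarithm coming from all scales max(U_i, U_j) between 1/t and 1; hence
    C(E_ij) = (lam_ij + o(1)) Pi(E_ij), and, bounding the deviation on dyadic shells of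
    max(U_i, U_j), the Dini condition gives C(E_ij) = lam_ij Pi(E_ij) + O(t^-2).
    Conditioning on all but the largest summand also shows that the law of S under C
    has bounded density near infinity, so that F(q(alpha)) = alpha for small alpha;
    the quantile and calibration statements then follow by inverting
    F(t) = c / t + A log t / t^2 + O(t^-2). *)

Require Import Defs.
From HB Require Import structures.
From mathcomp Require Import all_boot all_order all_algebra.
From mathcomp Require Import all_classical all_reals all_analysis.
From mathcomp Require Import measurable_realfun ess_sup_inf.
From mathcomp Require Import ring lra.

Set Implicit Arguments.
Unset Strict Implicit.
Unset Printing Implicit Defensive.

Import Order.TTheory GRing.Theory Num.Theory.
Import numFieldNormedType.Exports.

Local Open Scope classical_set_scope.
Local Open Scope ring_scope.

(** A law [Q] on tuples enters only through three properties: [uniform_margins], [dominated] and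
    [pair_close]. The independence law has them too, with bound 1, limit 1 and error 0, so one
    expansion, valid for every such [Q], is instantiated twice and the two instances are subtracted.
    The obstacle is the size of the discarded event. A third summand X_k that carries X_i, or X_i +
    X_j, across the level could be feared to cost a logarithm, since X_k has infinite mean. Ordering
    the summands prevents this: under X_k <= X_j the variable X_k is truncated at an independent
    copy of its own scale, and the truncated mean is bounded. This is why triples of indices appear.
    Conditioning is done by resampling: overwriting a coordinate of an independent sample by a fresh
    one preserves the law, so that integrating over the fresh coordinate means conditioning on the
    others. Both kinds of remainder are carried by one relation [log_close e], with error B / t^2 +
    e log t / t^2: all e > 0 together give the little-o claims, e = 0 gives the big-O ones. *)

Lemma pushforwardE d1 d2 (T1 : sigmaRingType d1) (T2 : sigmaRingType d2)
    (R : realFieldType) (m : set T1 -> \bar R) (f : T1 -> T2) A :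
  pushforward m f A = m (f @^-1` A).
Proof. by []. Qed.

(** * Product measures on tuples *)

Section product_measure_tuples.
Context d (T : measurableType d) (R : realType).

Lemma measurable_box n (A : 'I_n -> set T) :
  (forall k, measurable (A k)) ->
  measurable [set x : n.-tuple T | forall k, A k (tnth x k)].
Proof.
move=> mA; rewrite (_ : mkset _ = \bigcap_(k in [set: 'I_n]) ((@tnth n T)^~ k @^-1` A k)).
  apply: fin_bigcap_measurable => // k _.
  by rewrite -[X in measurable X]setTI; exact: (measurable_tnth k).
by apply/seteqP; split=> x /= h k; [move=> _; exact: h|exact: h].
Qed.

Lemma prod_measure_box (mu : {sigma_finite_measure set T -> \bar R}) n
    (A : 'I_n -> set T) : (forall k, measurable (A k)) ->
  prod_measure mu n [set x | forall k, A k (tnth x k)] = (\prod_(k < n) mu (A k))%E.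
Proof.
elim: n A => [|n ih] A mA /=.
  rewrite big_ord0 /dirac/= indicE mem_set//; by case.
rewrite /cons_measure /pushforward.
have -> : @tuple_cons _ _ n @^-1` [set x | forall k, A k (tnth x k)] =
    A ord0 `*` [set x : n.-tuple T | forall k, A (lift ord0 k) (tnth x k)].
  apply/seteqP; split=> -[a y] /=.
    move=> h; split; first exact: (h ord0).
    by move=> k; rewrite -(tnthS a y k); exact: (h (lift ord0 k)).
  move=> [ha hy] k; have [->|[j ->]] : k = ord0 \/ exists j, k = lift ord0 j; last 2 first.
  - exact: ha.
  - by rewrite /tuple_cons tnthS; exact: (hy j).
  by case: (unliftP ord0 k) => [j ->|->]; [right; exists j|left].
rewrite product_measure1E//; last by apply: (@measurable_box n (fun k => A (lift ord0 k))) => k; exact: mA.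
by rewrite (ih (fun k => A (lift ord0 k))) ?big_ord_recl// => k; exact: mA.
Qed.

(** Boxes are stable under intersection and generate the sigma-algebra of tuples. Resampling,
    passage to marginals and restriction of Lebesgue measure to the cube are all reduced to a
    computation on boxes in this way. *)
Lemma prod_measure_unique (P : probability T R) n
    (nu : {measure set (n.-tuple T) -> \bar R}) :
  (forall A : 'I_n -> set T, (forall k, measurable (A k)) ->
    nu [set x | forall k, A k (tnth x k)] = (\prod_(k < n) P (A k))%E) ->
  forall A, measurable A -> nu A = prod_measure P n A.
Proof.
move=> nuE A mA.
pose G : set (set (n.-tuple T)) :=
  [set B | exists2 A : 'I_n -> set T, (forall k, measurable (A k)) &
    B = [set x | forall k, A k (tnth x k)]].
have GT : G setT.
  by exists (fun=> setT) => //; apply/seteqP; split.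
apply: (measure_unique G (fun=> setT)) => //.
- apply/seteqP; split.
    apply: smallest_sub; first exact: smallest_sigma_algebra.
    rewrite -bigcup_seq => B [i /= _ [C mC <-]].
    apply: sub_sigma_algebra.
    exists (fun k => if k == i then C else setT) => [k|]; first by case: ifP.
    rewrite setTI; apply/seteqP; split=> x /=.
      by move=> Cx k; case: eqP => // ->.
    by move=> /(_ i); rewrite eqxx.
  apply: smallest_sub; first exact: sigma_algebra_measurable.
  by move=> _ [B mB ->]; exact: measurable_box.
- move=> _ _ [B mB ->] [C mC ->]; exists (fun k => B k `&` C k).
    by move=> k; exact: measurableI.
  by apply/seteqP; split=> x /= => [[h1 h2] k|h]; split => // k; have [] := h k.
- by rewrite bigcup_const//; exists 0%N.
- move=> _ [B mB ->]; rewrite nuE//.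
  exact/esym/(prod_measure_box P mB).
- move=> _; have := nuE (fun=> setT) (fun=> measurableT).
  rewrite (_ : [set x | _] = setT); last by apply/seteqP; split.
  by move=> ->; rewrite big1 ?ltry// => i _; rewrite probability_setT.
Qed.

(** Overwriting in place, instead of splitting the tuple into a coordinate and the rest, keeps all
    indices in ['I_n] whatever [i] is. *)
Definition upd n (x : n.-tuple T) (i : 'I_n) (u : T) : n.-tuple T :=
  [tuple if k == i then u else tnth x k | k < n].

Lemma tnth_upd n (x : n.-tuple T) i u k :
  tnth (upd x i u) k = if k == i then u else tnth x k.
Proof. by rewrite tnth_mktuple. Qed.

Lemma measurable_upd n (i : 'I_n) :
  measurable_fun [set: T * n.-tuple T] (fun p => upd p.2 i p.1).
Proof.
apply/measurable_fun_tnthP => k.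
rewrite (_ : _ \o _ = fun p : T * n.-tuple T => if k == i then p.1 else tnth p.2 k).
  case: (k == i); first exact: measurable_fst.
  exact: (measurableT_comp (measurable_tnth k) measurable_snd).
by apply/funext => p /=; rewrite tnth_upd.
Qed.

Section resample.
Variables (P : probability T R) (n : nat) (i : 'I_n).

(** On a box, the side at [i] constrains only the fresh coordinate; the overwritten one is left free
    and contributes a factor 1. *)
Lemma prod_measure_upd A : measurable A ->
  (P \x prod_measure P n)%E ((fun p => upd p.2 i p.1) @^-1` A) = prod_measure P n A.
Proof.
have mphi := measurable_upd i.
pose f := fun p : T * n.-tuple T => upd p.2 i p.1.
move=> mA.
have /(_ mphi) H := @prod_measure_unique P n (pushforward (P \x prod_measure P n)%E f).
rewrite -H // {A mA} => A mA.
rewrite /= pushforwardE /f.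
pose B k := if k == i then setT else A k.
have mB k : measurable (B k) by rewrite /B; case: ifP.
have -> : (fun p => upd p.2 i p.1) @^-1` [set x | forall k, A k (tnth x k)] =
   A i `*` [set x | forall k, B k (tnth x k)].
  apply/seteqP; split=> -[u x] /=.
    move=> h; split; first by have := h i; rewrite tnth_upd eqxx.
    by move=> k; have := h k; rewrite /B tnth_upd; case: eqP.
  by move=> [hi h] k; have := h k; rewrite /B tnth_upd; case: eqP => // ->.
rewrite product_measure1E//; last exact: measurable_box.
rewrite prod_measure_box// [RHS](bigD1 i)//= (bigD1 i)//= {1}/B eqxx.
rewrite probability_setT mul1e.
by congr (_ * _)%E; apply: eq_bigr => k /negPf ki; rewrite /B ki.
Qed.

(** The integrand is the conditional probability of [A] given all coordinates but the one at [i],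
    written as a function of the whole tuple. *)
Lemma prod_measure_resample A : measurable A ->
  prod_measure P n A = (\int[prod_measure P n]_x P [set u | A (upd x i u)])%E.
Proof.
move=> mA; rewrite -prod_measure_upd//.
have mA' : measurable ((fun p : T * n.-tuple T => upd p.2 i p.1) @^-1` A).
  by rewrite -[X in measurable X]setTI; exact: measurable_upd.
rewrite (@product_measure_unique _ _ _ _ _ P (prod_measure P n)
  (product_measure2 P (prod_measure P n))) //.
  rewrite /= /product_measure2; apply: eq_integral => x _ /=.
  by congr (P _); apply/seteqP; split=> u; rewrite /ysection/= inE.
by move=> B C mB mC; rewrite -product_measure2E.
Qed.

Lemma ge0_integral_resample (f : n.-tuple T -> \bar R) :
  measurable_fun setT f -> (forall x, 0 <= f x)%E ->
  (\int[prod_measure P n]_x f x =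
   \int[prod_measure P n]_x \int[P]_u f (upd x i u))%E.
Proof.
move=> mf f0.
have mphi := measurable_upd i.
transitivity (\int[pushforward (P \x prod_measure P n)%E
    (fun p : T * n.-tuple T => upd p.2 i p.1)]_x f x)%E.
  apply: eq_measure_integral => A mA _.
  exact/esym/prod_measure_upd.
rewrite (ge0_integral_pushforward mphi)//.
rewrite preimage_setT fubini_tonelli2//; last by move=> x; exact: f0.
exact: (measurableT_comp mf mphi).
Qed.

Lemma measurable_resample A : measurable A ->
  measurable_fun [set: n.-tuple T] (fun x => P [set u | A (upd x i u)]).
Proof.
move=> mA.
have mA' : measurable ((fun p : T * n.-tuple T => upd p.2 i p.1) @^-1` A).
  by rewrite -[X in measurable X]setTI; exact: measurable_upd.
rewrite (_ : (fun x => _) = P \o ysection ((fun p : T * n.-tuple T => upd p.2 i p.1) @^-1` A)).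
  exact: measurable_fun_ysection.
by apply/funext => x /=; congr (P _); apply/seteqP; split=> u; rewrite /ysection/= inE.
Qed.

End resample.

Lemma prod_measure_marginal (P : probability T R) m (I : {set 'I_m})
    (A : set (#|I|.-tuple T)) : measurable A ->
  prod_measure P m ((fun u => [tuple tnth u (enum_val k) | k < #|I|]) @^-1` A) =
  prod_measure P #|I| A.
Proof.
have mphi : measurable_fun setT
    (fun u : m.-tuple T => [tuple tnth u (enum_val k) | k < #|I|]).
  apply/measurable_fun_tnthP => k.
  rewrite (_ : _ \o _ = fun x : m.-tuple T => tnth x (enum_val k)).
    exact: measurable_tnth.
  by apply/funext => x /=; rewrite tnth_mktuple.
pose f := fun u : m.-tuple T => [tuple tnth u (enum_val k) | k < #|I|].
move=> mA.
have /(_ mphi) H := @prod_measure_unique P #|I| (pushforward (prod_measure P m) f).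
rewrite -H // {A mA} => A mA.
rewrite /= pushforwardE /f.
(* [enum_rank_in] needs a proof of [i \in I], hence the match on [boolP]. Sides outside [I] are the
   whole space and have probability 1. *)
pose B (i : 'I_m) : set T := if boolP (i \in I) is AltTrue h then A (enum_rank_in h i) else setT.
have BE k : B (enum_val k) = A k.
  rewrite /B; case: {-}_ / boolP => [h|]; last by rewrite enum_valP.
  by rewrite enum_valK_in.
rewrite (_ : _ @^-1` _ = [set x | forall i, B i (tnth x i)]); last first.
  apply/seteqP; split=> x /= h k.
    rewrite /B; case: {-}_ / boolP => [ki|//].
    by have := h (enum_rank_in ki k); rewrite tnth_mktuple enum_rankK_in.
  by rewrite tnth_mktuple -BE; exact: h.
rewrite prod_measure_box; last first.
  by move=> i; rewrite /B; case: {-}_ / boolP.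
rewrite (bigID (mem I))/= [X in (_ * X)%E]big1 ?mule1; last first.
  move=> i iI; rewrite /B; case: {-}_ / boolP => [|_]; last by rewrite probability_setT.
  by move=> h; rewrite h in iI.
by rewrite big_enum_val/=; apply: eq_bigr => k _; rewrite BE.
Qed.

Lemma prod_measure_pair (P : probability T R) m (i j : 'I_m) (E : set (T * T)) :
  i != j -> measurable E ->
  prod_measure P m [set x | E (tnth x i, tnth x j)] = (P \x P)%E E.
Proof.
move=> ij mE.
have mphi : measurable_fun setT (fun x : m.-tuple T => (tnth x i, tnth x j)).
  by apply: measurable_fun_pair; exact: measurable_tnth.
pose f := fun x : m.-tuple T => (tnth x i, tnth x j).
have /(_ mphi) H := @product_measure_unique _ _ _ _ _ P P (pushforward (prod_measure P m) f).
rewrite H // => A B mA mB.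
rewrite /= pushforwardE /f.
pose C k := if k == i then A else if k == j then B else setT.
rewrite (_ : _ @^-1` _ = [set x : m.-tuple T | forall k, C k (tnth x k)]); last first.
  apply/seteqP; split=> x; rewrite /C /=.
    by move=> [hA hB] k; case: eqP => [->//|_]; case: eqP => [->|].
  by move=> h; split; [have := h i; rewrite eqxx|
    have := h j; rewrite eqxx eq_sym (negPf ij)].
rewrite prod_measure_box; last by move=> k; rewrite /C; case: ifP => // _; case: ifP.
rewrite (bigD1 i)//= (bigD1 j)/=; last by rewrite eq_sym.
rewrite {1}/C eqxx {1}/C eq_sym (negPf ij) eqxx big1 ?mule1// => k /andP[/negPf ki /negPf kj].
by rewrite /C ki kj probability_setT.
Qed.

End product_measure_tuples.

(** * Measurability of sets given by comprehension *)

Section measurable_comprehension.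
Context d (T : measurableType d) (R : realType).
Implicit Types (f g : T -> R) (P Q : T -> Prop) (b c : T -> bool).

Lemma measurable_set_lt f g : measurable_fun setT f -> measurable_fun setT g ->
  measurable [set x | f x < g x].
Proof.
move=> mf mg; rewrite -[X in measurable X]setTI.
have := @measurable_fun_ltr _ _ _ setT f g mf mg.
by move=> /(_ measurableT [set true] I); rewrite /preimage /=.
Qed.

Lemma measurable_set_le f g : measurable_fun setT f -> measurable_fun setT g ->
  measurable [set x | f x <= g x].
Proof.
move=> mf mg; rewrite -[X in measurable X]setTI.
have := @measurable_fun_ler _ _ _ setT f g mf mg.
by move=> /(_ measurableT [set true] I); rewrite /preimage /=.
Qed.

Lemma measurable_set_and P Q : measurable [set x | P x] ->
  measurable [set x | Q x] -> measurable [set x | P x /\ Q x].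
Proof. exact: measurableI. Qed.

Lemma measurable_set_andb b c : measurable [set x | b x] ->
  measurable [set x | c x] -> measurable [set x | b x && c x].
Proof.
move=> mb mc; rewrite (_ : mkset _ = [set x | b x] `&` [set x | c x]).
  exact: measurableI.
by apply/seteqP; split=> x /= => [/andP[]//|[-> ->]].
Qed.

Lemma measurable_set_exists (J : finType) (F : J -> T -> Prop) :
  (forall j, measurable [set x | F j x]) -> measurable [set x | exists j, F j x].
Proof.
move=> mF; rewrite (_ : mkset _ = \bigcup_(j in [set: J]) [set x | F j x]).
  exact: fin_bigcup_measurable.
by apply/seteqP; split=> x /= => [[j ?]|[j _ ?]]; exists j.
Qed.

Lemma measurable_set_cst (A : Prop) : measurable [set x : T | A].
Proof.
have [a|a] := pselect A.
  by rewrite (_ : mkset _ = setT)//; apply/seteqP; split.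
by rewrite (_ : mkset _ = set0)//; apply/seteqP; split.
Qed.

End measurable_comprehension.

(** * Real-valued probabilities and approximately disjoint unions *)

Section real_probability.
Context d (T : measurableType d) (R : realType).
Implicit Types (Q : probability T R) (A B : set T).

Definition pr Q A : R := fine (Q A).

Lemma prE Q A : measurable A -> (pr Q A)%:E = Q A.
Proof. by move=> mA; rewrite /pr fineK// fin_num_measure. Qed.

Lemma pr_ge0 Q A : 0 <= pr Q A.
Proof. exact: fine_ge0. Qed.

Lemma le_pr Q A B : measurable A -> measurable B -> A `<=` B -> pr Q A <= pr Q B.
Proof.
by move=> mA mB AB; rewrite -lee_fin !prE//; apply: le_measure; rewrite ?inE.
Qed.

Lemma pr0 Q : pr Q set0 = 0.
Proof. by rewrite /pr measure0. Qed.

Lemma prU_le Q A B : measurable A -> measurable B ->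
  pr Q (A `|` B) <= pr Q A + pr Q B.
Proof.
move=> mA mB; rewrite -lee_fin EFinD !prE//; last exact: measurableU.
exact: measureU2.
Qed.

Lemma prU Q A B : measurable A -> measurable B -> A `&` B = set0 ->
  pr Q (A `|` B) = pr Q A + pr Q B.
Proof.
move=> mA mB AB; apply: EFin_inj; rewrite EFinD !prE//; last exact: measurableU.
exact: measureU.
Qed.

Lemma pr_split Q A B : measurable A -> measurable B ->
  pr Q A = pr Q (A `&` B) + pr Q (A `&` ~` B).
Proof.
move=> mA mB; rewrite -prU.
- by rewrite -setIUr setUv setIT.
- exact: measurableI.
- by apply: measurableI => //; exact: measurableC.
- by rewrite setIACA setICr setI0.
Qed.

Section finite_families.
Context (J : finType) (Q : probability T R).

Lemma pr_exists_le (P : pred J) (F : J -> set T) : (forall j, measurable (F j)) ->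
  pr Q [set x | exists j, P j /\ F j x] <= \sum_(j | P j) pr Q (F j).
Proof.
move=> mF; rewrite (_ : mkset _ = \big[setU/set0]_(j | P j) F j); last first.
  rewrite -bigcup_seq_cond; apply/seteqP; split=> x /=.
    by move=> [j [Pj Fj]]; exists j; rewrite //= mem_index_enum.
  by move=> [j /= /andP[_ Pj] Fj]; exists j.
suff [] : measurable (\big[setU/set0]_(j | P j) F j) /\
    pr Q (\big[setU/set0]_(j | P j) F j) <= \sum_(j | P j) pr Q (F j) by [].
apply: (big_rec2 (fun B r => measurable B /\ pr Q B <= r)).
  by rewrite pr0.
move=> j r B _ [mB Br]; split; first exact: measurableU.
by apply: (le_trans (prU_le _ _ mB)) => //; rewrite lerD2l.
Qed.

Lemma sum_pr_disjoint_le (P : pred J) (F : J -> set T) (S : set T) :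
  measurable S -> (forall j, measurable (F j)) ->
  (forall j, P j -> F j `<=` S) ->
  (forall i j x, P i -> P j -> F i x -> F j x -> i = j) ->
  \sum_(j | P j) pr Q (F j) <= pr Q S.
Proof.
move=> mS mF FS dF.
have mU (s : seq J) : measurable (\big[setU/set0]_(j <- s | P j) F j).
  exact: bigsetU_measurable.
have inU (s : seq J) x : (\big[setU/set0]_(j <- s | P j) F j) x ->
    exists j, [/\ j \in s, P j & F j x].
  by rewrite -bigcup_seq_cond => -[j /= /andP[js Pj] Fj]; exists j.
suff /(_ _ (index_enum_uniq J)) -> : forall s : seq J, uniq s ->
    \sum_(j <- s | P j) pr Q (F j) = pr Q (\big[setU/set0]_(j <- s | P j) F j).
  apply: le_pr => // x /inU[j [_ Pj Fj]]; exact: (FS j).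
elim=> [|j s ih] /=; first by rewrite !big_nil pr0.
move=> /andP[js us]; rewrite !big_cons; case: ifPn => Pj; last exact: ih.
rewrite ih// prU//.
rewrite -subset0 => x [Fj /inU[k [ks Pk Fk]]].
by have jk := dF _ _ _ Pj Pk Fj Fk; rewrite jk ks in js.
Qed.

(** From above, [S] is covered by the sets [F j] and [B]. From below, the sets [F j] deprived of [B]
    are disjoint parts of [S], and removing [B] costs at most [pr Q B] for each index. No
    inclusion-exclusion is needed, because overlaps occur only inside [B]. *)
Lemma pr_approx_union (P : pred J) (F : J -> set T) (S B : set T) :
  measurable S -> measurable B -> (forall j, measurable (F j)) ->
  (forall x, S x -> ~ B x -> exists j, P j /\ F j x) ->
  (forall j, P j -> F j `<=` S) ->
  (forall i j x, P i -> P j -> i != j -> F i x -> F j x -> B x) ->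
  `|pr Q S - \sum_(j | P j) pr Q (F j)| <= #|J|.+1%:R * pr Q B.
Proof.
move=> mS mB mF SF FS FB.
have mU : measurable [set x | exists j, P j /\ F j x].
  apply: measurable_set_exists => j; apply: measurable_set_and; last exact: mF.
  exact: measurable_set_cst.
have up : pr Q S <= \sum_(j | P j) pr Q (F j) + pr Q B.
  apply: (@le_trans _ _ (pr Q ([set x | exists j, P j /\ F j x] `|` B))).
    apply: le_pr => //; first exact: measurableU.
    by move=> x Sx; have [Bx|/(SF _ Sx)] := pselect (B x); [right|left].
  apply: (le_trans (prU_le _ mU mB)); rewrite lerD2r; exact: pr_exists_le.
have lo : \sum_(j | P j) pr Q (F j) <= pr Q S + #|J|%:R * pr Q B.
  apply: (@le_trans _ _ (\sum_(j | P j) (pr Q (F j `&` ~` B) + pr Q B))).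
    apply: ler_sum => j _; rewrite (pr_split Q (mF j) mB) addrC lerD2l.
    by apply: le_pr => //; exact: measurableI.
  rewrite big_split/=; apply: lerD.
    apply: sum_pr_disjoint_le => //.
    - by move=> j; apply: measurableI => //; exact: measurableC.
    - by move=> j Pj x [Fj _]; exact: (FS j).
    - move=> i j x Pi Pj [Fi nB] [Fj _]; apply/eqP/negPn/negP => ij.
      exact/nB/(FB i j).
  apply: (@le_trans _ _ (\sum_(j : J) pr Q B)).
    by rewrite [leRHS](bigID P)/= lerDl sumr_ge0// => *; exact: pr_ge0.
  by rewrite sumr_const mulr_natl.
have B0 := pr_ge0 Q B.
have n0 : 0 <= #|J|%:R * pr Q B by rewrite mulr_ge0.
rewrite -natr1 mulrDl mul1r ler_norml.
by apply/andP; split; lra.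
Qed.

End finite_families.

End real_probability.

(** * The uniform law on the unit interval *)

Section uniform_law.
Context (R : realType).
Local Notation RB := (measurableTypeR R).
Local Notation mu := (uniform_prob (@ltr01 R)).

Lemma uniform_prob_lebesgue (A : set RB) : measurable A ->
  mu A = lebesgue_measure (A `&` `[0, 1]).
Proof.
move=> mA; rewrite /uniform_prob integral_uniform_pdf.
rewrite (eq_integral (fun=> 1%E)); last first.
  by move=> x; rewrite inE/= in_itv/= /uniform_pdf => -[_ ->]; rewrite subr0 invr1.
by rewrite integral_cst ?mul1e//; exact: measurableI.
Qed.

Lemma uniform_prob_itv (b c : bool) (x y : R) : 0 <= x -> x <= y -> y <= 1 ->
  mu [set` Interval (BSide b x) (BSide c y)] = (y - x)%:E.
Proof.
move=> x0 xy y1; rewrite uniform_prob_lebesgue//.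
rewrite setIidl; last first.
  move=> z /=; rewrite !itv_boundlr !bnd_simp => /andP[xz zy].
  have {}xz : x <= z by case: b xz => /=; rewrite ?bnd_simp => // /ltW.
  have {}zy : z <= y by case: c zy => /=; rewrite ?bnd_simp => // /ltW.
  by rewrite (le_trans x0 xz) (le_trans zy y1).
rewrite lebesgue_measure_itv/= lte_fin; case: ltP => // yx.
by rewrite (@le_anti _ _ x y) ?subrr// xy yx.
Qed.

(** [A] lies in [[inf A, inf A + r]]. Sections of events can thus be estimated from pairwise
    distances alone, without identifying them as intervals. *)
Lemma uniform_prob_diam (A : set RB) (r : R) : measurable A -> 0 <= r ->
  A `<=` `]0, 1[ -> (forall u v, A u -> A v -> u < v -> v - u <= r) ->
  (mu A <= r%:E)%E.
Proof.
move=> mA r0 A01 Ar.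
have [->|/set0P A0] := eqVneq A set0; first by rewrite measure0 lee_fin.
have lA : has_lbound A by exists 0 => u /A01 /=; rewrite in_itv/= => /andP[/ltW].
rewrite uniform_prob_lebesgue//.
apply: (@le_trans _ _ (lebesgue_measure `[inf A, inf A + r])).
  apply: le_measure; rewrite ?inE//; first exact: measurableI.
  move=> v [Av _] /=; rewrite in_itv/= ge_inf//=.
  rewrite -lerBlDr; apply: lb_le_inf => // u Au.
  have [vu|vu] := leP v u; first by rewrite lerBlDr (le_trans vu)// lerDl.
  by rewrite lerBlDr addrC -lerBlDr; exact: Ar.
rewrite lebesgue_measure_itv/= lte_fin; case: ifP => _; last by rewrite lee_fin.
by rewrite -EFinB addrAC subrr add0r.
Qed.

Lemma uniform_prob_oo : mu `]0, 1[ = 1%E.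
Proof. by rewrite uniform_prob_itv// subr0. Qed.

End uniform_law.

(** * Tails of the aggregate under independence *)

Section transform_bounds.
Context (R : realType).
Implicit Types (u v x y : R) (S : statistic).

Lemma tan_expanding x y : 0 <= x -> x < y -> y < pi / 2 -> y - x <= tan y - tan x.
Proof.
move=> x0 xy ypi.
have cosN0 z : x <= z <= y -> 0 < cos z.
  move=> /andP[xz zy]; apply: cos_gt0_pihalf; rewrite (le_lt_trans zy ypi) andbT.
  by rewrite (lt_le_trans _ (le_trans x0 xz))// oppr_lt0 divr_gt0// pi_gt0.
have [||z] := @MVT R tan (fun z => (cos z)^-2) x y xy.
- move=> z; rewrite in_itv/= => /andP[xz zy]; apply: is_derive_tan.
  by rewrite gt_eqF// cosN0// !ltW.
- apply: derivable_within_continuous => z; rewrite in_itv/= => xzy.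
  by apply: derivable_tan; rewrite gt_eqF// cosN0.
rewrite in_itv/= => /andP[xz zy] ->.
rewrite ler_peMl ?subr_ge0 ?(ltW xy)//.
have cz : 0 < cos z by rewrite cosN0// !ltW.
by rewrite invf_ge1 ?exprn_gt0// expr_le1// ?cos_le1// ltW.
Qed.

Lemma cotE x : cot x = (tan x)^-1.
Proof. by rewrite /cot /tan invf_div. Qed.

Lemma scaled_arc u : 0 < u < 1 -> 0 < pi * u / 2 < pi / 2.
Proof.
move=> /andP[u0 u1]; have p0 := pi_gt0 R; apply/andP; split.
  by rewrite divr_gt0// mulr_gt0.
by rewrite ltr_pM2r// -[ltRHS]mulr1 ltr_pM2l.
Qed.

Lemma transform_gt0 S u : 0 < u < 1 -> 0 < transform S u.
Proof.
case: S => /= u01; first by rewrite invr_gt0; case/andP: u01.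
have /andP[h0 h1] := scaled_arc u01.
rewrite /cot divr_gt0//; last by apply: sin_gt0_pihalf; rewrite h0 h1.
by apply: cos_gt0_pihalf; rewrite h1 (lt_trans _ h0)// oppr_lt0 divr_gt0// pi_gt0.
Qed.

(** The inverse of the transform is u or tan(pi u / 2), and the latter has derivative at least pi /
    2 >= 1. Hence values of u whose inverse transforms are close must be at least as close
    themselves; the bounded density of the sum rests on this. *)
Lemma inv_transform_expanding S u v : 0 < u -> u < v -> v < 1 ->
  v - u <= (transform S v)^-1 - (transform S u)^-1.
Proof.
move=> u0 uv v1; case: S => /=; first by rewrite !invrK.
rewrite !cotE !invrK.
have /andP[xv1 xv2] : 0 < pi * v / 2 < pi / 2 by apply: scaled_arc; rewrite v1 (lt_trans u0).
have /andP[xu1 xu2] : 0 < pi * u / 2 < pi / 2 by apply: scaled_arc; rewrite u0 (lt_trans uv).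
apply: (@le_trans _ _ (pi * v / 2 - pi * u / 2)); last first.
  apply: tan_expanding => //; first exact: ltW.
  by rewrite ltr_pM2r// ltr_pM2l// pi_gt0.
have := pi_ge2 R; nra.
Qed.

Lemma scale_const_gt0 S : 0 < scale_const R S.
Proof. by case: S => //=; rewrite divr_gt0// pi_gt0. Qed.

Lemma scale_const_le1 S : scale_const R S <= 1.
Proof. by case: S => //=; rewrite ler_pdivrMr ?pi_gt0// mul1r pi_ge2. Qed.

Lemma transform_le S u : 0 < u < 1 -> transform S u <= scale_const R S / u.
Proof.
move=> /[dup] u01 /andP[u0 u1]; case: S => /=; first by rewrite mul1r.
have /andP[h0 h1] := scaled_arc u01; rewrite cotE.
have p0 := pi_gt0 R.
have xt := tan_expanding (lexx 0) h0 h1; rewrite tan0 !subr0 in xt.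
have -> : 2 / pi / u = (pi * u / 2)^-1 by rewrite !invfM invrK; ring.
by rewrite lef_pV2// posrE//; exact: lt_le_trans xt.
Qed.

(** For the cotangent put x = pi u / 2: from cos x + sin x >= 1 and sin x <= x follows cot x + 1 =
    (cos x + sin x) / sin x >= 1 / x. *)
Lemma transform_ge S u : 0 < u < 1 -> scale_const R S / u - 1 <= transform S u.
Proof.
move=> /[dup] u01 /andP[u0 u1]; case: S => /=; first by rewrite mul1r; lra.
have /andP[] := scaled_arc u01; have p0 := pi_gt0 R.
have -> : 2 / pi / u = (pi * u / 2)^-1 by rewrite !invfM invrK; ring.
move: (pi * u / 2) => x x0 x1; rewrite /cot.
have s0 : 0 < sin x by apply: sin_gt0_pihalf; rewrite x0 x1.
have c0 : 0 < cos x.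
  by apply: cos_gt0_pihalf; rewrite x1 (lt_trans _ x0)// oppr_lt0 divr_gt0.
have sx : sin x <= x.
  have [|z _ E] := @MVT R sin cos 0 x x0.
    by apply: continuous_subspaceT => z; exact: continuous_sin.
  move: E; rewrite sin0 !subr0 => ->; rewrite ler_piMl// ?cos_le1// ltW//.
have cs := cos2Dsin2 x.
have cs1 : 1 <= cos x + sin x by nra.
rewrite lerBlDr -[X in _ + X](mulfV (lt0r_neq0 s0)) -mulrDl.
rewrite ler_pdivlMr// mulrC ler_pdivrMr//; nra.
Qed.

End transform_bounds.

Lemma sum_le_card (R : realType) (J : finType) (P : pred J) (f : J -> R) (r : R) :
  0 <= r -> (forall j, P j -> f j <= r) -> \sum_(j | P j) f j <= #|J|%:R * r.
Proof.
move=> r0 fr; apply: (@le_trans _ _ (\sum_(j | P j) r)); first exact: ler_sum.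
apply: (@le_trans _ _ (\sum_(j : J) r)).
  by rewrite [leRHS](bigID P)/= lerDl sumr_ge0.
by rewrite sumr_const mulr_natl.
Qed.

Section independence_copula.
Context (R : realType) (m : nat).
Local Notation RB := (measurableTypeR R).
Local Notation mu := (uniform_prob (@ltr01 R)).
Local Notation Pi := (indep_copula R m).
Implicit Types (i j k : 'I_m) (A B D : set (m.-tuple RB)).

Lemma measurable_unit_cube n : measurable (@unit_cube R n).
Proof.
apply: (measurable_box (A := fun=> [set u : RB | 0 < u < 1])) => _.
rewrite (_ : mkset _ = `]0, 1[%classic); first exact: measurable_itv.
by apply/seteqP; split=> x /=; rewrite in_itv.
Qed.

Lemma measurable_ratio (c : R) i :
  measurable_fun setT (fun x : m.-tuple RB => c / tnth x i).
Proof.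
apply: measurable_funM => //.
exact: (measurableT_comp (@measurable_transform R Reciprocal) (measurable_tnth i)).
Qed.

Lemma measurable_section A i x : measurable A -> measurable [set u : RB | A (upd x i u)].
Proof.
move=> mA; have mphi : measurable_fun setT (fun u : RB => upd x i u).
  apply/measurable_fun_tnthP => k; rewrite (_ : _ \o _ =
      fun u => if k == i then u else tnth x k); first by case: (k == i).
  by apply/funext => u /=; rewrite tnth_upd.
by rewrite -[X in measurable X]setTI; exact: mphi.
Qed.

Lemma upd_cube x i (u : RB) : unit_cube (upd x i u) -> 0 < u < 1.
Proof. by move=> /(_ i); rewrite tnth_upd eqxx. Qed.

Lemma indep_resample_le A i (r : R) : measurable A ->
  (forall x, (mu [set u | A (upd x i u)] <= r%:E)%E) -> pr Pi A <= r.
Proof.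
move=> mA Ar; rewrite -lee_fin prE//.
rewrite [X in (X <= _)%E](prod_measure_resample mu i mA).
apply: (@le_trans _ _ (\int[prod_measure mu m]_x r%:E)%E).
  apply: ge0_le_integral => //; first exact: measurable_resample.
  by move=> x _; exact: Ar.
rewrite integral_cst// [X in (_ * X)%E](prod_measure_setT mu m) mule1.
by rewrite lexx.
Qed.

(** Two successive conditionings: resampling [i] leaves [g x * \1_D x], and resampling [j] then acts
    on [D] only, because [g] ignores the coordinate [j]. The function [g] may be unbounded; only its
    product with the conditional probability of [D] has to be controlled. *)
Lemma indep_resample2_le A D i j (g : m.-tuple RB -> R) (r : R) :
  measurable A -> measurable D -> measurable_fun setT g -> (forall x, 0 <= g x) ->
  (forall x u, g (upd x j u) = g x) ->
  (forall x, (mu [set u | A (upd x i u)] <= (g x * \1_D x)%:E)%E) ->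
  (forall x, ((g x)%:E * mu [set u | D (upd x j u)] <= r%:E)%E) ->
  pr Pi A <= r.
Proof.
move=> mA mD mg g0 gj Ag Dr; rewrite -lee_fin prE//.
rewrite [X in (X <= _)%E](prod_measure_resample mu i mA).
have mgD : measurable_fun setT (fun x => (g x * \1_D x)%:E).
  by apply/measurable_EFinP; apply: measurable_funM => //; exact: measurable_indic.
have gD0 x : (0 <= (g x * \1_D x)%:E)%E by rewrite lee_fin mulr_ge0.
apply: (@le_trans _ _ (\int[prod_measure mu m]_x (g x * \1_D x)%:E)%E).
  apply: ge0_le_integral => //; first exact: measurable_resample.
  by move=> x _; exact: Ag.
rewrite (ge0_integral_resample mu j mgD gD0).
have E x : (\int[mu]_u (g (upd x j u) * \1_D (upd x j u))%:E =
    (g x)%:E * mu [set u | D (upd x j u)])%E.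
  under eq_integral do rewrite gj EFinM.
  rewrite ge0_integralZl_EFin//; last first.
    apply/measurable_EFinP.
    exact: (measurable_indic (measurable_section j x mD)).
  congr (_ * _)%E; rewrite [LHS](integral_indic mu measurableT) ?setIT//.
  exact: measurable_section.
under eq_integral do rewrite E.
apply: (@le_trans _ _ (\int[prod_measure mu m]_x r%:E)%E).
  apply: ge0_le_integral => //.
  - by move=> x _; rewrite mule_ge0// lee_fin.
  - apply: emeasurable_funM; first exact/measurable_EFinP.
    exact: measurable_resample.
rewrite integral_cst// [X in (_ * X)%E](prod_measure_setT mu m) mule1.
by rewrite lexx.
Qed.

Lemma indep_rect i j (E F : set RB) : i != j -> measurable E -> measurable F ->
  Pi [set x | E (tnth x i) /\ F (tnth x j)] = (mu E * mu F)%E.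
Proof.
move=> ij mE mF; rewrite -product_measure1E//.
rewrite -(prod_measure_pair mu ij)//; exact: measurableX.
Qed.

End independence_copula.

Section aggregate_tail.
Context (R : realType) (m : nat).
Local Notation RB := (measurableTypeR R).
Local Notation mu := (uniform_prob (@ltr01 R)).
Local Notation Pi := (indep_copula R m).
Implicit Types (i j k : 'I_m) (S : statistic) (w a : 'I_m -> R).

Lemma measurable_aggregate S w : measurable_fun setT (aggregate S w : m.-tuple RB -> R).
Proof. exact: measurable_funP. Qed.

Lemma measurable_summand S (c : R) i :
  measurable_fun setT (fun x : m.-tuple RB => c * transform S (tnth x i)).
Proof.
apply: measurable_funM => //.
exact: (measurableT_comp (measurable_transform S) (measurable_tnth i)).
Qed.

Lemma aggregate_upd S w x i (u v : RB) :
  aggregate S w (upd x i u) - aggregate S w (upd x i v) =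
  w i * (transform S u - transform S v).
Proof.
rewrite /aggregate (bigD1 i)//= [X in _ - X](bigD1 i)//= !tnth_upd eqxx.
rewrite (eq_bigr (fun k => w k * transform S (tnth x k))) => [|k /negPf ki]; last first.
  by rewrite tnth_upd ki.
rewrite [X in _ - (_ + X)](eq_bigr (fun k => w k * transform S (tnth x k))) => [|k /negPf ki]; last first.
  by rewrite tnth_upd ki.
by rewrite opprD addrACA subrr addr0 mulrBr.
Qed.

Lemma exists_large_summand (f : 'I_m -> R) (s : R) : 0 < s -> s < \sum_i f i ->
  exists i, s / m%:R <= f i.
Proof.
move=> s0 sf; apply: contrapT => /forallNP nf.
suff : \sum_i f i <= s by move=> /(lt_le_trans sf); rewrite ltxx.
have [m0|m0] := posnP m.
  by move: f sf nf; rewrite m0 => f; rewrite big_ord0 => /(lt_trans s0); rewrite ltxx.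
apply: (@le_trans _ _ (\sum_(i < m) s / m%:R)).
  by apply: ler_sum => i _; have /negP := nf i; rewrite -ltNge => /ltW.
by rewrite sumr_const card_ord -[leLHS]mulr_natr divfK// pnatr_eq0 -lt0n.
Qed.

(* Conditioning on all coordinates but [i]: 1/psi expands distances, so the
   values of u_i that keep the sum in (s, t] while w_i psi(u_i) >= s/m fill at
   most m^2 (t-s)/s^2. *)
Lemma indep_aggregate_itv S w (s t : R) : (forall i, 0 < w i <= 1) ->
  0 < s -> s <= t ->
  pr Pi [set x | unit_cube x /\ s < aggregate S w x <= t] <=
    m%:R ^+ 3 * (t - s) / s ^+ 2.
Proof.
move=> w01 s0 st.
pose F i := [set x : m.-tuple RB | (unit_cube x /\ s < aggregate S w x <= t) /\
    s / m%:R <= w i * transform S (tnth x i)].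
have mE : measurable [set x : m.-tuple RB | unit_cube x /\ s < aggregate S w x <= t].
  apply: measurable_set_and; first exact: measurable_unit_cube.
  apply: measurable_set_andb.
    by apply: measurable_set_lt => //; exact: measurable_aggregate.
  by apply: measurable_set_le => //; exact: measurable_aggregate.
have mF i : measurable (F i).
  apply: measurable_set_and => //.
  by apply: measurable_set_le => //; exact: measurable_summand.
apply: (@le_trans _ _ (pr Pi [set x | exists i, true /\ F i x])).
  apply: le_pr => //.
    by apply: measurable_set_exists => i; apply: measurable_set_and; [exact: measurable_set_cst|exact: mF].
  move=> x [cx /[dup] sx /andP[/(exists_large_summand s0) [i ix] _]].
  by exists i.
apply: (le_trans (pr_exists_le Pi xpredT mF)).
have d0 : 0 <= (t - s) / s ^+ 2 by rewrite divr_ge0 ?subr_ge0// exprn_ge0// ltW.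
(* One of the three factors m pays for the union over the index of the large summand. *)
have -> : m%:R ^+ 3 * (t - s) / s ^+ 2 = #|'I_m|%:R * (m%:R ^+ 2 * ((t - s) / s ^+ 2)).
  by rewrite card_ord; ring.
apply: sum_le_card => [|i _]; first by rewrite mulr_ge0.
have m0 : 0 < m%:R :> R by rewrite ltr0n; case: (m) (i) => [[]|].
apply: (@indep_resample_le _ _ _ i) => // x.
have /andP[wi0 wi1] := w01 i.
apply: uniform_prob_diam.
- exact: measurable_section.
- by rewrite mulr_ge0.
- by move=> u [[/upd_cube u01 _] _]; rewrite /= in_itv.
move=> u v [[/upd_cube/andP[u0 u1] /andP[_ ut]]]; rewrite tnth_upd eqxx => su.
move=> [[/upd_cube/andP[v0 v1] /andP[sv _]]]; rewrite tnth_upd eqxx => sv' uv.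
apply: (le_trans (inv_transform_expanding S u0 uv v1)).
have dd := aggregate_upd S w x i u v.
have pu : 0 < transform S u by apply: transform_gt0; rewrite u0.
have pv : 0 < transform S v by apply: transform_gt0; rewrite v0.
move: (transform S u) (transform S v) dd pu pv su sv' => p q dd pu pv su sv'.
have sm0 : 0 < s / m%:R by rewrite divr_gt0.
have -> : q^-1 - p^-1 = (p - q) / (p * q).
  by field; rewrite !gt_eqF.
rewrite ler_pdivrMr ?mulr_gt0//.
have h1 : (s / m%:R) ^+ 2 <= p * q * (w i) ^+ 2.
  rewrite expr2 [leRHS](_ : _ = (w i * p) * (w i * q)); last by ring.
  by apply: ler_pM => //; exact: ltW.
have h2 : w i * (p - q) <= t - s by rewrite -dd; lra.
rewrite -(ler_pM2l wi0); apply: (le_trans h2).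
have -> : w i * (m%:R ^+ 2 * ((t - s) / s ^+ 2) * (p * q)) =
   (t - s) * ((m%:R / s) ^+ 2 * (p * q * w i)).
  by field; rewrite gt_eqF.
rewrite ler_peMr ?subr_ge0//.
have h3 : p * q * w i ^+ 2 <= p * q * w i.
  by rewrite ler_pM2l ?mulr_gt0// expr2 ler_piMl// ltW.
apply: (@le_trans _ _ ((m%:R / s) ^+ 2 * (s / m%:R) ^+ 2)); last first.
  rewrite ler_pM2l ?exprn_gt0 ?divr_gt0//; exact: le_trans h3.
by rewrite -exprMn mulrA divfK ?gt_eqF// divff ?gt_eqF// expr1n.
Qed.

End aggregate_tail.

(** * Decomposition of a large sum *)

Section one_big_jump.
Context (R : realType) (m : nat) (X : 'I_m -> R) (t e : R).
Hypotheses (t0 : 0 < t) (X0 : forall i, 0 < X i).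
Hypothesis eE : e = t / (4 * m%:R).
Hypothesis no_pair : forall i j, i != j -> e < X i -> X j <= e.
(** [b] selects the quantity that may not lie just below the level: X_i alone, or X_i + X_j. The
    forbidden gap m X_k is what m summands of size X_k could fill. The first case serves uniqueness
    of the exceeding pair, the second its existence. *)
Hypothesis no_triple : forall (b : bool) i j k, i != j -> i != k -> j != k ->
  X j <= e -> X k <= X j -> X i <= t - b%:R * X j -> X i <= t - b%:R * X j - m%:R * X k.

(** The diagonal pair [(i, i)] stands for X_i alone passing t, so that one family indexed by the
    pairs with [p.1 <= p.2] contains both kinds of events. *)
Definition exceeds (p : 'I_m * 'I_m) : bool :=
  if p.1 == p.2 then t < X p.1
  else [&& X p.1 <= t, X p.2 <= t & t < X p.1 + X p.2].

Lemma exceeds_swap i j : exceeds (i, j) = exceeds (j, i).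
Proof.
rewrite /exceeds /= eq_sym; case: eqP => [->//|_].
by rewrite andbCA addrC.
Qed.

Let m_gt0 (i : 'I_m) : 0 < m%:R :> R.
Proof. by rewrite ltr0n; case: (m) i => [[]|]. Qed.

Let e_lt (i : 'I_m) : e <= t / 4.
Proof.
have t4 : 0 <= t / 4 by rewrite divr_ge0// ltW.
rewrite eE invfM mulrA ler_pdivrMr ?m_gt0// ler_peMr//.
by rewrite ler1n; case: (m) i => [[]|].
Qed.

(** Some X_i is at least t / m > e, so all others are at most e. If neither X_i nor any X_i + X_j
    passes t, take for X_j the largest of the others: by [no_triple] with [b = true], each further
    X_k is at most D / m, where D = t - X_i - X_j is the slack, and together they cannot bring the
    sum above t. *)
Lemma sum_gt_exceeds : t < \sum_i X i -> exists p : 'I_m * 'I_m, (p.1 <= p.2)%N /\ exceeds p.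
Proof.
move=> tX; have [i ti] := exists_large_summand t0 tX.
have mi := m_gt0 i; have et := e_lt i.
have ei : e < X i.
  apply: lt_le_trans ti; rewrite eE invfM mulrA ltr_pM2r ?invr_gt0//.
  by rewrite ltr_pdivrMr// ltr_pMr// ltr1n.
have Xj j : j != i -> X j <= e by rewrite eq_sym => ij; exact: no_pair ij ei.
have sym i' j' : exceeds (i', j') -> exists p : 'I_m * 'I_m, (p.1 <= p.2)%N /\ exceeds p.
  move=> ex; have [ij|/ltnW ij] := leqP i' j'; first by exists (i', j').
  by exists (j', i'); rewrite exceeds_swap.
have [iit|tii] := ltP t (X i); first by exists (i, i); rewrite /exceeds eqxx.
have [[j [ij tij]]|nj] := pselect (exists j, j != i /\ t < X i + X j).
  apply: (sym i j); rewrite /exceeds /= eq_sym (negPf ij) tii tij andbT /=.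
  by have := Xj j ij; lra.
have [|/forallNP nji] := pselect (exists j, j != i); last first.
  exfalso; move: tX; rewrite (bigD1 i)//= big_pred0 ?addr0 => [|j].
    by rewrite ltNge tii.
  by apply/negbTE/negP/nji.
move=> [j0 j0i]; exfalso.
case: (@arg_maxP _ _ _ j0 (fun j => j != i) X j0i) => j ji jmax.
have tij : X i + X j <= t by rewrite leNgt; apply/negP => h; apply: nj; exists j.
pose D := t - X i - X j.
have D0 : 0 <= D by rewrite /D; lra.
suff : \sum_k X k <= t by move=> /(lt_le_trans tX); rewrite ltxx.
rewrite (bigD1 i)//= (bigD1 j)//=.
suff : \sum_(k < m | (k != i) && (k != j)) X k <= #|'I_m|%:R * (D / m%:R).
  by rewrite card_ord mulrC divfK ?gt_eqF// /D => ?; lra.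
apply: sum_le_card => [|k /andP[ki kj]]; first by rewrite divr_ge0// ltW.
rewrite ler_pdivlMr// mulrC /D.
have := @no_triple true i j k.
rewrite mul1r eq_sym ji eq_sym ki eq_sym kj => /(_ isT isT isT (Xj _ ji) (jmax _ ki)).
by move=> h; have := h ltac:(lra); lra.
Qed.

(** Each exceeding pair has a member z with X_z > e, and [no_pair] makes z common to both. If the
    partners differ and y2 is the smaller one, then t < X_z + X_y2 contradicts X_z <= t - m X_y2,
    which is [no_triple] with [b = false]. *)
Lemma exceeds_unique (p q : 'I_m * 'I_m) : (p.1 <= p.2)%N -> (q.1 <= q.2)%N ->
  exceeds p -> exceeds q -> p = q.
Proof.
have t0' := t0.
have main r : exceeds r -> exists z y, [/\ r = (z, y) \/ r = (y, z), e < X z &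
    (z = y /\ t < X z) \/ [/\ z != y, X z <= t, X y <= t & t < X z + X y]].
  case: r => i j; rewrite /exceeds /=; case: eqP => [<-|/eqP ij].
    move=> ti; exists i, i; split; [by left| |by left].
    by have := e_lt i; lra.
  case/and3P => it jt tij.
  have et := e_lt i.
  have [ji|ij'] := leP (X j) (X i).
    by exists i, j; split; [left| lra |right; split].
  by exists j, i; split; [right| lra |right; split; rewrite // 1?eq_sym 1?addrC].
move=> pp qq /main[z [y [pE ez Hp]]] /main[z' [y' [qE ez' Hq]]].
have zz : z = z'.
  apply/eqP/negPn/negP => nzz; have := no_pair nzz ez; lra.
rewrite -{z'}zz in qE ez' Hq.
have uniqp (r : 'I_m * 'I_m) (y1 : 'I_m) : (r.1 <= r.2)%N -> r = (z, y1) \/ r = (y1, z) ->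
    r = if (z <= y1)%N then (z, y1) else (y1, z).
  move=> + [rE|rE]; rewrite rE/=; first by move=> ->.
  move=> yz; case: leqP => // zy.
  by have /val_inj -> : (z = y1 :> nat) by apply/eqP; rewrite eqn_leq zy yz.
case: Hp => [[zy tz]|[zy zt yt tzy]]; case: Hq => [[zy' tz']|[zy' zt' yt' tzy']].
- rewrite -zy in pE; rewrite -zy' in qE.
  by rewrite (uniqp _ _ pp pE) (uniqp _ _ qq qE).
- by move: (lt_le_trans tz zt'); rewrite ltxx.
- by move: (lt_le_trans tz' zt); rewrite ltxx.
have [yy|yy] := eqVneq y y'.
  by rewrite -yy in qE; rewrite (uniqp _ _ pp pE) (uniqp _ _ qq qE).
exfalso.
have ye := no_pair zy ez; have ye' := no_pair zy' ez.
have m1 : 1 <= m%:R :> R by rewrite ler1n (leq_ltn_trans _ (ltn_ord z)).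
have abs y1 y2 : z != y1 -> z != y2 -> y1 != y2 -> X y1 <= e -> X y2 <= X y1 ->
    t < X z + X y2 -> False.
  move=> n1 n2 n12 h1 h2 h3; have := @no_triple false z y1 y2 n1 n2 n12 h1 h2.
  rewrite mul0r subr0 => /(_ zt).
  have := X0 y2; nra.
have [yy'|y'y] := leP (X y') (X y); first exact: (abs y y').
by apply: (abs y' y) => //; [rewrite eq_sym|exact: ltW].
Qed.

End one_big_jump.

(** * The discarded event and its probability under independence *)

Section bad_events.
Context (R : realType) (m : nat) (a : 'I_m -> R).
Hypothesis a01 : forall i, 0 < a i <= 1.
Local Notation RB := (measurableTypeR R).
Local Notation mu := (uniform_prob (@ltr01 R)).
Local Notation Pi := (indep_copula R m).
Implicit Types (i j k : 'I_m).

Definition ratio (x : m.-tuple RB) i : R := a i / tnth x i.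

Lemma measurable_ratio_fun i : measurable_fun setT (fun x => ratio x i).
Proof. exact: measurable_ratio. Qed.

Lemma ratio_gt0 x i : unit_cube x -> 0 < ratio x i.
Proof.
by move=> /(_ i)/andP[x0 _]; rewrite divr_gt0//; have /andP[] := a01 i.
Qed.

Lemma ratio_upd x i (u : RB) k :
  ratio (upd x i u) k = if k == i then a i / u else ratio x k.
Proof. by rewrite /ratio tnth_upd; case: eqP => // ->. Qed.

Lemma uniform_prob_ratio_tail (A : set RB) (c z : R) : measurable A -> 0 < c -> 0 < z ->
  (forall u, A u -> 0 < u < 1 /\ z <= c / u) -> (mu A <= (c / z)%:E)%E.
Proof.
move=> mA c0 z0 Az; apply: uniform_prob_diam => //.
- by rewrite divr_ge0// ltW.
- by move=> u /Az[u01 _]; rewrite /= in_itv.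
move=> u v /Az[/andP[u0 _] _] /Az[/andP[v0 _]]; rewrite ler_pdivlMr// mulrC.
by rewrite -ler_pdivlMr// => vz _; lra.
Qed.

Lemma uniform_prob_ratio_itv (A : set RB) (c z y : R) : measurable A ->
  0 < c -> 0 < z -> z <= y ->
  (forall u, A u -> 0 < u < 1 /\ z < c / u <= y) ->
  (mu A <= (c * (y - z) / (z * y))%:E)%E.
Proof.
move=> mA c0 z0 zy Az; have y0 : 0 < y := lt_le_trans z0 zy.
have -> : c * (y - z) / (z * y) = c / z - c / y by field; rewrite !gt_eqF.
apply: uniform_prob_diam => //.
- by rewrite subr_ge0 ler_pM2l// lef_pV2// posrE.
- by move=> u /Az[u01 _]; rewrite /= in_itv.
move=> u v /Az[/andP[u0 _] /andP[_]]; rewrite ler_pdivrMr// mulrC -ler_pdivrMr// => yu.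
move=> /Az[/andP[v0 _] /andP[zv _] _]; rewrite ltr_pdivlMr// mulrC -ltr_pdivlMr// in zv.
lra.
Qed.

Definition two_large (s : R) i j : set (m.-tuple RB) :=
  [set x | unit_cube x /\ (s < ratio x i /\ s < ratio x j)].

Lemma measurable_two_large s i j : measurable (two_large s i j).
Proof.
apply: measurable_set_and; first exact: measurable_unit_cube.
by apply: measurable_set_and; apply: measurable_set_lt => //; exact: measurable_ratio_fun.
Qed.

(** The configurations that violate [no_triple]. The clause with t / 2 costs nothing, since b X_j +
    m X_k <= 2 m X_j <= t / 2 when X_k <= X_j <= t / (4 m). It keeps the window for X_i, of width n
    X_k, above t / 2, where it has probability at most 4 n X_k / t^2. *)
Definition near_level (b : bool) (n t : R) i j k : set (m.-tuple RB) :=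
  [set x | unit_cube x /\ [/\ ratio x k <= ratio x j,
    t / 2 <= t - b%:R * ratio x j - n * ratio x k,
    t - b%:R * ratio x j - n * ratio x k < ratio x i &
    ratio x i <= t - b%:R * ratio x j]].

Lemma measurable_near_level b n t i j k : measurable (near_level b n t i j k).
Proof.
have mY : measurable_fun setT (fun x : m.-tuple RB => t - b%:R * ratio x j).
  apply: measurable_funB => //; apply: measurable_funM => //.
  exact: measurable_ratio_fun.
have mZ : measurable_fun setT (fun x : m.-tuple RB => t - b%:R * ratio x j - n * ratio x k).
  apply: measurable_funB => //; apply: measurable_funM => //.
  exact: measurable_ratio_fun.
apply: measurable_set_and; first exact: measurable_unit_cube.
rewrite (_ : mkset _ = [set x : m.-tuple RB | [&& ratio x k <= ratio x j,
    t / 2 <= t - b%:R * ratio x j - n * ratio x k,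
    t - b%:R * ratio x j - n * ratio x k < ratio x i &
    ratio x i <= t - b%:R * ratio x j]]); last first.
  by apply/seteqP; split=> x /=; [move=> /and4P|move=> /and4P].
repeat (apply: measurable_set_andb);
  (apply: measurable_set_le || apply: measurable_set_lt) => //;
  exact: measurable_ratio_fun.
Qed.

Lemma indep_two_large i j (s : R) : i != j -> 0 < s ->
  pr Pi (two_large s i j) <= s^-1 ^+ 2.
Proof.
move=> ij s0.
pose E k := [set u : RB | 0 < u < 1 /\ s < a k / u].
have mE k : measurable (E k).
  have mr : measurable_fun setT (fun u : RB => a k / u).
    by apply: measurable_funM => //; exact: (@measurable_transform R Reciprocal).
  apply: measurable_set_and; last exact: measurable_set_lt.
  rewrite (_ : mkset _ = `]0, 1[%classic); first exact: measurable_itv.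
  by apply/seteqP; split=> u /=; rewrite in_itv.
have Es k : (mu (E k) <= (s^-1)%:E)%E.
  have /andP[a0 a1] := a01 k.
  apply: (@le_trans _ _ (a k / s)%:E).
    by apply: uniform_prob_ratio_tail => // u [u01 /ltW].
  by rewrite lee_fin ler_piMl// invr_ge0 ltW.
have mEE : measurable [set x : m.-tuple RB | E i (tnth x i) /\ E j (tnth x j)].
  by apply: measurable_set_and; rewrite -[X in measurable X]setTI; exact: measurable_tnth.
apply: (@le_trans _ _ (pr Pi [set x : m.-tuple RB | E i (tnth x i) /\ E j (tnth x j)])).
  apply: le_pr => //.
    exact: measurable_two_large.
  by move=> x [cx [hi hj]]; split; (split; first exact: cx).
rewrite -lee_fin prE// [leLHS]indep_rect// expr2 EFinM.
by apply: lee_pmul.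
Qed.

(* Conditioning first on (x_j, x_k), then bounding the mean of X_k 1{X_k <= X_j}
   by a_j: given x_k, the event X_k <= a_j / u has probability at most a_j / X_k. *)
Lemma indep_near_level (b : bool) i j k (n t : R) : i != j -> i != k -> j != k ->
  0 <= n -> 0 < t ->
  pr Pi (near_level b n t i j k) <= 4 * n / t ^+ 2.
Proof.
move=> ij ik jk n0 t0; set A := near_level b n t i j k.
pose D := [set x : m.-tuple RB | [/\ 0 < tnth x k, 0 < tnth x j < 1 & ratio x k <= ratio x j]].
(* The absolute value makes [g] nonnegative at every tuple, also off the cube, where the ratio may
   be negative. *)
pose g x : R := 4 * n * `|ratio x k| / t ^+ 2.
have mA : measurable A := measurable_near_level b n t i j k.
have mD : measurable D.
  rewrite (_ : D = [set x : m.-tuple RB | [&& 0 < tnth x k, 0 < tnth x j < 1 & ratio x k <= ratio x j]]); last first.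
    by apply/seteqP; split=> x /= /and3P.
  repeat (apply: measurable_set_andb);
    (apply: measurable_set_le || apply: measurable_set_lt) => //;
    by [exact: measurable_ratio_fun | exact: measurable_tnth].
have /andP[ai0 ai1] := a01 i; have /andP[aj0 aj1] := a01 j; have /andP[ak0 ak1] := a01 k.
have t2 : 0 <= (t ^+ 2)^-1 by rewrite invr_ge0 exprn_ge0// ltW.
have r0 : 0 <= 4 * n / t ^+ 2 by rewrite !mulr_ge0.
have g0 x : 0 <= g x by rewrite /g !mulr_ge0.
apply: (@indep_resample2_le _ _ _ D i j g) => //.
- apply: measurable_funM => //; apply: measurable_funM => //.
  by apply: measurableT_comp => //; exact: measurable_ratio_fun.
- by move=> x u; rewrite /g ratio_upd eq_sym (negPf jk).
- move=> x; pose y := t - b%:R * ratio x j; pose z := y - n * ratio x k.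
  have Ax u : A (upd x i u) -> [/\ 0 < u < 1, D x, t / 2 <= z & z < a i / u <= y].
    move=> [cu []]; rewrite !ratio_upd eqxx [k == i]eq_sym (negPf ik) [j == i]eq_sym (negPf ij).
    move=> kj tz zu uy; split => //; last by rewrite zu uy.
      exact: upd_cube cu.
    split => //; first by have /andP[+ _] := cu k; rewrite tnth_upd eq_sym (negPf ik).
    by have := cu j; rewrite tnth_upd eq_sym (negPf ij).
  have [[Dx tz]|nDx] := pselect (D x /\ t / 2 <= z); last first.
    rewrite (_ : mkset _ = set0) ?measure0.
      by rewrite lee_fin mulr_ge0.
    by apply/seteqP; split=> u //= /Ax[_ Dx tz _]; exact: nDx.
  have xk0 : 0 < ratio x k by case: Dx => k0 _ _; rewrite divr_gt0.
  have th : 0 < t / 2 by rewrite divr_gt0.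
  have z0 : 0 < z := lt_le_trans th tz.
  have nk : 0 <= n * ratio x k := mulr_ge0 n0 (ltW xk0).
  have zy : z <= y by rewrite /z lerBlDr lerDl.
  apply: (@le_trans _ _ (a i * (y - z) / (z * y))%:E).
    apply: uniform_prob_ratio_itv => //; first exact: measurable_section.
    by move=> u /Ax[? _ _ ?].
  rewrite lee_fin indicE mem_set// mulr1 /g (gtr0_norm xk0).
  have -> : y - z = n * ratio x k by rewrite /z; ring.
  have -> : 4 * n * ratio x k / t ^+ 2 = n * ratio x k / (t / 2 * (t / 2)).
    by field; rewrite gt_eqF.
  apply: ler_pM.
  - by apply: mulr_ge0 => //; exact: ltW.
  - by rewrite invr_ge0 mulr_ge0// ltW// (lt_le_trans z0 zy).
  - by rewrite ler_piMl.
  - rewrite lef_pV2 ?posrE ?mulr_gt0//; last exact: lt_le_trans zy.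
    by apply: ler_pM => //; rewrite ?(ltW th)//; exact: le_trans zy.
- move=> x; have [xk0|xk0] := ltP 0 (tnth x k); last first.
    rewrite (_ : mkset _ = set0) ?measure0 ?mule0.
      by rewrite lee_fin.
    apply/seteqP; split=> u //= -[+ _ _]; rewrite tnth_upd [k == j]eq_sym (negPf jk).
    by rewrite ltNge xk0.
  have rk0 : 0 < ratio x k by rewrite divr_gt0.
  apply: (@le_trans _ _ ((g x)%:E * (a j / ratio x k)%:E)%E).
    apply: lee_wpmul2l; first by rewrite lee_fin.
    apply: uniform_prob_ratio_tail => //; first exact: measurable_section.
    move=> u [_]; rewrite tnth_upd eqxx !ratio_upd eqxx [k == j]eq_sym (negPf jk).
    by move=> u01 h; split.
  rewrite -EFinM lee_fin /g (gtr0_norm rk0).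
  have -> : 4 * n * ratio x k / t ^+ 2 * (a j / ratio x k) = 4 * n / t ^+ 2 * a j.
    by field; rewrite !gt_eqF.
  by rewrite ler_piMr.
Qed.

Definition bad (t : R) : set (m.-tuple RB) :=
  [set x | exists p : 'I_m * 'I_m, p.1 != p.2 /\ two_large (t / (4 * m%:R)) p.1 p.2 x] `|`
  [set x | exists q : bool * 'I_m * ('I_m * 'I_m),
     [&& q.1.2 != q.2.1, q.1.2 != q.2.2 & q.2.1 != q.2.2] /\
     near_level q.1.1 m%:R t q.1.2 q.2.1 q.2.2 x].

Lemma measurable_bad t : measurable (bad t).
Proof.
apply: measurableU; apply: measurable_set_exists => p;
  apply: measurable_set_and; try exact: measurable_set_cst.
- exact: measurable_two_large.
- exact: measurable_near_level.
Qed.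

(** 24 is 16 + 8: there are m^2 pairs of cost (4 m)^2, and 2 m^3 choices of [b] and three indices of
    cost 4 m, each divided by t^2. *)
Lemma indep_bad_le t : 0 < t -> pr Pi (bad t) <= 24 * m%:R ^+ 4 / t ^+ 2.
Proof.
move=> t0.
have t2 : 0 <= (t ^+ 2)^-1 by rewrite invr_ge0 exprn_ge0// ltW.
have b1 : pr Pi [set x | exists p : 'I_m * 'I_m,
    p.1 != p.2 /\ two_large (t / (4 * m%:R)) p.1 p.2 x] <= 16 * m%:R ^+ 4 / t ^+ 2.
  apply: (le_trans (pr_exists_le _ _ _)) => [p|]; first exact: measurable_two_large.
  have -> : 16 * m%:R ^+ 4 / t ^+ 2 = #|{: 'I_m * 'I_m}|%:R * (16 * m%:R ^+ 2 / t ^+ 2).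
    by rewrite card_prod card_ord natrM; ring.
  apply: sum_le_card => [|p ij]; first by rewrite mulr_ge0// mulr_ge0// exprn_ge0.
  have m0 : 0 < m%:R :> R by rewrite ltr0n (leq_ltn_trans _ (ltn_ord p.1)).
  apply: (le_trans (indep_two_large ij _)); first by rewrite divr_gt0// mulr_gt0.
  have -> : (t / (4 * m%:R))^-1 ^+ 2 = 16 * m%:R ^+ 2 / t ^+ 2 by field; rewrite !gt_eqF.
  exact: lexx.
have b2 : pr Pi [set x | exists q : bool * 'I_m * ('I_m * 'I_m),
     [&& q.1.2 != q.2.1, q.1.2 != q.2.2 & q.2.1 != q.2.2] /\
     near_level q.1.1 m%:R t q.1.2 q.2.1 q.2.2 x] <= 8 * m%:R ^+ 4 / t ^+ 2.
  apply: (le_trans (pr_exists_le _ _ _)) => [p|]; first exact: measurable_near_level.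
  have -> : 8 * m%:R ^+ 4 / t ^+ 2 =
      #|{: bool * 'I_m * ('I_m * 'I_m)}|%:R * (4 * m%:R / t ^+ 2).
    by rewrite !card_prod !card_ord card_bool !natrM; ring.
  apply: sum_le_card => [|q /and3P[h1 h2 h3]]; first by rewrite mulr_ge0// mulr_ge0.
  exact: indep_near_level.
have -> : 24 * m%:R ^+ 4 / t ^+ 2 = 16 * m%:R ^+ 4 / t ^+ 2 + 8 * m%:R ^+ 4 / t ^+ 2.
  by rewrite -!mulrDl -natrD.
apply: (le_trans (prU_le _ _ _)); last exact: lerD.
- apply: measurable_set_exists => p;
  apply: measurable_set_and; [exact: measurable_set_cst|exact: measurable_two_large].
- apply: measurable_set_exists => p;
  apply: measurable_set_and; [exact: measurable_set_cst|exact: measurable_near_level].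
Qed.

(** Lets the bound on [bad t] pass from independence to a dominated law: for large t, a ratio above
    t / (4 m) forces a coordinate below [u0]. *)
Lemma bad_one_big x t : 0 < t -> bad t x -> unit_cube x /\ exists k, t / (4 * m%:R) < ratio x k.
Proof.
move=> t0 [[p [_ [cx [h _]]]]|[q [_ [cx [_ h1 h2 _]]]]]; split=> //; first by exists p.1.
exists q.1.2; apply: le_lt_trans h2; apply: le_trans h1.
have m1 : 1 <= m%:R :> R by rewrite ler1n (leq_ltn_trans _ (ltn_ord q.1.2)).
rewrite ler_pM2l// lef_pV2 ?posrE//; last by rewrite mulr_gt0// (lt_le_trans ltr01).
lra.
Qed.

Definition exceeding t (p : 'I_m * 'I_m) : set (m.-tuple RB) :=
  [set x | unit_cube x /\ exceeds (ratio x) t p].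

Lemma measurable_exceeding t p : measurable (exceeding t p).
Proof.
apply: measurable_set_and; first exact: measurable_unit_cube.
have [pp|/negPf pp] := boolP (p.1 == p.2).
  rewrite (_ : mkset _ = [set x | t < ratio x p.1]).
    by apply: measurable_set_lt => //; exact: measurable_ratio_fun.
  by apply/seteqP; split=> x /=; rewrite /exceeds pp.
rewrite (_ : mkset _ = [set x | [&& ratio x p.1 <= t, ratio x p.2 <= t &
    t < ratio x p.1 + ratio x p.2]]); last first.
  by apply/seteqP; split=> x /=; rewrite /exceeds pp.
repeat (apply: measurable_set_andb);
  (apply: measurable_set_le || apply: measurable_set_lt) => //;
  try exact: measurable_ratio_fun.
by apply: measurable_funD; exact: measurable_ratio_fun.
Qed.

Lemma not_bad_no_pair x t i j : unit_cube x -> ~ bad t x -> i != j ->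
  t / (4 * m%:R) < ratio x i -> ratio x j <= t / (4 * m%:R).
Proof.
move=> cx nb ij hi; rewrite leNgt; apply/negP => hj; apply: nb; left.
by exists (i, j).
Qed.

Lemma not_bad_no_triple x t (b : bool) i j k : 0 < t -> unit_cube x -> ~ bad t x ->
  i != j -> i != k -> j != k ->
  ratio x j <= t / (4 * m%:R) -> ratio x k <= ratio x j ->
  ratio x i <= t - b%:R * ratio x j ->
  ratio x i <= t - b%:R * ratio x j - m%:R * ratio x k.
Proof.
move=> t0 cx nb ij ik jk je kj it; rewrite leNgt; apply/negP => hi; apply: nb; right.
exists ((b, i), (j, k)); rewrite /= ij ik jk; split => //; split => //; split => //.
have m1 : 1 <= m%:R :> R by rewrite ler1n (leq_ltn_trans _ (ltn_ord i)).
have m0 : 0 < m%:R :> R by rewrite (lt_le_trans ltr01).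
have xk := ratio_gt0 k cx; have xj := ratio_gt0 j cx.
have jm : ratio x j * (4 * m%:R) <= t by rewrite -ler_pdivlMr// mulr_gt0.
have : b%:R * ratio x j <= ratio x j by case: b {it hi} => /=; rewrite ?mul1r// mul0r ltW.
nra.
Qed.

Lemma aggregate_reciprocal x : aggregate Reciprocal a x = \sum_i ratio x i.
Proof. by []. Qed.

Lemma aggregate_approx (Q : probability (m.-tuple RB) R) t : 0 < t ->
  `|pr Q [set x | unit_cube x /\ t < aggregate Reciprocal a x] -
    \sum_(p : 'I_m * 'I_m | (p.1 <= p.2)%N) pr Q (exceeding t p)| <=
  (m ^ 2).+1%:R * pr Q (bad t).
Proof.
move=> t0; have -> : (m ^ 2).+1 = #|{: 'I_m * 'I_m}|.+1.
  by rewrite card_prod card_ord -mulnn.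
apply: pr_approx_union.
- apply: measurable_set_and; first exact: measurable_unit_cube.
  by apply: measurable_set_lt => //; exact: measurable_aggregate.
- exact: measurable_bad.
- exact: measurable_exceeding.
- move=> x [cx tx] nb.
  have [||p [pp xp]] := @sum_gt_exceeds _ _ (ratio x) t _ t0 erefl _ _ tx.
  + by move=> i j; exact: not_bad_no_pair.
  + by move=> b i j k; exact: not_bad_no_triple.
  by exists p.
- move=> p _ x [cx xp]; split => //; rewrite aggregate_reciprocal.
  move: xp; rewrite /exceeds (bigD1 p.1)//=; case: eqP => [_|/eqP p12 /and3P[_ _]].
    by move/lt_le_trans; apply; rewrite lerDl sumr_ge0// => k _; exact/ltW/ratio_gt0.
  rewrite (bigD1 p.2)/= 1?eq_sym// addrA => /lt_le_trans; apply.
  by rewrite lerDl sumr_ge0// => k _; exact/ltW/ratio_gt0.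
- move=> p q x pp qq pq [cx xp] [_ xq]; apply: contrapT => nb.
  move/eqP: pq; apply.
  apply: (@exceeds_unique _ _ (ratio x) t _ t0 _ erefl _ _ p q) => //.
  + by move=> i; exact: ratio_gt0.
  + by move=> i j; exact: not_bad_no_pair.
  + by move=> b i j k; exact: not_bad_no_triple.
Qed.

End bad_events.

Lemma measure_split d (T : measurableType d) (R : realType)
    (nu : {measure set T -> \bar R}) (A B : set T) : measurable A -> measurable B ->
  nu A = (nu (A `&` B) + nu (A `&` ~` B))%E.
Proof.
move=> mA mB; rewrite -measureU//.
- by rewrite -setIUr setUv setIT.
- exact: measurableI.
- by apply: measurableI => //; exact: measurableC.
- by rewrite setIACA setICr setI0.
Qed.

(** * Probability of the pair events *)

Section pair_area.
Context (R : realType).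
Local Notation RB := (measurableTypeR R).
Local Notation mu := (uniform_prob (@ltr01 R)).
Local Notation leb := (@lebesgue_measure R).

Lemma integral_inv_affine (t a x0 : R) : 0 < t -> a < t * x0 -> x0 < 1 ->
  (\int[leb]_(x in `[x0, 1%R]) ((t * x - a)^-1)%:E =
   ((ln (t - a) - ln (t * x0 - a)) / t)%:E)%E.
Proof.
move=> t0 ax x1.
pose F (x : R) := t^-1 * ln (t * x - a).
have pos x : x0 <= x -> 0 < t * x - a.
  by move=> xx; rewrite subr_gt0 (lt_le_trans ax)// ler_pM2l.
have dF x : x0 <= x -> is_derive x 1 F (t * x - a)^-1.
  move=> /pos px.
  have d1 : is_derive x 1 (fun y : R => t * y - a) t.
    by apply: is_derive_eq; rewrite /GRing.scale /= mulr1 subr0.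
  have d2 : is_derive (t * x - a) 1 (@ln R) (t * x - a)^-1 by exact: is_derive1_ln.
  have d3 : is_derive x 1 (@ln R \o (fun y : R => t * y - a)) (t * (t * x - a)^-1).
    by apply: is_derive_eq; rewrite /GRing.scale /= mulrC.
  rewrite /F; apply: is_derive_eq.
  by rewrite /GRing.scale /= mulrA mulVf ?mul1r// gt_eqF.
rewrite (@continuous_FTC2 _ (fun x => (t * x - a)^-1) F x0 1 x1).
- by rewrite -EFinB /F mulr1 -mulrBr mulrC.
- apply: continuous_in_subspaceT => x; rewrite inE/= in_itv/= => /andP[xx _].
  apply: cvgV; first by rewrite gt_eqF// pos.
  by apply: cvgB; [apply: cvgM; [exact: cvg_cst|exact: cvg_id]|exact: cvg_cst].
- split.
  + by move=> x; rewrite in_itv/= => /andP[/ltW /dF[]].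
  + apply: cvg_at_right_filter; apply: differentiable_continuous.
    by apply/derivable1_diffP; have [] := dF x0 (lexx _).
  + apply: cvg_at_left_filter; apply: differentiable_continuous.
    by apply/derivable1_diffP; have [] := dF 1 (ltW x1).
- move=> x; rewrite in_itv/= => /andP[/ltW /dF[_ h] _].
  by rewrite derive1E.
Qed.

Definition pair_level (a b t : R) : set (RB * RB) :=
  [set p | [&& 0 < p.1 < 1, 0 < p.2 < 1, a / p.1 <= t, b / p.2 <= t &
    t < a / p.1 + b / p.2]].

Lemma measurable_pair_level a b t : measurable (pair_level a b t).
Proof.
have m1 : measurable_fun setT (fun p : RB * RB => p.1) by exact: measurable_fst.
have m2 : measurable_fun setT (fun p : RB * RB => p.2) by exact: measurable_snd.
have r1 : measurable_fun setT (fun p : RB * RB => a / p.1).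
  apply: measurable_funM => //.
  exact: (measurableT_comp (@measurable_transform R Reciprocal) m1).
have r2 : measurable_fun setT (fun p : RB * RB => b / p.2).
  apply: measurable_funM => //.
  exact: (measurableT_comp (@measurable_transform R Reciprocal) m2).
rewrite /pair_level; repeat (apply: measurable_set_andb);
  (apply: measurable_set_le || apply: measurable_set_lt) => //.
exact: measurable_funD.
Qed.

(** For u in [x0, 1), with x0 = a / (t - b), the section in v is the interval [b / t, b / (t - a /
    u)), which lies in (0, 1) and has length a b / (t (t u - a)); integrating it gives the
    logarithms. For smaller u the section is cut off by v < 1, but u >= a / t leaves only a strip of
    width x0 - a / t = a b / (t (t - b)), which bounds [r]. *)
Lemma pair_level_area (a b t : R) : 0 < a <= 1 -> 0 < b <= 1 -> 2 < t ->
  exists2 r, 0 <= r <= a * b / (t * (t - b)) &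
  (mu \x mu)%E (pair_level a b t) =
    (a * b / t ^+ 2 * (ln (t - a) + ln (t - b) - ln (a * b)) + r)%:E.
Proof.
move=> /andP[a0 a1] /andP[b0 b1] t2.
have t0 : 0 < t by lra.
have tb : 0 < t - b by lra.
pose x0 := a / (t - b).
have x00 : 0 < x0 by rewrite divr_gt0.
have x01 : x0 < 1 by rewrite /x0 ltr_pdivrMr// mul1r; lra.
have atx : a / t <= x0 by rewrite /x0 ler_pM2l// lef_pV2 ?posrE//; lra.
have at0 : 0 < a / t by rewrite divr_gt0.
pose V : set (RB * RB) := `[x0, 1[ `*` setT.
have mV : measurable V by apply: measurableX.
have mE := measurable_pair_level a b t.
have mE1 : measurable (pair_level a b t `&` V) by exact: measurableI.
have mE2 : measurable (pair_level a b t `&` ~` V).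
  by apply: measurableI => //; exact: measurableC.
have e2 : ((mu \x mu)%E (pair_level a b t `&` ~` V) <= (a * b / (t * (t - b)))%:E)%E.
  apply: (@le_trans _ _ ((mu \x mu)%E (`[a / t, x0] `*` setT))).
    apply: le_measure; rewrite ?inE//; first exact: measurableX.
    move=> [u v] [/and5P[/= /andP[u0 u1] _ at_ _ _] nV]; split => //=.
    rewrite in_itv/= ler_pdivrMr// mulrC -ler_pdivrMr// at_ /=.
    by rewrite leNgt; apply/negP => xu; apply: nV; split => //=; rewrite in_itv/= u1 ltW.
  rewrite product_measure1E// [X in (_ * X)%E](@probability_setT _ _ _ mu) mule1.
  rewrite [leLHS](@uniform_prob_itv R true false (a / t) x0 (ltW at0) atx (ltW x01)).
  rewrite lee_fin /x0 le_eqVlt; apply/orP; left; apply/eqP.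
  by field; rewrite !gt_eqF.
exists (fine ((mu \x mu)%E (pair_level a b t `&` ~` V))).
  rewrite fine_ge0//= -lee_fin fineK// ge0_fin_numE//.
  exact: (le_lt_trans e2 (ltry _)).
rewrite [LHS](measure_split (mu \x mu)%E mE mV) EFinD fineK; last by rewrite ge0_fin_numE//; exact: (le_lt_trans e2 (ltry _)).
congr (_ + _)%E.
pose g (x : R) := a * b / t * (t * x - a)^-1.
have gpos x : x0 <= x -> 0 < t * x - a.
  move=> xx; rewrite subr_gt0; apply: (@lt_le_trans _ _ (t * x0)); last by rewrite ler_pM2l.
  by rewrite /x0 mulrA ltr_pdivlMr//; nra.
have secE x : mu (xsection (pair_level a b t `&` V) x) =
    if x \in `[x0, 1[ then (g x)%:E else 0%E.
  case: ifPn => xV; last first.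
    rewrite (_ : xsection _ _ = set0) ?measure0//.
    apply/seteqP; split=> v //=; rewrite /xsection/= inE => -[_ [/= xV' _]].
    by move/negP: xV; apply.
  have /andP[xx x1] : x0 <= x < 1 by move: xV; rewrite in_itv.
  have x0' : 0 < x := lt_le_trans x00 xx.
  have txa := gpos x xx.
  have tax : b <= t - a / x.
    by rewrite lerBrDl -lerBrDr ler_pdivrMr// mulrC -ler_pdivrMr.
  have tax0 : 0 < t - a / x := lt_le_trans b0 tax.
  rewrite (_ : xsection _ _ = [set` `[b / t, b / (t - a / x)[ ]); last first.
    apply/seteqP; split=> v /=; rewrite /xsection/= inE/=.
      move=> [/and5P[/= _ /andP[v0 v1] _ bv tv] _].
      rewrite in_itv/= ler_pdivrMr// mulrC -ler_pdivrMr// bv /=.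
      by rewrite ltr_pdivlMr// mulrC -ltr_pdivlMr// ltrBlDl.
    rewrite in_itv/= => /andP[bv vb].
    have v0 : 0 < v by apply: lt_le_trans bv; rewrite divr_gt0.
    have v1 : v < 1 by apply: (lt_le_trans vb); rewrite ler_pdivrMr// mul1r.
    split; last by split.
    apply/and5P; split=> /=; [exact/andP|exact/andP| | |].
    - by rewrite ler_pdivrMr//; lra.
    - by rewrite ler_pdivrMr// mulrC -ler_pdivrMr.
    - by rewrite -ltrBlDl ltr_pdivlMr// mulrC -ltr_pdivlMr.
  rewrite (@uniform_prob_itv R true true).
  - rewrite /g; congr (_%:E); field.
    by rewrite !gt_eqF//= mulrC.
  - by rewrite divr_ge0// ltW.
  - by rewrite ler_pM2l// lef_pV2 ?posrE// lerBlDr lerDl divr_ge0// ltW.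
  - by rewrite ler_pdivrMr// mul1r.
transitivity (\int[mu]_x mu (xsection (pair_level a b t `&` V) x))%E; first by [].
rewrite integral_uniform//; last exact: measurable_fun_xsection.
rewrite subr0 invr1 mul1e.
transitivity (\int[leb]_(x in `[0%R, 1%R]) ((EFin \o g) \_ `[x0, 1%R[) x)%E.
  apply: eq_integral => x _ /=; rewrite secE patchE mem_setE.
  by case: ifP.
have mg : measurable_fun `[x0, 1] (EFin \o g).
  apply/measurable_EFinP; apply: subspace_continuous_measurable_fun => //.
  apply: continuous_in_subspaceT => x; rewrite inE/= in_itv/= => /andP[xx _].
  apply: cvgM; first exact: cvg_cst.
  apply: cvgV; first by rewrite gt_eqF// gpos.
  by apply: cvgB; [apply: cvgM; [exact: cvg_cst|exact: cvg_id]|exact: cvg_cst].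
rewrite -integral_mkcondr setIidr; last first.
  move=> x /=; rewrite !in_itv/= => /andP[xx x1].
  by rewrite (le_trans (ltW x00) xx) ltW.
rewrite integral_itv_bndo_bndc; last first.
  by apply: measurable_funS mg => //; apply: subset_itvl; rewrite bnd_simp.
under eq_integral do rewrite /g/= EFinM.
rewrite ge0_integralZl_EFin//.
- rewrite integral_inv_affine//; last by rewrite -subr_gt0; exact: gpos.
  rewrite -EFinM; congr (_%:E).
  have -> : t * x0 - a = a * b / (t - b) by rewrite /x0; field; rewrite gt_eqF.
  rewrite ln_div ?posrE ?mulr_gt0//.
  by field; rewrite gt_eqF.
- move=> x; rewrite /= in_itv/= => /andP[xx _].
  by rewrite lee_fin invr_ge0 ltW// gpos.
- apply/measurable_EFinP; apply: subspace_continuous_measurable_fun => //.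
  apply: continuous_in_subspaceT => x; rewrite inE/= in_itv/= => /andP[xx _].
  apply: cvgV; first by rewrite gt_eqF// gpos.
  by apply: cvgB; [apply: cvgM; [exact: cvg_cst|exact: cvg_id]|exact: cvg_cst].
- by rewrite divr_ge0 ?mulr_ge0// ltW.
Qed.

End pair_area.

Section weights.
Context (R : realType) (m : nat) (S : statistic) (w : 'I_m -> R).

Lemma weight_le1 : (forall i, 0 < w i) -> \sum_i w i = 1 -> forall i, 0 < w i <= 1.
Proof.
by move=> w0 w1 i; rewrite w0 -w1 (bigD1 i)//= lerDl sumr_ge0// => k _; exact: ltW.
Qed.

Lemma scaled_weight_le1 : (forall i, 0 < w i <= 1) ->
  forall i, 0 < scale_const R S * w i <= 1.
Proof.
move=> w01 i; have /andP[wi0 wi1] := w01 i; rewrite mulr_gt0 ?scale_const_gt0//=.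
by rewrite mulr_ile1// ?scale_const_le1// ltW// scale_const_gt0.
Qed.

End weights.

(** * Laws dominated by the independence copula near the axes *)

Section dominated_laws.
Context (R : realType) (m : nat).
Local Notation RB := (measurableTypeR R).
Local Notation mu := (uniform_prob (@ltr01 R)).
Local Notation Pi := (indep_copula R m).
Implicit Types (Q : probability (m.-tuple RB) R) (i j : 'I_m).

Definition uniform_margins Q := forall i (A : set RB), measurable A ->
  Q [set x | A (tnth x i)] = mu A.

(** Stated for events rather than densities, so that it covers the independence law with [M = 1]
    and, for m <= 1, a law for which no density is given. *)
Definition dominated Q (M u0 : R) := forall A : set (m.-tuple RB), measurable A ->
  A `<=` min_le u0 -> pr Q A <= M * pr Pi A.

Lemma measurable_coord i (A : set RB) : measurable A ->
  measurable [set x : m.-tuple RB | A (tnth x i)].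
Proof.
by move=> mA; rewrite -[X in measurable X]setTI; exact: (measurable_tnth i).
Qed.

Lemma measurable_coord2 i j (G : set (RB * RB)) : measurable G ->
  measurable [set x : m.-tuple RB | G (tnth x i, tnth x j)].
Proof.
have mphi : measurable_fun setT (fun x : m.-tuple RB => (tnth x i, tnth x j)).
  by apply: measurable_fun_pair; exact: measurable_tnth.
by move=> mG; rewrite -[X in measurable X]setTI; exact: mphi.
Qed.

Lemma indep_uniform_margins : uniform_margins Pi.
Proof.
move=> i A mA.
rewrite (_ : [set x | _] = [set x : m.-tuple RB | forall k, (if k == i then A else setT) (tnth x k)]).
  rewrite [LHS](@prod_measure_box _ _ _ mu m (fun k => if k == i then A else setT)); last first.
    by move=> k; case: ifP.
  rewrite (bigD1 i)//= eqxx big1 ?mule1// => k /negPf ->.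
  exact: probability_setT.
apply/seteqP; split=> x /=; first by move=> Ax k; case: eqP => // ->.
by move=> /(_ i); rewrite eqxx.
Qed.

Lemma indep_dominated u0 : dominated Pi 1 u0.
Proof. by move=> A _ _; rewrite mul1r. Qed.

Section one_law.
Variable Q : probability (m.-tuple RB) R.
Hypothesis Qm : uniform_margins Q.

(** Each coordinate falls outside (0, 1) with probability 0, so no mass lies off the open cube. *)
Lemma pr_cube (A : set (m.-tuple RB)) : measurable A ->
  pr Q [set x | unit_cube x /\ A x] = pr Q A.
Proof.
move=> mA; have mc := @measurable_unit_cube R m.
have E : [set x | unit_cube x /\ A x] = A `&` @unit_cube R m by rewrite [RHS]setIC.
rewrite E [in RHS](pr_split Q mA mc) [X in _ = _ + X](_ : _ = 0) ?addr0//.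
apply/eqP; rewrite eq_le pr_ge0 andbT.
have m01 : measurable (~` `]0, 1[ : set RB) by apply: measurableC; exact: measurable_itv.
apply: (@le_trans _ _ (pr Q [set x | exists i, true /\ (~` `]0, 1[ : set RB) (tnth x i)])).
  apply: le_pr.
  - by apply: measurableI => //; exact: measurableC.
  - apply: measurable_set_exists => i; apply: measurable_set_and; first exact: measurable_set_cst.
    exact: measurable_coord.
  - move=> x [_ /existsNP[i xi]]; by exists i; split => //=; rewrite in_itv.
apply: le_trans (pr_exists_le Q xpredT _) _ => [i|]; first exact: measurable_coord.
rewrite big1// => i _; rewrite /pr Qm//.
have := @probability_setC _ _ _ mu `]0, 1[%classic (measurable_itv _).
by move=> /= ->; rewrite uniform_prob_oo subee.
Qed.

Lemma pr_coord_tail i (c t : R) : 0 < c <= 1 -> 1 <= t ->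
  pr Q [set x | unit_cube x /\ t < c / tnth x i] = c / t.
Proof.
move=> /andP[c0 c1] t1; have t0 : 0 < t by lra.
have mr : measurable [set x : m.-tuple RB | t < c / tnth x i].
  by apply: measurable_set_lt => //; exact: measurable_ratio.
rewrite pr_cube//.
have -> : pr Q [set x | t < c / tnth x i] = pr Q [set x | unit_cube x /\ `]0, c / t[%classic (tnth x i)].
  rewrite -pr_cube//; congr (pr Q _); apply/seteqP; split=> x /= [cx h]; split => //;
    have /andP[x0 x1] := cx i.
    by rewrite in_itv/= x0 ltr_pdivlMr// mulrC -ltr_pdivlMr.
  move: h; rewrite in_itv/= => /andP[_].
  by rewrite ltr_pdivlMr// mulrC -ltr_pdivlMr.
rewrite pr_cube; last by apply: measurable_coord; exact: measurable_itv.
rewrite /pr Qm; last exact: measurable_itv.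
rewrite (@uniform_prob_itv R false true) ?subr0//; first by rewrite divr_ge0// ltW.
by rewrite ler_pdivrMr// mul1r (le_trans c1).
Qed.

Variables (M u0 : R).
Hypotheses (M0 : 0 <= M) (u01 : 0 < u0 < 1) (QM : dominated Q M u0).

Section ratios.
Variable a : 'I_m -> R.
Hypothesis a01 : forall i, 0 < a i <= 1.

Lemma min_le_of_large x (s : R) i : unit_cube x -> u0^-1 <= s -> s < ratio a x i -> min_le u0 x.
Proof.
have /andP[u00 _] := u01; move=> cx us sx; split => //; exists i.
have /andP[x0 _] := cx i; have /andP[_ a1] := a01 i.
have : u0^-1 < (tnth x i)^-1.
  apply: (le_lt_trans us (lt_le_trans sx _)).
  by rewrite /ratio ler_piMl// invr_ge0 ltW.
by rewrite ltf_pV2 ?posrE// => /ltW.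
Qed.

(** The threshold ensures t / (4 m) >= 1 / u0, which places [bad t] inside [min_le u0], and t >= 1,
    for which the diagonal events have probability exactly a_i / t. *)
Lemma reciprocal_expansion : exists B, forall t, 4 * m%:R / u0 + 1 <= t ->
  `|pr Q [set x | unit_cube x /\ t < aggregate Reciprocal a x] -
    ((\sum_i a i) / t + \sum_(i < m) \sum_(j < m | (i < j)%N)
       pr Q [set x | pair_level (a i) (a j) t (tnth x i, tnth x j)])| <= B / t ^+ 2.
Proof.
have /andP[u00 _] := u01.
exists ((m ^ 2).+1%:R * (M * (24 * m%:R ^+ 4))) => t ht.
have mu0 : 0 <= 4 * m%:R / u0 by rewrite divr_ge0 ?mulr_ge0// ltW.
have t1 : 1 <= t by lra.
have t0 : 0 < t by lra.
have -> : (\sum_i a i) / t + \sum_(i < m) \sum_(j < m | (i < j)%N)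
       pr Q [set x | pair_level (a i) (a j) t (tnth x i, tnth x j)] =
    \sum_(p : 'I_m * 'I_m | (p.1 <= p.2)%N) pr Q (exceeding a t p).
  rewrite mulr_suml -big_split/=.
  rewrite -(pair_big_dep xpredT (fun i j : 'I_m => (i <= j)%N)
    (fun i j => pr Q (exceeding a t (i, j))))/=.
  apply: eq_bigr => i _; rewrite [RHS](bigD1 i)//=; congr (_ + _).
    rewrite -(@pr_coord_tail i _ _ (a01 i) t1); congr (pr Q _).
    by apply/seteqP; split=> x /=; rewrite /exceeding/= /exceeds/= eqxx.
  apply: eq_big => [j|j ij]; first by rewrite ltn_neqAle andbC eq_sym.
  rewrite -pr_cube; last by apply: measurable_coord2; exact: measurable_pair_level.
  congr (pr Q _); apply/seteqP; split=> x /=; rewrite /exceeding/= /exceeds/= -val_eqE/= (ltn_eqF ij).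
    by move=> [cx /and5P[_ _ h1 h2 h3]]; split => //; apply/and3P.
  move=> [cx /and3P[h1 h2 h3]]; split => //; apply/and5P; split => //=; exact: cx.
apply: (le_trans (aggregate_approx a01 Q t0)).
rewrite -[leRHS]mulrA ler_wpM2l// -[leRHS]mulrA.
apply: (le_trans (QM (measurable_bad a t) _)).
  move=> x /(bad_one_big t0) [cx [k xk]].
  apply: (min_le_of_large cx _ xk).
  have m0 : 0 < m%:R :> R by rewrite ltr0n (leq_ltn_trans _ (ltn_ord k)).
  rewrite ler_pdivlMr ?mulr_gt0// mulrC; lra.
by rewrite ler_wpM2l//; exact: indep_bad_le.
Qed.

End ratios.

Section survival.
Variables (w : 'I_m -> R) (S : statistic).
Hypothesis w01 : forall i, 0 < w i <= 1.
Let c := scale_const R S.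
Let a i := c * w i.

Let a01 : forall i, 0 < a i <= 1 := scaled_weight_le1 S w01.

Lemma survivalE t : survival S w Q t = pr Q [set x | unit_cube x /\ t < aggregate S w x].
Proof.
rewrite pr_cube; last by apply: measurable_set_lt => //; exact: measurable_aggregate.
rewrite /survival /pr /ccdf /distribution /pushforward.
by congr (fine (Q _)); apply/seteqP; split=> x /=; rewrite in_itv/= andbT.
Qed.

Lemma survival_nonincreasing s t : s <= t -> survival S w Q t <= survival S w Q s.
Proof.
move=> st; rewrite !survivalE.
apply: le_pr; try (apply: measurable_set_and; first exact: measurable_unit_cube;
  by apply: measurable_set_lt => //; exact: measurable_aggregate).
by move=> x [cx /(le_lt_trans st)].
Qed.

(** Some summand is at least s / m >= 1 / u0, which puts its coordinate below [u0]; the event can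
    then be handed over to independence. *)
Lemma pr_aggregate_itv (s t : R) : m%:R / u0 + 1 <= s -> s <= t ->
  pr Q [set x | unit_cube x /\ s < aggregate S w x <= t] <=
    M * (m%:R ^+ 3 * (t - s) / s ^+ 2).
Proof.
have /andP[u00 _] := u01; move=> hs st.
have mu0 : 0 <= m%:R / u0 by rewrite divr_ge0// ltW.
have s0 : 0 < s by lra.
have mE : measurable [set x : m.-tuple RB | unit_cube x /\ s < aggregate S w x <= t].
  apply: measurable_set_and; first exact: measurable_unit_cube.
  apply: measurable_set_andb.
    by apply: measurable_set_lt => //; exact: measurable_aggregate.
  by apply: measurable_set_le => //; exact: measurable_aggregate.
apply: (le_trans (QM mE _)); last by rewrite ler_wpM2l// indep_aggregate_itv.
move=> x [cx /andP[/(exists_large_summand s0) [i si] _]]; split => //; exists i.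
have xi := cx i; have /andP[x0 _] := xi; have /andP[a0 a1] := a01 i.
have /andP[w0 _] := w01 i.
have m0 : 0 < m%:R :> R by rewrite ltr0n (leq_ltn_trans _ (ltn_ord i)).
have : s / m%:R <= (tnth x i)^-1.
  apply: (le_trans si); apply: (@le_trans _ _ (a i / tnth x i)).
    rewrite /a [leRHS](_ : _ = w i * (c / tnth x i)); last by rewrite mulrA [c * _]mulrC.
    by rewrite ler_pM2l// transform_le.
  by rewrite ler_piMl// invr_ge0 ltW.
have us : u0^-1 <= s / m%:R by rewrite ler_pdivlMr// mulrC; lra.
by move=> /(le_trans us); rewrite lef_pV2 ?posrE.
Qed.

Let mtail S' w' t : measurable [set x : m.-tuple RB | unit_cube x /\ t < aggregate S' w' x].
Proof.
apply: measurable_set_and; first exact: measurable_unit_cube.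
by apply: measurable_set_lt => //; exact: measurable_aggregate.
Qed.

(** The factor s^-2 is given away, as s >= 1: inverting the tail needs only a Lipschitz bound far
    out. *)
Lemma survival_increment (s t : R) : m%:R / u0 + 1 <= s -> s <= t ->
  survival S w Q s - survival S w Q t <= M * m%:R ^+ 3 * (t - s).
Proof.
have /andP[u00 _] := u01; move=> hs st.
have mu0 : 0 <= m%:R / u0 by rewrite divr_ge0// ltW.
have mst : measurable [set x : m.-tuple RB | unit_cube x /\ s < aggregate S w x <= t].
  apply: measurable_set_and; first exact: measurable_unit_cube.
  apply: measurable_set_andb.
    by apply: measurable_set_lt => //; exact: measurable_aggregate.
  by apply: measurable_set_le => //; exact: measurable_aggregate.
apply: (@le_trans _ _ (pr Q [set x | unit_cube x /\ s < aggregate S w x <= t])).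
  rewrite !survivalE lerBlDr -prU.
  - apply: le_pr; [exact: mtail|by apply: measurableU => //; exact: mtail|].
    move=> x [cx sx]; have [xt|tx] := leP (aggregate S w x) t; [left|right] => //=.
    by rewrite sx xt.
  - exact: mst.
  - exact: mtail.
  - rewrite -subset0 => x [[_ /andP[_ xt]] [_ tx]].
    by move: (lt_le_trans tx xt); rewrite ltxx.
apply: (le_trans (pr_aggregate_itv hs st)); rewrite -[leRHS]mulrA ler_wpM2l//.
rewrite ler_pdivrMr ?exprn_gt0//; last by lra.
rewrite ler_peMr ?mulr_ge0 ?exprn_ge0 ?subr_ge0//.
by rewrite exprn_ege1//; lra.
Qed.

End survival.

Section survival_expansion.
Variables (w : 'I_m -> R) (S : statistic).
Hypothesis w0 : forall i, 0 < w i.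
Hypothesis w1 : \sum_i w i = 1.
Let c := scale_const R S.
Let a i := c * w i.

Let w01 := weight_le1 w0 w1.

Let a01 : forall i, 0 < a i <= 1 := scaled_weight_le1 S w01.

(** Each transform falls short of its ratio by at most 1, and the weights sum to 1, so the total
    defect is again at most 1. *)
Lemma aggregate_sandwich x : unit_cube x ->
  aggregate Reciprocal a x - 1 <= aggregate S w x <= aggregate Reciprocal a x.
Proof.
move=> cx; apply/andP; split.
  rewrite -[X in _ - X]w1 /aggregate -sumrB; apply: ler_sum => i _ /=.
  have h := transform_ge S (cx i); rewrite -(ler_pM2l (w0 i)) in h.
  by apply: le_trans h; rewrite mulrBr mulr1 lerD2r /a mulrA [c * _]mulrC.
apply: ler_sum => i _ /=.
have h := transform_le S (cx i); rewrite -(ler_pM2l (w0 i)) in h.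
by apply: (le_trans h); rewrite /a mulrA [c * _]mulrC.
Qed.

(** The tails of S and of the reciprocal sum with weights [a] differ only where the latter lies in
    (t, t + 1], a window of length 1 and hence of probability O(t^-2). From here on the two
    statistics are treated alike. *)
Lemma survival_expansion : exists B T, forall t, T <= t ->
  `|survival S w Q t - (c / t + \sum_(i < m) \sum_(j < m | (i < j)%N)
      pr Q [set x | pair_level (a i) (a j) t (tnth x i, tnth x j)])| <= B / t ^+ 2.
Proof.
have /andP[u00 _] := u01.
have [B HB] := reciprocal_expansion a01.
exists (M * m%:R ^+ 3 + B), (4 * m%:R / u0 + 1) => t tT.
have mu0 : 0 <= m%:R / u0 by rewrite divr_ge0// ltW.
have t0 : 0 < t by rewrite -mulrA in tT; lra.
have {HB} := HB t tT; rewrite -mulr_sumr w1 mulr1.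
set E := (c / t + _)%R => HE.
have mR : measurable [set x : m.-tuple RB | unit_cube x /\ t < aggregate Reciprocal a x <= t + 1].
  apply: measurable_set_and; first exact: measurable_unit_cube.
  apply: measurable_set_andb.
    by apply: measurable_set_lt => //; exact: measurable_aggregate.
  by apply: measurable_set_le => //; exact: measurable_aggregate.
have mS S' w' : measurable [set x : m.-tuple RB | unit_cube x /\ t < aggregate S' w' x].
  apply: measurable_set_and; first exact: measurable_unit_cube.
  by apply: measurable_set_lt => //; exact: measurable_aggregate.
have lo : survival S w Q t <= pr Q [set x | unit_cube x /\ t < aggregate Reciprocal a x].
  rewrite survivalE; apply: le_pr => // x [cx tx]; split => //.
  by apply: (lt_le_trans tx); have /andP[] := aggregate_sandwich cx.
have up : pr Q [set x | unit_cube x /\ t < aggregate Reciprocal a x] <=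
    survival S w Q t + M * m%:R ^+ 3 / t ^+ 2.
  apply: (@le_trans _ _ (survival S w Q t +
     pr Q [set x | unit_cube x /\ t < aggregate Reciprocal a x <= t + 1])).
    rewrite survivalE; apply: le_trans (prU_le _ _ _) => //.
    apply: le_pr => //; first exact: measurableU.
    move=> x [cx tx]; have [tS|St] := ltP t (aggregate S w x); [by left|right].
    by split => //; rewrite tx/=; have /andP[h _] := aggregate_sandwich cx; lra.
  rewrite lerD2l; apply: le_trans (pr_aggregate_itv _ _ _ _) _ => //.
  - by rewrite -mulrA in tT; lra.
  - by rewrite lerDl.
  - by rewrite [t + 1]addrC addrK mulr1 mulrA.
have p0 : 0 <= M * m%:R ^+ 3 / t ^+ 2 by rewrite divr_ge0 ?mulr_ge0 ?exprn_ge0// ltW.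
rewrite mulrDl; set X := pr Q _ in HE lo up.
move: X E (_ / _) (_ / _) p0 HE lo up => X E p q p0.
by rewrite !ler_norml => /andP[h1 h2] lo up; apply/andP; split; lra.
Qed.

End survival_expansion.
End one_law.
End dominated_laws.

(** * Pair events and their shells under independence *)

Section pair_asymptotics.
Context (R : realType) (m : nat).
Local Notation RB := (measurableTypeR R).
Local Notation mu := (uniform_prob (@ltr01 R)).
Local Notation Pi := (indep_copula R m).

Definition pair_event (a b t : R) (i j : 'I_m) : set (m.-tuple RB) :=
  [set x | pair_level a b t (tnth x i, tnth x j)].

Definition box_event (s : R) (i j : 'I_m) : set (m.-tuple RB) :=
  [set x | tnth x i <= s /\ tnth x j <= s].

Lemma measurable_pair_event a b t i j : measurable (pair_event a b t i j).
Proof. by apply: measurable_coord2; exact: measurable_pair_level. Qed.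

Lemma measurable_box_event s i j : measurable (box_event s i j).
Proof.
by apply: measurable_set_and; apply: measurable_set_le => //; exact: measurable_tnth.
Qed.

Section two_coordinates.
Variables (i j : 'I_m) (a b : R).
Hypotheses (ij : i != j) (a01 : 0 < a <= 1) (b01 : 0 < b <= 1).

(** For t >= 4 both t - a and t - b are at least t / 2, so replacing their logarithms by ln t costs
    ln 2 each, and the remainder of [pair_level_area] is at most 2 a b / t^2. *)
Lemma indep_pair_event_asymp : exists B, forall t, 4 <= t ->
  `|pr Pi (pair_event a b t i j) - 2 * a * b * (ln t / t ^+ 2)| <= B / t ^+ 2.
Proof.
have /andP[a0 a1] := a01; have /andP[b0 b1] := b01.
exists (a * b * (2 * ln 2 + `|ln (a * b)| + 2)) => t t4.
have t0 : 0 < t by lra.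
have [|r /andP[r0 r1] E] := pair_level_area (t := t) a01 b01; first by lra.
rewrite /pr /pair_event [X in fine X](prod_measure_pair mu ij (measurable_pair_level a b t)) E /=.
have ab0 : 0 < a * b by rewrite mulr_gt0.
have lnb (z : R) : t / 2 <= z -> z <= t -> `|ln z - ln t| <= ln 2.
  move=> z1 z2; have z0 : 0 < z by lra.
  have h1 : ln z <= ln t by rewrite ler_ln ?posrE.
  have h2 : ln t - ln 2 <= ln z.
    by rewrite -ln_div ?posrE// ler_ln ?posrE// divr_gt0.
  by rewrite distrC ger0_norm ?subr_ge0//; lra.
have la := lnb (t - a) ltac:(lra) ltac:(lra).
have lb := lnb (t - b) ltac:(lra) ltac:(lra).
have tt0 : 0 < t ^+ 2 by rewrite exprn_gt0.
have r2 : r <= 2 * (a * b) / t ^+ 2.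
  apply: (le_trans r1); rewrite ler_pdivrMr ?mulr_gt0//; last by lra.
  have -> : 2 * (a * b) / t ^+ 2 * (t * (t - b)) = a * b * (2 * (t - b) / t).
    by field; rewrite gt_eqF.
  by rewrite ler_peMr ?(ltW ab0)// ler_pdivlMr//; lra.
have -> : a * b / t ^+ 2 * (ln (t - a) + ln (t - b) - ln (a * b)) + r -
    2 * a * b * (ln t / t ^+ 2) =
    a * b / t ^+ 2 * ((ln (t - a) - ln t) + (ln (t - b) - ln t) - ln (a * b)) + r.
  by ring.
apply: (le_trans (ler_normD _ _)); rewrite normrM (ger0_norm r0).
rewrite (ger0_norm (ltW (divr_gt0 ab0 tt0))).
have -> : a * b * (2 * ln 2 + `|ln (a * b)| + 2) / t ^+ 2 =
   a * b / t ^+ 2 * (2 * ln 2 + `|ln (a * b)|) + 2 * (a * b) / t ^+ 2 by ring.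
apply: lerD => //; rewrite ler_pM2l ?divr_gt0//.
apply: (le_trans (ler_normB _ _)); rewrite lerD2r.
apply: (le_trans (ler_normD _ _)); lra.
Qed.

(* If x_i > s then X_i < 1/s <= t/2, which confines X_j to (t - 1/s, t]. *)
Lemma indep_pair_event_shell (s r t : R) : 0 < s -> s <= r -> r <= 1 -> 2 <= s * t ->
  pr Pi (pair_event a b t i j `&` box_event r i j `&` ~` box_event s i j) <=
    4 * (r / s) / t ^+ 2.
Proof.
have /andP[a0 a1] := a01; have /andP[b0 b1] := b01.
move=> s0 sr r1 st.
have t0 : 0 < t by rewrite -(pmulr_rgt0 _ s0); lra.
have r0 : 0 < r by lra.
have st' : s^-1 <= t / 2 by rewrite ler_pdivlMr// mulrC ler_pdivrMr//; lra.
have si0 : 0 < s^-1 by rewrite invr_gt0.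
pose F (c : R) := [set u : RB | 0 < u < 1 /\ t - s^-1 < c / u <= t].
have mr (c : R) : measurable_fun setT (fun u : RB => c / u).
  by apply: measurable_funM => //; exact: (@measurable_transform R Reciprocal).
have mF c : measurable (F c).
  apply: measurable_set_and; last first.
    by apply: measurable_set_andb; [exact: measurable_set_lt|exact: measurable_set_le].
  rewrite (_ : mkset _ = `]0, 1[%classic); first exact: measurable_itv.
  by apply/seteqP; split=> u /=; rewrite in_itv.
(* The window has length 1 / s and, as 1 / s <= t / 2, a lower end of at least t / 2. The final 4
   counts the 2 obtained here once for each coordinate that may be the one above s. *)
have Fle c : 0 < c <= 1 -> (mu (F c) <= (2 / (s * t ^+ 2))%:E)%E.
  move=> /andP[c0 c1].
  apply: (@le_trans _ _ (c * (t - (t - s^-1)) / ((t - s^-1) * t))%:E).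
    apply: uniform_prob_ratio_itv => //; first by lra.
    by rewrite gerBl ltW.
  rewrite lee_fin (_ : t - (t - s^-1) = s^-1); last by ring.
  apply: (@le_trans _ _ (s^-1 / (t / 2 * t))).
    apply: ler_pM => //.
    - by rewrite mulr_ge0// ltW.
    - by rewrite invr_ge0 mulr_ge0//; lra.
    - by rewrite ler_piMl// ltW.
    - rewrite lef_pV2 ?posrE ?mulr_gt0// ?ler_pM2r//; lra.
  rewrite le_eqVlt; apply/orP; left; apply/eqP.
  by field; rewrite !gt_eqF.
pose I : set RB := `]0, r]%classic.
have mI : measurable I by exact: measurable_itv.
have muI : mu I = r%:E by rewrite /I (@uniform_prob_itv R false false) ?subr0// ltW.
have rect (k l : 'I_m) c : k != l -> 0 < c <= 1 ->
    pr Pi [set x : m.-tuple RB | I (tnth x k) /\ F c (tnth x l)] <= 2 * (r / s) / t ^+ 2.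
  move=> kl c01; rewrite -lee_fin prE; last first.
    by apply: measurable_set_and; exact: measurable_coord.
  rewrite [leLHS]indep_rect// [X in (X * _)%E]muI.
  apply: (@le_trans _ _ (r%:E * (2 / (s * t ^+ 2))%:E)%E).
    by apply: lee_wpmul2l; [rewrite lee_fin ltW|exact: Fle].
  rewrite -EFinM lee_fin le_eqVlt; apply/orP; left; apply/eqP.
  by field; rewrite !gt_eqF.
have mrect k l c : measurable [set x : m.-tuple RB | I (tnth x k) /\ F c (tnth x l)].
  by apply: measurable_set_and; exact: measurable_coord.
apply: (@le_trans _ _ (pr Pi ([set x : m.-tuple RB | I (tnth x i) /\ F b (tnth x j)] `|`
    [set x : m.-tuple RB | I (tnth x j) /\ F a (tnth x i)]))).
  apply: le_pr.
  - apply: measurableI; last by apply: measurableC; exact: measurable_box_event.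
    by apply: measurableI; [exact: measurable_pair_event|exact: measurable_box_event].
  - exact: measurableU.
  - move=> x [[/and5P[/= xi xj hi hj hij] [ir jr]] nb].
    have inv_lt (c v : R) : 0 < c <= 1 -> s < v -> c / v < s^-1.
      move=> /andP[c0 c1] sv; have v0 : 0 < v := lt_trans s0 sv.
      apply: (@le_lt_trans _ _ v^-1); first by rewrite ler_piMl// invr_ge0 ltW.
      by rewrite ltf_pV2 ?posrE.
    have [si|is_] := ltP s (tnth x i).
      left; split; first by rewrite /I/= in_itv/= ir andbT; have /andP[] := xi.
      by split => //; rewrite hj andbT; have := inv_lt a _ a01 si; lra.
    have [sj|js] := ltP s (tnth x j); last by exfalso; apply: nb.
    right; split; first by rewrite /I/= in_itv/= jr andbT; have /andP[] := xj.
    by split => //; rewrite hi andbT; have := inv_lt b _ b01 sj; lra.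
apply: (le_trans (prU_le _ _ _)) => //.
have -> : 4 * (r / s) / t ^+ 2 = 2 * (r / s) / t ^+ 2 + 2 * (r / s) / t ^+ 2 by ring.
by apply: lerD; apply: rect => //; rewrite eq_sym.
Qed.

End two_coordinates.
End pair_asymptotics.

(** * Deviation of a pair event from a multiple of its probability under independence *)

Section pair_deviation.
Context (R : realType) (m : nat).
Local Notation RB := (measurableTypeR R).
Local Notation mu := (uniform_prob (@ltr01 R)).
Local Notation Pi := (indep_copula R m).
Variables (Q : probability (m.-tuple RB) R) (M u0 lam : R) (i j : 'I_m) (a b : R).
Hypotheses (Qm : uniform_margins Q) (M0 : 0 <= M) (u01 : 0 < u0 < 1).
Hypotheses (QM : dominated Q M u0) (ij : i != j) (a01 : 0 < a <= 1) (b01 : 0 < b <= 1).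

(** The integrated form of the essential bounds lam - om and lam + om for the pair density on the
    corner: a relative error, uniform over planar events. *)
Definition pair_close (s om : R) := forall G : set (RB * RB), measurable G ->
  (forall p, G p -> 0 < p.1 <= s /\ 0 < p.2 <= s) ->
  `|pr Q [set x | G (tnth x i, tnth x j)] -
    lam * pr Pi [set x | G (tnth x i, tnth x j)]| <=
  om * pr Pi [set x | G (tnth x i, tnth x j)].

Let dev (A : set (m.-tuple RB)) := `|pr Q A - lam * pr Pi A|.
Let E t := pair_event a b t i j.
Let box s := box_event s i j : set (m.-tuple RB).

Let mE t : measurable (E t). Proof. exact: measurable_pair_event. Qed.
Let mbox s : measurable (box s). Proof. exact: measurable_box_event. Qed.
Let mNbox s : measurable (~` box s). Proof. by apply: measurableC; exact: mbox. Qed.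

Let dev_split A B : measurable A -> measurable B ->
  dev A <= dev (A `&` B) + dev (A `&` ~` B).
Proof.
move=> mA mB; rewrite /dev (pr_split Q mA mB) (pr_split Pi mA mB) mulrDr opprD addrACA.
exact: ler_normD.
Qed.

(** The crude bound, free of any closeness: on the pair event one of the two ratios exceeds t / 2 >=
    1 / u0, or is at least close enough to it that domination applies. *)
Let dev_dom t A : 2 / u0 <= t -> measurable A -> A `<=` E t ->
  dev A <= (M + `|lam|) * pr Pi A.
Proof.
have /andP[u00 _] := u01; move=> tu mA AE.
have t0 : 0 < t by apply: lt_le_trans tu; rewrite divr_gt0.
have QA : pr Q A <= M * pr Pi A.
  rewrite -(pr_cube Qm mA) -(pr_cube (@indep_uniform_margins R m) mA).
  apply: QM; first by apply: measurable_set_and => //; exact: measurable_unit_cube.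
  move=> x [cx /AE/and5P[/= xi xj _ _ tx]]; split => //.
  have small (k : 'I_m) c : 0 < c <= 1 -> t / 2 < c / tnth x k -> tnth x k <= u0.
    move=> /andP[c0 c1]; have /andP[xk0 _] := cx k.
    rewrite ltr_pdivlMr// => h; have : t / 2 * tnth x k < 1 by exact: lt_le_trans c1.
    move=> h1; apply: contraT; rewrite -ltNge => h2.
    have h3 : 2 <= t * u0 by rewrite -ler_pdivrMr.
    nra.
  have [h|h] := ltP (t / 2) (a / tnth x i); first by exists i; exact: small h.
  by exists j; apply: (small _ b) => //; lra.
apply: (le_trans (ler_normB _ _)); rewrite normrM.
by rewrite !(ger0_norm (pr_ge0 _ _)) mulrDl lerD2r.
Qed.

Let dev_close s om A : pair_close s om -> measurable A ->
  (exists2 G : set (RB * RB), measurable G & A = [set x | G (tnth x i, tnth x j)]) ->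
  (forall x, A x -> 0 < tnth x i <= s /\ 0 < tnth x j <= s) ->
  dev A <= om * pr Pi A.
Proof.
move=> close mA [G mG AE] As; rewrite /dev.
pose G' := G `&` [set p : RB * RB | 0 < p.1 <= s /\ 0 < p.2 <= s].
have {}AE : A = [set x | G' (tnth x i, tnth x j)].
  apply/seteqP; split=> x; first by move=> /[dup] /As ? ; rewrite AE.
  by rewrite AE => -[].
rewrite AE; apply: close; last by move=> p [_ []].
apply: measurableI => //.
by apply: measurable_set_and; apply: measurable_set_andb;
  (apply: measurable_set_lt || apply: measurable_set_le) => //.
Qed.

Let cylE t : exists2 G : set (RB * RB), measurable G & E t = [set x | G (tnth x i, tnth x j)].
Proof. by exists (pair_level a b t) => //; exact: measurable_pair_level. Qed.

Let mboxT s : measurable [set p : RB * RB | p.1 <= s /\ p.2 <= s].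
Proof. by apply: measurable_set_and; apply: measurable_set_le. Qed.

Let E_pos t x : E t x -> 0 < tnth x i /\ 0 < tnth x j.
Proof. by move=> /and5P[/= /andP[? _] /andP[? _] _ _ _]. Qed.

Let E_box1 t : E t = E t `&` box 1.
Proof.
apply/seteqP; split=> x; last by case.
move=> Ex; split => //; move: Ex => /and5P[/= /andP[_ ?] /andP[_ ?] _ _ _].
by split; exact: ltW.
Qed.

(** Outside the box of fixed side [s] there is a single shell, between s and 1, whose probability
    O(t^-2) carries no logarithm. The logarithm sits inside the box, where the relative error is
    [om]. *)
Lemma pair_deviation_eps (s om t : R) : 0 <= om -> 0 < s <= 1 -> pair_close s om ->
  2 / u0 <= t -> 2 / s <= t ->
  `|pr Q (E t) - lam * pr Pi (E t)| <=
    (M + `|lam|) * (4 / s) / t ^+ 2 + om * pr Pi (E t).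
Proof.
move=> om0 /andP[s0 s1] close tu ts.
apply: (le_trans (dev_split (mE t) (mbox s))); rewrite addrC; apply: lerD.
  have mA : measurable (E t `&` ~` box s) by exact: measurableI.
  apply: (le_trans (dev_dom tu mA (@subIsetl _ _ _))).
  rewrite -[leRHS]mulrA ler_wpM2l ?addr_ge0//.
  rewrite E_box1 -(mul1r s^-1).
  by apply: indep_pair_event_shell => //; rewrite mulrC -ler_pdivrMr.
have mA : measurable (E t `&` box s) by exact: measurableI.
apply: (@le_trans _ _ (om * pr Pi (E t `&` box s))).
  apply: (dev_close close mA).
    have [G mG ->] := cylE t; exists (G `&` [set p : RB * RB | p.1 <= s /\ p.2 <= s]) => //.
    exact: measurableI.
  by move=> x [/E_pos[-> ->] [-> ->]].
by rewrite ler_wpM2l//; apply: le_pr => //; exact: subIsetl.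
Qed.

Let indep_box_le s t : 0 < s <= 1 -> pr Pi (E t `&` box s) <= s ^+ 2.
Proof.
move=> /andP[s0 s1]; pose I : set RB := `]0, s]%classic.
have mI : measurable I by exact: measurable_itv.
have muI : mu I = s%:E by rewrite /I (@uniform_prob_itv R false false) ?subr0// ltW.
have mII : measurable [set x : m.-tuple RB | I (tnth x i) /\ I (tnth x j)].
  by apply: measurable_set_and; exact: measurable_coord.
apply: (@le_trans _ _ (pr Pi [set x : m.-tuple RB | I (tnth x i) /\ I (tnth x j)])).
  apply: le_pr => //; first exact: measurableI.
  by move=> x [/E_pos[xi xj] [si sj]]; split; rewrite /I/= in_itv/= ?xi ?xj.
by rewrite -lee_fin prE// [leLHS]indep_rect// [X in (X * _)%E]muI [X in (_ * X)%E]muI.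
Qed.

Section dyadic.
Variables (s0 W : R) (om : nat -> R).
Hypotheses (s01 : 0 < s0 <= 1) (om0 : forall k, 0 <= om k).
Hypothesis omW : forall N, \sum_(k < N) om k <= W.
Let sk k := s0 / 2 ^+ k.
Hypothesis close : forall k, pair_close (sk k) (om k).

Let sk_gt0 k : 0 < sk k.
Proof. by have /andP[h _] := s01; rewrite divr_gt0// exprn_gt0. Qed.

Let sk_le1 k : sk k <= 1.
Proof.
have /andP[h h1] := s01; apply: le_trans h1.
by rewrite ler_pdivrMr ?exprn_gt0// ler_peMr ?(ltW h)// exprn_ege1// ler1n.
Qed.

Let skS k : sk k = 2 * sk k.+1.
Proof. by rewrite /sk exprS invfM; field; rewrite expf_neq0. Qed.

(** Consecutive radii have ratio 2, so every shell has probability at most 8 / t^2 under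
    independence, whatever its scale; the deviation on shell k is that bound times [om k]. *)
Let dyadic_sum t N : 2 <= sk N * t ->
  dev (E t `&` box (sk 0)) <= dev (E t `&` box (sk N)) + 8 / t ^+ 2 * \sum_(k < N) om k.
Proof.
have t2 : 0 <= 8 / t ^+ 2 by rewrite divr_ge0// sqr_ge0.
elim: N => [|N ih] tN; first by rewrite big_ord0 mulr0 addr0.
have t0 : 0 < t by rewrite -(pmulr_rgt0 _ (sk_gt0 N.+1)); lra.
have tN' : 2 <= sk N * t by rewrite skS -mulrA; lra.
apply: (le_trans (ih tN')); rewrite big_ord_recr/= mulrDr [X in _ <= _ + X]addrC addrA lerD2r.
have mA k : measurable (E t `&` box (sk k)) by exact: measurableI.
apply: (le_trans (dev_split (mA N) (mbox (sk N.+1)))); apply: lerD.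
  rewrite -setIA (_ : box (sk N) `&` box (sk N.+1) = box (sk N.+1)) ?lexx//.
  have ss : sk N.+1 <= sk N by rewrite [leRHS]skS; have := sk_gt0 N.+1; lra.
  apply/seteqP; split=> x; first by case.
  by move=> [h1 h2]; split => //; split; exact: le_trans ss.
apply: (@le_trans _ _ (om N * pr Pi (E t `&` box (sk N) `&` ~` box (sk N.+1)))).
  apply: (dev_close (@close N)).
  - exact: measurableI.
  - have [G mG ->] := cylE t.
    exists (G `&` [set p : RB * RB | p.1 <= sk N /\ p.2 <= sk N]
       `&` ~` [set p : RB * RB | p.1 <= sk N.+1 /\ p.2 <= sk N.+1]) => //.
    by apply: measurableI; [exact: measurableI|exact: measurableC].
  - by move=> x [[/E_pos[-> ->] [-> ->]] _].
rewrite mulrC ler_wpM2r//.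
apply: (le_trans (indep_pair_event_shell ij a01 b01 (sk_gt0 N.+1) _ (sk_le1 N) tN)).
  by rewrite [leRHS]skS; have := sk_gt0 N.+1; lra.
rewrite skS mulfK ?gt_eqF//; lra.
Qed.

(** The halving stops at a scale comparable to 1 / t: the shell bound requires [2 <= sk N * t],
    while the remaining box, of side below 4 / t, has probability at most 16 / t^2, so that the
    crude bound is enough there. *)
Let dyadic_stop t : 2 <= sk 0 * t -> exists2 N, 2 <= sk N * t & sk N * t < 4.
Proof.
move=> t2.
have t0 : 0 < t by rewrite -(pmulr_rgt0 _ (sk_gt0 0)); lra.
have [N hN] : exists N, sk N * t < 2.
  exists (Num.bound (s0 * t)); rewrite /sk mulrAC ltr_pdivrMr ?exprn_gt0//.
  have := @archi_boundP R (s0 * t).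
  have /andP[s00 _] := s01; rewrite mulr_ge0 ?ltW// => /(_ isT) h.
  apply: (lt_trans h); set n := Num.bound _.
  have : n%:R < 2 ^+ n :> R by rewrite -natrX ltr_nat ltn_expl.
  by have p0 : 0 < 2 ^+ n :> R by [rewrite exprn_gt0]; move: (2 ^+ n) p0 => p p0 np; lra.
elim: N hN => [|N ih] hN; first by move: t2; rewrite leNgt hN.
have [h|h] := ltP (sk N * t) 2; first exact: ih.
by exists N => //; rewrite skS -mulrA; lra.
Qed.

(** The three terms of the constant come from outside the box of side [s0], from the last box and
    from the dyadic shells, in this order. *)
Lemma pair_deviation_dyadic t : 2 / u0 <= t -> 2 / s0 <= t ->
  `|pr Q (E t) - lam * pr Pi (E t)| <=
    ((M + `|lam|) * (4 / s0) + 16 * (M + `|lam|) + 8 * W) / t ^+ 2.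
Proof.
have /andP[s00 s0_1] := s01; move=> tu ts.
have t0 : 0 < t by apply: lt_le_trans ts; rewrite divr_gt0.
have sk0 : sk 0 = s0 by rewrite /sk expr0 divr1.
apply: (le_trans (dev_split (mE t) (mbox s0))).
have [N tN tN4] : exists2 N, 2 <= sk N * t & sk N * t < 4.
  by apply: dyadic_stop; rewrite sk0 mulrC -ler_pdivrMr.
have ML : 0 <= M + `|lam| by rewrite addr_ge0.
have h1 : dev (E t `&` ~` box s0) <= (M + `|lam|) * (4 / s0) / t ^+ 2.
  have mA : measurable (E t `&` ~` box s0) by exact: measurableI.
  apply: (le_trans (dev_dom tu mA (@subIsetl _ _ _))).
  rewrite -[leRHS]mulrA ler_wpM2l//.
  rewrite E_box1 -(mul1r s0^-1).
  by apply: indep_pair_event_shell => //; rewrite mulrC -ler_pdivrMr.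
have h2 := dyadic_sum tN; rewrite sk0 in h2.
have h3 : dev (E t `&` box (sk N)) <= 16 * (M + `|lam|) / t ^+ 2.
  have mA : measurable (E t `&` box (sk N)) by exact: measurableI.
  apply: (le_trans (dev_dom tu mA (@subIsetl _ _ _))).
  rewrite -mulrA mulrCA ler_wpM2l//.
  apply: (le_trans (indep_box_le t _)); first by rewrite sk_gt0 sk_le1.
  rewrite ler_pdivlMr ?exprn_gt0// -exprMn.
  have := sk_gt0 N; nra.
have h4 : 8 / t ^+ 2 * \sum_(k < N) om k <= 8 * W / t ^+ 2.
  by rewrite mulrAC ler_pM2r ?invr_gt0 ?exprn_gt0// ler_pM2l.
by rewrite !mulrDl; lra.
Qed.

End dyadic.
End pair_deviation.

(** * Copula densities *)

Section essential_bounds.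
Context (R : realType) (n : nat).
Local Notation RB := (measurableTypeR R).
Local Notation mu := (uniform_prob (@ltr01 R)).
Local Notation leb := (@lebesgue R n).
Local Notation cube := (@unit_cube R n).
Implicit Types (D B : set (n.-tuple RB)) (f c : n.-tuple RB -> R).

Lemma lebesgue_cube B : measurable B -> leb (B `&` cube) = indep_copula R n B.
Proof.
move=> mB; have mc := @measurable_unit_cube R n.
rewrite -[LHS]/(mrestr leb mc B).
apply: (@prod_measure_unique _ _ _ mu n (mrestr leb mc)) => // A mA.
rewrite /= /mrestr.
have -> : [set x : n.-tuple RB | forall k, A k (tnth x k)] `&` cube =
    [set x | forall k, (A k `&` `]0, 1[) (tnth x k)].
  apply/seteqP; split=> x /=.
    by move=> [h1 h2] k; split; [exact: h1|rewrite /= in_itv/=; exact: h2].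
  by move=> h; split=> k; have [] := h k => //; rewrite /= in_itv.
rewrite [LHS](@prod_measure_box _ _ _ (@lebesgue_measure R) n (fun k => A k `&` `]0, 1[)); last first.
  by move=> k; apply: measurableI => //; exact: measurable_itv.
apply: eq_bigr => k _.
have m01 : measurable (`]0, 1[%classic : set RB) by exact: measurable_itv.
(* [uniform_prob] lives on the closed interval; the part of [A k] outside the open one is null. *)
rewrite [RHS](measure_split mu (mA k) m01) [X in _ = (_ + X)%E](_ : _ = 0%E) ?adde0.
  rewrite [RHS]uniform_prob_lebesgue; last exact: measurableI.
  congr (lebesgue_measure _); rewrite [RHS]setIidl//.
  by move=> x [_] /=; rewrite !in_itv/= => /andP[/ltW -> /ltW ->].
apply/eqP; rewrite eq_le measure_ge0 andbT.
apply: (@le_trans _ _ (mu (~` `]0, 1[%classic))).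
  apply: le_measure; rewrite ?inE//.
  - by apply: measurableI => //; exact: measurableC.
  - exact: measurableC.
have := @probability_setC _ _ _ mu `]0, 1[%classic m01.
by move=> /= ->; rewrite uniform_prob_oo subee.
Qed.

Lemma ess_sup_on_leP D f (y : R) : (ess_sup_on D f <= y%:E)%E <->
  \forall x \ae leb, D x -> f x <= y.
Proof.
split.
  move=> /ess_supP; apply: filterS => x + Dx.
  by rewrite /patch mem_set//= lee_fin.
move=> h; apply/ess_supP; apply: filterS h => x h.
rewrite /patch; case: ifPn => [|_]; last exact: leNye.
by rewrite inE /= lee_fin.
Qed.

Lemma ess_inf_on_geP D f (y : R) : (y%:E <= ess_inf_on D f)%E <->
  \forall x \ae leb, D x -> y <= f x.
Proof.
split.
  move=> /ess_infP; apply: filterS => x + Dx.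
  by rewrite /patch mem_set//= lee_fin.
move=> h; apply/ess_infP; apply: filterS h => x h.
rewrite /patch; case: ifPn => [|_]; last exact: leey.
by rewrite inE /= lee_fin.
Qed.

Lemma lebesgue_null_of_ae_false B : measurable B ->
  (\forall x \ae leb, ~ B x) -> leb B = 0%E.
Proof.
move=> mB h; apply: measure_negligible => //.
by apply: negligibleS h => x Bx; apply.
Qed.

Section density.
Variables (nu : set (n.-tuple RB) -> \bar R) (c : n.-tuple RB -> R).
Hypothesis nuc : is_density nu c.

Lemma density_ub D (y : R) B : (ess_sup_on D c <= y%:E)%E -> measurable B ->
  B `<=` D -> (nu B <= y%:E * indep_copula R n B)%E.
Proof.
have [mcf c0 nuE] := nuc; move=> /ess_sup_on_leP Dy mB BD.
have mBc : measurable (B `&` cube) by apply: measurableI => //; exact: measurable_unit_cube.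
rewrite nuE// -lebesgue_cube//.
have [y0|y0] := leP 0 y.
  rewrite -integral_cst//.
  apply: ae_ge0_le_integral => //.
  - by move=> x [_ cx]; rewrite lee_fin; exact: c0.
  - apply/measurable_EFinP; apply: measurable_funS mcf => //.
    exact: measurable_unit_cube.
  - by apply: filterS Dy => x h [/BD Dx _]; rewrite lee_fin; exact: h.
(* A negative upper bound contradicts [0 <= c] almost everywhere on [B] within the cube, so that
   this set is null and both sides vanish. *)
have lB : leb (B `&` cube) = 0%E.
  apply: lebesgue_null_of_ae_false => //.
  apply: filterS Dy => x h [/BD/h cy cx].
  by have := c0 x cx; rewrite leNgt (le_lt_trans cy y0).
rewrite lB mule0 -[leRHS](integral0 leb (B `&` cube)).
apply: ae_ge0_le_integral => //.
- by move=> x [_ cx]; rewrite lee_fin; exact: c0.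
- apply/measurable_EFinP; apply: measurable_funS mcf => //.
  exact: measurable_unit_cube.
- apply: filterS Dy => x h [/BD Dx _]; rewrite lee_fin.
  exact: le_trans (h Dx) (ltW y0).
Qed.

Lemma density_lb D (y : R) B : (y%:E <= ess_inf_on D c)%E -> measurable B ->
  B `<=` D -> (y%:E * indep_copula R n B <= nu B)%E.
Proof.
have [mcf c0 nuE] := nuc; move=> /ess_inf_on_geP Dy mB BD.
have mBc : measurable (B `&` cube) by apply: measurableI => //; exact: measurable_unit_cube.
have cB0 x : (B `&` cube) x -> (0 <= (c x)%:E)%E.
  by move=> [_ cx]; rewrite lee_fin; exact: c0.
rewrite nuE//.
have [y0|y0] := leP 0 y; last first.
  apply: (@le_trans _ _ 0%E); last exact: integral_ge0.
  by rewrite mule_le0_ge0 ?measure_ge0// lee_fin ltW.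
rewrite -lebesgue_cube// -integral_cst//.
apply: ae_ge0_le_integral => //.
- apply/measurable_EFinP; apply: measurable_funS mcf => //.
  exact: measurable_unit_cube.
- by apply: filterS Dy => x h [/BD Dx _]; rewrite lee_fin; exact: h.
Qed.

End density.

Lemma osc_le_bounds c (l s y : R) : (osc c l s <= y%:E)%E ->
  (ess_sup_on (corner s) c <= (l + y)%:E)%E /\ ((l - y)%:E <= ess_inf_on (corner s) c)%E.
Proof.
move=> /ess_sup_on_leP h; split; [apply/ess_sup_on_leP|apply/ess_inf_on_geP];
  apply: filterS h => x h /h; rewrite ler_norml => /andP[h1 h2]; lra.
Qed.

Lemma osc_le c (l s s' : R) : s <= s' -> (osc c l s <= osc c l s')%E.
Proof.
move=> ss; apply: le_ess_sup; apply: nearW => x; rewrite /patch.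
case: ifPn => [xs|_]; last exact: leNye.
rewrite ifT//; move: xs; rewrite !inE => xs k.
by have /andP[-> /le_trans] := xs k; exact.
Qed.

(** A negative value would make the corner a null set, as an absolute value is never negative; but
    its volume is s^n > 0. *)
Lemma osc_ge0 c (l s : R) : 0 < s -> (0 <= osc c l s)%E.
Proof.
move=> s0; rewrite leNgt; apply/negP => h.
have [y /andP[hy y0]] : exists y : R, (osc c l s <= y%:E)%E && (y < 0).
  case: (osc c l s) h => [r| |]//; first by rewrite lte_fin => r0; exists r; rewrite lexx.
  by move=> _; exists (-1); rewrite leNye/= ltrN10.
have mcorner : measurable (@corner R n s).
  apply: (measurable_box (A := fun=> `]0, s]%classic)) => _.
  exact: measurable_itv.
have : leb (corner s) = 0%E.
  rewrite (_ : corner s = [set x | forall k : 'I_n, `]0, s]%classic (tnth x k)]) in mcorner *; last first.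
    by apply/seteqP; split=> x /= h' k; have := h' k; rewrite in_itv.
  apply: lebesgue_null_of_ae_false => //.
  move/ess_sup_on_leP : hy; apply: filterS => x hx xs.
  have /hx : corner s x by move=> k; have := xs k; rewrite /= in_itv.
  by rewrite leNgt (lt_le_trans y0).
rewrite (_ : corner s = [set x | forall k : 'I_n, `]0, s]%classic (tnth x k)]); last first.
  by apply/seteqP; split=> x /= h' k; have := h' k; rewrite in_itv.
rewrite [LHS](@prod_measure_box _ _ _ (@lebesgue_measure R) n (fun=> `]0, s]%classic)) => [|_]; last exact: measurable_itv.
rewrite (eq_bigr (fun=> s%:E)); last first.
  by move=> k _; rewrite [LHS](@lebesgue_measure_itv R `]0, s])/= lte_fin s0 sube0.
rewrite prodEFin => -[] /eqP; rewrite prodr_const expf_eq0 => /andP[_ /eqP s00].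
by move: s0; rewrite s00 ltxx.
Qed.

End essential_bounds.

(** * From densities to domination and closeness *)

Section copula_densities.
Context (R : realType) (m : nat).
Local Notation RB := (measurableTypeR R).
Local Notation mu := (uniform_prob (@ltr01 R)).
Local Notation Pi := (indep_copula R m).
Variable Q : probability (m.-tuple RB) R.

Lemma indep_marginal (I : {set 'I_m}) (B : set (#|I|.-tuple RB)) : measurable B ->
  Pi (@marginal R m I @^-1` B) = indep_copula R #|I| B.
Proof. exact: prod_measure_marginal. Qed.

(** With at most one coordinate there is no index set of size two to carry a density, but the
    margins already determine the law, which is the independence law. *)
Lemma uniform_margins_dominated1 u0 : (m <= 1)%N -> uniform_margins Q -> dominated Q 1 u0.
Proof.
move=> m1 Qm A mA _; rewrite mul1r /pr.
suff -> : Q A = Pi A by [].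
apply: (@prod_measure_unique _ _ _ mu m Q) => // B mB.
have [m0|m0] := posnP m.
  have Q1 : Q setT = 1%E := probability_setT Q.
  rewrite (_ : [set x | _] = setT); last first.
    by apply/seteqP; split=> // x _ k; exfalso; case: k; rewrite m0.
  by rewrite [LHS]Q1 big1// => k _; exfalso; case: k; rewrite m0.
have i : 'I_m by exact: Ordinal m0.
have ii k : k = i.
  have z (l : 'I_m) : l = 0%N :> nat.
    by apply/eqP; rewrite -leqn0 -ltnS (leq_trans (ltn_ord l)).
  by apply/val_inj; rewrite /= !z.
rewrite (_ : [set x | _] = [set x | B i (tnth x i)]); last first.
  by apply/seteqP; split=> x /= => [|h k]; [exact|rewrite (ii k)].
rewrite [LHS](Qm i _ (mB i)) (bigD1 i)//=.
by rewrite big1 ?mule1// => k; rewrite (ii k) eqxx.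
Qed.

(** Over the full index set, [marginal] merely changes the index type; [g] is its inverse and
    carries both [A] and [min_le u0] across. *)
Lemma density_dominated (c : #|[set: 'I_m]%SET|.-tuple RB -> R) (u0 M : R) :
  is_density (pushforward Q (@marginal R m [set: 'I_m]%SET)) c ->
  (ess_sup_on (min_le u0) c <= M%:E)%E -> dominated Q M u0.
Proof.
move=> dc cM A mA Au.
pose I := [set: 'I_m]%SET; have inI i : i \in I by rewrite inE.
pose g (y : #|I|.-tuple RB) : m.-tuple RB := [tuple tnth y (enum_rank_in (inI i) i) | i < m].
have mg : measurable_fun setT g.
  apply/measurable_fun_tnthP => i.
  rewrite (_ : _ \o _ = fun y : #|I|.-tuple RB => tnth y (enum_rank_in (inI i) i)).
    exact: measurable_tnth.
  by apply/funext => x /=; rewrite tnth_mktuple.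
have mB : measurable (g @^-1` A) by rewrite -[X in measurable X]setTI; exact: mg.
have gK x : g (marginal I x) = x.
  by apply: eq_from_tnth => i; rewrite !tnth_mktuple enum_rankK_in.
have gv (y : #|I|.-tuple RB) k : tnth y k = tnth (g y) (enum_val k).
  by rewrite tnth_mktuple enum_valK_in.
have AE : A = @marginal R m I @^-1` (g @^-1` A).
  by apply/seteqP; split=> x /=; rewrite gK.
have Bu : g @^-1` A `<=` min_le u0.
  move=> y /Au[cy [i yi]]; split; first by move=> k; rewrite gv; exact: cy.
  by exists (enum_rank_in (inI i) i); move: yi; rewrite tnth_mktuple.
have := density_ub dc cM mB Bu.
rewrite -indep_marginal// pushforwardE -AE => h.
by rewrite -lee_fin EFinM !prE.
Qed.

Section pair_density.
Variables i j : 'I_m.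
Let I : {set 'I_m} := [set i; j]%SET.
Variable c : #|I|.-tuple RB -> R.
Hypothesis dc : is_density (pushforward Q (@marginal R m I)) c.

(** Coordinates of the marginal are addressed through the ranks of [i] and [j], so their order in
    the enumeration does not matter; as [I] has no other member, constraints at these two ranks
    already describe the corner. *)
Lemma density_pair_close (lam s om : R) :
  (ess_sup_on (corner s) c <= (lam + om)%:E)%E ->
  ((lam - om)%:E <= ess_inf_on (corner s) c)%E ->
  pair_close Q lam i j s om.
Proof.
move=> csup cinf G mG Gs.
have iI : i \in I by rewrite !inE eqxx.
have jI : j \in I by rewrite !inE eqxx orbT.
pose ri := enum_rank_in iI i; pose rj := enum_rank_in jI j.
pose B : set (#|I|.-tuple RB) := [set y | G (tnth y ri, tnth y rj)].
have mB : measurable B by exact: measurable_coord2.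
have BE : @marginal R m I @^-1` B = [set x | G (tnth x i, tnth x j)].
  by apply/seteqP; split=> x; rewrite /B/= !tnth_mktuple !enum_rankK_in.
have Bs : B `<=` corner s.
  move=> y /Gs[/= yi yj] k.
  have : enum_val k \in I := enum_valP k.
  rewrite !inE => /orP[/eqP|/eqP] kE.
    by rewrite (_ : k = ri)//; apply: enum_val_inj; rewrite kE enum_rankK_in.
  by rewrite (_ : k = rj)//; apply: enum_val_inj; rewrite kE enum_rankK_in.
have ub := density_ub dc csup mB Bs; have lb := density_lb dc cinf mB Bs.
rewrite -indep_marginal// pushforwardE BE in ub.
rewrite -indep_marginal// pushforwardE BE in lb.
have mE : measurable [set x : m.-tuple RB | G (tnth x i, tnth x j)] by exact: measurable_coord2.
rewrite -!prE// -EFinM lee_fin in ub; rewrite -!prE// -EFinM lee_fin in lb.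
rewrite ler_norml; apply/andP; split; lra.
Qed.

Lemma limit_pair_close (lam : R) :
  (ess_sup_on (corner s) c @[s --> (0:R)^'+] --> lam%:E)%E ->
  (ess_inf_on (corner s) c @[s --> (0:R)^'+] --> lam%:E)%E ->
  forall e, 0 < e -> exists2 s, 0 < s <= 1 & pair_close Q lam i j s e.
Proof.
move=> hsup hinf e e0.
have hub : nbhs (lam%:E) [set y | (y <= (lam + e)%:E)%E].
  have := @cvgr_le _ _ (nbhs lam) _ id lam cvg_id (lam + e); rewrite ltrDl => /(_ _ e0).
  by apply: filterS => x; rewrite /= lee_fin.
have hlb : nbhs (lam%:E) [set y | ((lam - e)%:E <= y)%E].
  have := @cvgr_ge _ _ (nbhs lam) _ id lam cvg_id (lam - e); rewrite gtrBl => /(_ _ e0).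
  by apply: filterS => x; rewrite /= lee_fin.
have : \forall s \near (0:R)^'+, [/\ 0 < s, s <= 1,
    (ess_sup_on (corner s) c <= (lam + e)%:E)%E &
    ((lam - e)%:E <= ess_inf_on (corner s) c)%E].
  near=> s; split; near: s.
  - exact: nbhs_right_gt.
  - exact: nbhs_right_le.
  - exact: hsup hub.
  - exact: hinf hlb.
move/filter_ex => [s [s0 s1 h1 h2]]; exists s; first by rewrite s0.
exact: density_pair_close.
Unshelve. all: by end_near. Qed.

Lemma osc_fin (lam u0 M s : R) : 0 < s <= u0 -> u0 < 1 ->
  (ess_sup_on (min_le u0) c <= M%:E)%E -> (osc c lam s <= (`|M| + `|lam|)%:E)%E.
Proof.
move=> /andP[s0 su] u1 /ess_sup_on_leP cM; apply/ess_sup_on_leP.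
have [_ c0 _] := dc.
apply: filterS cM => x cM xs.
have cx : unit_cube x.
  by move=> k; have /andP[x0 xk] := xs k; rewrite x0 (le_lt_trans (le_trans xk su) u1).
have iI : i \in I by rewrite !inE eqxx.
have : c x <= M.
  apply: cM; split => //; exists (enum_rank_in iI i).
  by have /andP[_ /le_trans] := xs (enum_rank_in iI i); apply.
have := c0 x cx => h1 h2.
apply: (le_trans (ler_normB _ _)); rewrite lerD2r ger0_norm//.
exact: le_trans (ler_norm _).
Qed.

(* On (s_(k+1), s_k) the integrand is at least osc(s_(k+1))/s_k, and the length of
   this interval is s_k/2. *)
Lemma osc_dyadic_sums (lam u0 M : R) : 0 < u0 < 1 ->
  (ess_sup_on (min_le u0) c <= M%:E)%E ->
  (\int[@lebesgue_measure R]_(s in `]0%R, u0[) (osc c lam s * (s^-1)%R%:E) < +oo)%E ->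
  exists W (om : nat -> R), [/\ forall k, 0 <= om k,
    forall k, (osc c lam (u0 / 2 / 2 ^+ k) <= (om k)%:E)%E &
    forall N, \sum_(k < N) om k <= W].
Proof.
move=> /andP[u0_gt0 u1] cM fin.
(* A total, real-valued version of the oscillation. The values chosen for s <= 0 and beyond [u0],
   the latter the bound of [osc_fin], make it nondecreasing on the whole line, which yields
   measurability. *)
pose om (s : R) : R := if s <= 0 then 0 else if s <= u0 then fine (osc c lam s) else `|M| + `|lam|.
have oscE s : 0 < s -> s <= u0 -> osc c lam s = (om s)%:E.
  move=> s0 su; rewrite /om leNgt s0 su /= fineK// ge0_fin_numE ?osc_ge0//.
  by apply: le_lt_trans (ltry _); apply: osc_fin cM => //; rewrite s0.
have om_ge0 s : 0 <= om s.
  rewrite /om; case: (leP s 0) => // s0; case: (leP s u0) => _; last by rewrite addr_ge0.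
  by rewrite fine_ge0// osc_ge0.
have om_big y : 0 < y -> u0 < y -> om y = `|M| + `|lam|.
  by move=> y0 uy; rewrite /om (lt_geF y0) (lt_geF uy).
have om_homo : {homo om : x y / x <= y}.
  move=> x y xy; have [x0|x0] := leP x 0; first by rewrite {1}/om x0 om_ge0.
  have y0 : 0 < y := lt_le_trans x0 xy.
  have [yu|uy] := leP y u0.
    by rewrite -lee_fin -!oscE// ?osc_le// (le_trans xy).
  rewrite (om_big y)//.
  have [xu|ux] := leP x u0; last by rewrite om_big.
  by rewrite -lee_fin -oscE//; apply: osc_fin cM => //; rewrite x0.
pose f (s : R) : \bar R := (om s * s^-1)%:E.
have mf : measurable_fun setT f.
  apply/measurable_EFinP; apply: measurable_funM.
    exact: nondecreasing_measurable.
  exact: (@measurable_transform R Reciprocal).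
have f0 s : 0 < s -> (0 <= f s)%E by move=> s0; rewrite lee_fin mulr_ge0// invr_ge0 ltW.
pose J := (\int[@lebesgue_measure R]_(s in `]0%R, u0[) f s)%E.
have Jfin : (J < +oo)%E.
  rewrite (_ : J = (\int[@lebesgue_measure R]_(s in `]0%R, u0[) (osc c lam s * (s^-1)%R%:E))%E)//.
  apply: eq_integral => s; rewrite inE/= in_itv/= => /andP[s0 su].
  by rewrite oscE// ?ltW// -EFinM.
have J0 : (0 <= J)%E.
  by apply: integral_ge0 => s; rewrite /= in_itv/= => /andP[s0 _]; exact: f0.
pose sk k : R := u0 / 2 ^+ k.
have sk0 k : 0 < sk k by rewrite divr_gt0// exprn_gt0.
have skS k : sk k = 2 * sk k.+1 by rewrite /sk exprS invfM; field; rewrite expf_neq0.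
have sk_u k : sk k <= u0.
  by rewrite ler_pdivrMr ?exprn_gt0// ler_peMr ?(ltW u0_gt0)// exprn_ege1// ler1n.
(* Each interval sees the oscillation at its left end, so the scales start at u0 / 2; it contributes
   half of that value to the integral, whence the factor 2. *)
exists (2 * fine J), (fun k => om (sk k.+1)); split.
- by move=> k; exact: om_ge0.
- move=> k; rewrite (_ : u0 / 2 / 2 ^+ k = sk k.+1) ?oscE//.
  by rewrite /sk exprS invfM mulrA.
move=> N.
have main : ((\sum_(k < N) (om (sk k.+1) / 2))%:E <=
    \int[@lebesgue_measure R]_(s in `]sk N, u0[) f s)%E.
  elim: N => [|N ih].
    rewrite big_ord0; apply: integral_ge0 => s; rewrite /= in_itv/= => /andP[s0 _].
    by apply: f0; exact: lt_trans s0.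
  have ss : sk N.+1 < sk N by rewrite [ltRHS]skS; have := sk0 N.+1; lra.
  have pos s : (`]sk N.+1, sk N[%classic `|` `]sk N, u0[%classic) s -> (0 <= f s)%E.
    move=> [] /=; rewrite in_itv/= => /andP[h _]; apply: f0; exact: lt_trans h.
  apply: (@le_trans _ _ (\int[@lebesgue_measure R]_(s in `]sk N.+1, sk N[%classic `|` `]sk N, u0[%classic) f s)%E); last first.
    apply: ge0_subset_integral => //.
    - exact: measurableU.
    - exact: measurable_funTS.
    - by move=> s; rewrite /= in_itv/= => /andP[h _]; apply: f0; exact: lt_trans h.
    - move=> s [] /=; rewrite !in_itv/= => /andP[h1 h2]; apply/andP; split => //.
        exact: lt_le_trans (sk_u N).
      exact: lt_trans h1.
  rewrite ge0_integral_setU//; last 2 first.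
  - exact: measurable_funTS.
  - apply/disj_setPS => s [] /=; rewrite !in_itv/= => /andP[_ h1] /andP[h2 _].
    by move: (lt_trans h1 h2); rewrite ltxx.
  rewrite big_ord_recr/= EFinD addeC; apply: leeD => //.
  apply: (@le_trans _ _ (\int[@lebesgue_measure R]_(s in `]sk N.+1, sk N[) (om (sk N.+1) / sk N)%:E)%E).
    rewrite integral_cst//= lebesgue_measure_itv/= lte_fin ss -EFinB -EFinM lee_fin.
    rewrite (skS N); rewrite le_eqVlt; apply/orP; left; apply/eqP; field; exact/lt0r_neq0.
  apply: ge0_le_integral => //.
  - by move=> s _; rewrite lee_fin divr_ge0// ltW.
  - exact: measurable_funTS.
  - move=> s; rewrite /= in_itv/= => /andP[h1 h2]; rewrite lee_fin.
    apply: ler_pM => //; first by rewrite invr_ge0 ltW.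
      exact/om_homo/ltW.
    have s0 : 0 < s by exact: lt_trans h1.
    by rewrite lef_pV2 ?posrE// ltW.
rewrite -mulr_suml in main.
suff : (\sum_(k < N) om (sk k.+1)) / 2 <= fine J by rewrite ler_pdivrMr// [fine J * 2]mulrC.
rewrite -lee_fin fineK ?ge0_fin_numE//; apply: (le_trans main).
apply: ge0_subset_integral => //.
- exact: measurable_funTS.
- by move=> s; rewrite /= in_itv/= => /andP[h _]; exact: f0.
- move=> s /=; rewrite !in_itv/= => /andP[h1 ->]; rewrite andbT.
  exact: lt_trans h1.
Qed.

End pair_density.
End copula_densities.

(** * Inversion of tail expansions *)

Section quantile_expansion.
Context (R : realType).

(** Apply ln y <= y to the square root of t. Squared, for t >= 1, it gives (ln t)^2 <= 4 t, the
    origin of the 4 in [D]. *)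
Lemma ln_le_2sqrt (t : R) : 0 < t -> ln t <= 2 * Num.sqrt t.
Proof.
move=> t0; have s0 : 0 < Num.sqrt t by rewrite sqrtr_gt0.
rewrite -{1}(sqr_sqrtr (ltW t0)) lnXn// mulr2n.
by have := ln_sublinear s0; lra.
Qed.

Variables (F : R -> R) (c A B T : R).
Hypothesis c0 : 0 < c.
Hypothesis expF : forall t, T <= t -> `|F t - (c / t + A * (ln t / t ^+ 2))| <= B / t ^+ 2.

Let D := 4 * `|A| + `|B|.

Let scaled_bounds (t : R) : T <= t -> 1 <= t ->
  [/\ `|F t * t - c| * ln t <= D & `|F t * t - c| * t <= `|A| * ln t + `|B|].
Proof.
move=> Tt t1; have t0 : 0 < t by lra.
have l0 : 0 <= ln t by exact: ln_ge0.
have key : `|F t * t - c| * t <= `|A| * ln t + `|B|.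
  have E : (F t * t - c) * t = (F t - (c / t + A * (ln t / t ^+ 2))) * t ^+ 2 + A * ln t.
    by field; lra.
  rewrite (_ : `|F t * t - c| * t = `|(F t * t - c) * t|); last by rewrite normrM (gtr0_norm t0).
  rewrite E (le_trans (ler_normD _ _))// [leLHS]addrC [`|A * _|]normrM (ger0_norm l0) lerD2l.
  rewrite normrM [`|t ^+ 2|]gtr0_norm ?exprn_gt0//.
  have := expF Tt; rewrite ler_pdivlMr ?exprn_gt0// => /le_trans; apply; exact: ler_norm.
split=> //; rewrite -(ler_pM2r t0) mulrAC.
apply: (le_trans (ler_wpM2r l0 key)).
have ls := ln_le_2sqrt t0; have lt := ln_sublinear t0.
have l4 : ln t * ln t <= 4 * t.
  have -> : 4 * t = (2 * Num.sqrt t) * (2 * Num.sqrt t).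
    by rewrite -{1}(sqr_sqrtr (ltW t0)); ring.
  by apply: ler_pM.
rewrite mulrDl -mulrA /D mulrDl; apply: lerD.
  by rewrite [4 * _]mulrC -mulrA ler_wpM2l.
by rewrite ler_wpM2l// ltW.
Qed.

Let scaled_near : exists T1, forall t, T1 <= t ->
  [/\ T <= t, 1 <= t & c / 2 <= F t * t <= 2 * c].
Proof.
pose K := 2 * (2 * `|A| + `|B|) / c.
have K0 : 0 <= K by rewrite divr_ge0 ?(ltW c0)// mulr_ge0// addr_ge0// mulr_ge0.
exists (Num.max T (Num.max 1 (K ^+ 2))) => t; rewrite !ge_max => /and3P[Tt t1 Kt]; split => //.
have t0 : 0 < t by lra.
have [_ h] := scaled_bounds Tt t1.
have Ks : K <= Num.sqrt t by rewrite -(ger0_norm K0) -sqrtr_sqr ler_wsqrtr.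
have s1 : 1 <= Num.sqrt t by rewrite -[leLHS]sqrtr1 ler_wsqrtr.
have tE : t = Num.sqrt t * Num.sqrt t by rewrite -expr2 sqr_sqrtr// ltW.
have : `|F t * t - c| * t <= c / 2 * t.
  apply: (le_trans h); apply: (@le_trans _ _ ((2 * `|A| + `|B|) * Num.sqrt t)).
    rewrite mulrDl; apply: lerD; last by rewrite ler_peMr.
    by rewrite [2 * _]mulrC -mulrA ler_wpM2l// ln_le_2sqrt.
  rewrite [X in _ <= _ * X]tE mulrA ler_wpM2r ?sqrtr_ge0//.
  move: Ks; rewrite /K ler_pdivrMr// => Ks; lra.
rewrite ler_pM2r// ler_norml => /andP[h1 h2]; apply/andP; split; lra.
Qed.

(** The inversion is done at a point t with a = F t, before any quantile appears. The product x = a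
    t stays within constant factors of c and (c - x) ln t is bounded, so ln (1 / a) = ln t - ln x
    differs from ln t by a bounded amount. *)
Lemma inverse_expansion : exists B' T', forall t, T' <= t ->
  [/\ `|t - (c / F t + A / c * ln (F t)^-1)| <= B',
   `|ln t / t ^+ 2 - (F t / c) ^+ 2 * ln (F t)^-1| <= B' * F t ^+ 2 &
   t ^- 2 <= B' * F t ^+ 2].
Proof.
have [T1 near1] := scaled_near.
pose L := `|ln (c / 2)| + `|ln (2 * c)|.
pose B1 := `|A| / c * (2 / c * D + L) + 2 / c * `|B|.
(* 12 / c^3 is the product of 3 c, (2 / c)^2 and c^-2, from c + x <= 3 c and 1 / x <= 2 / c. *)
pose B2 := 12 / c ^+ 3 * D + L / c ^+ 2.
exists (Num.max (Num.max B1 B2) ((2 / c) ^+ 2)), T1 => t T1t; have [Tt t1 /andP[x1 x2]] := near1 t T1t.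
have t0 : 0 < t by lra.
have [h _] := scaled_bounds Tt t1.
have := expF Tt.
set a := F t in x1 x2 h *; set x := a * t in x1 x2 h => ea.
have xgt0 : 0 < x by have := c0; lra.
have a0 : 0 < a by rewrite -(pmulr_lgt0 _ t0).
have tn : t != 0 by rewrite gt_eqF.
have an : a != 0 by rewrite gt_eqF.
have cn : c != 0 by rewrite gt_eqF.
have lx : `|ln x| <= L.
  have l1 : ln (c / 2) <= ln x by rewrite ler_ln ?posrE ?divr_gt0.
  have l2 : ln x <= ln (2 * c) by rewrite ler_ln ?posrE ?mulr_gt0.
  have n1 := ler_norm (- ln (c / 2)); have n2 := ler_norm (ln (2 * c)).
  rewrite normrN in n1; rewrite ler_norml /L; apply/andP; split.
    by have := normr_ge0 (ln (2 * c)); lra.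
  by have := normr_ge0 (ln (c / 2)); lra.
have lnV : ln a^-1 = ln t - ln x by rewrite lnV ?posrE// /x lnM ?posrE//; ring.
have l0 : 0 <= ln t by exact: ln_ge0.
have D0 : 0 <= D by rewrite addr_ge0// mulr_ge0.
have ix : x^-1 <= 2 / c.
  by rewrite -[leRHS]invf_div lef_pV2 ?posrE// divr_gt0.
have ix0 : 0 <= x^-1 by rewrite invr_ge0 ltW.
suff [h1 h2] : `|t - (c / a + A / c * ln a^-1)| <= B1 /\
    `|ln t / t ^+ 2 - (a / c) ^+ 2 * ln a^-1| <= B2 * a ^+ 2.
  split; first by rewrite !le_max h1.
    by apply: (le_trans h2); rewrite ler_wpM2r ?sqr_ge0// !le_max lexx orbT.
  apply: (@le_trans _ _ ((2 / c) ^+ 2 * a ^+ 2)); last first.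
    by rewrite ler_wpM2r ?sqr_ge0// !le_max lexx orbT.
  rewrite (_ : t ^- 2 = (x^-1 * a) ^+ 2); last by rewrite /x; field; rewrite tn an.
  rewrite exprMn ler_wpM2r ?sqr_ge0//.
  by rewrite lerXn2r ?nnegrE// divr_ge0// ltW.
split.
  (* An exact identity. Since (c - x) ln t, ln x and 1 / x are bounded, so is the first term; the
     last one is bounded by the expansion of [F]. *)
  have -> : t - (c / a + A / c * ln a^-1) =
     A / c * ((c - x) * ln t * x^-1 + ln x)
     + (a - (c / t + A * (ln t / t ^+ 2))) * t ^+ 2 * x^-1.
    by rewrite lnV /x; field; rewrite tn an cn.
  apply: (le_trans (ler_normD _ _)); apply: lerD.
    rewrite normrM normrM normfV (gtr0_norm c0) ler_wpM2l ?divr_ge0// ?(ltW c0)//.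
    apply: (le_trans (ler_normD _ _)); apply: lerD => //.
    rewrite normrM normrM (ger0_norm ix0) (ger0_norm l0) distrC [leRHS]mulrC.
    by apply: ler_pM => //; rewrite mulr_ge0.
  rewrite normrM [leRHS]mulrC (ger0_norm ix0); apply: ler_pM => //.
  rewrite normrM [`|t ^+ 2|]gtr0_norm ?exprn_gt0//.
  move: ea; rewrite ler_pdivlMr ?exprn_gt0// => /le_trans; apply; exact: ler_norm.
have -> : ln t / t ^+ 2 - (a / c) ^+ 2 * ln a^-1 =
    ((c - x) * ln t * ((c + x) * (x^-1) ^+ 2 * c^-2) + ln x * c^-2) * a ^+ 2.
  by rewrite lnV /x; field; rewrite tn an cn.
rewrite normrM [`|a ^+ 2|]gtr0_norm ?exprn_gt0// ler_pM2r ?exprn_gt0//.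
have c20 : 0 <= c^-2 by rewrite invr_ge0 exprn_ge0// ltW.
apply: (le_trans (ler_normD _ _)); apply: lerD; last first.
  by rewrite normrM (ger0_norm c20) ler_wpM2r.
rewrite normrM normrM (ger0_norm l0) distrC [leRHS]mulrC; apply: ler_pM => //.
  by rewrite mulr_ge0.
have cx : 0 <= c + x by have := c0; lra.
rewrite ger0_norm ?mulr_ge0 ?exprn_ge0//.
have -> : 12 / c ^+ 3 = (3 * c) * (2 / c) ^+ 2 * c^-2 by field.
rewrite ler_wpM2r//; apply: ler_pM => //; first by rewrite exprn_ge0.
  by lra.
by rewrite lerXn2r ?nnegrE// divr_ge0// ltW.
Qed.

Hypothesis niF : forall s t, s <= t -> F t <= F s.
Variable L : R.
Hypothesis lipF : forall s t, T <= s -> s <= t -> F s - F t <= L * (t - s).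

Lemma upper_quantileP (T0 : R) : exists2 a0, 0 < a0 & forall a, 0 < a < a0 ->
  T0 <= upper_quantile F a /\ F (upper_quantile F a) = a.
Proof.
have [T1 near1] := scaled_near.
(* [T + 1] leaves room for a step of length at most 1 to the left of the quantile within the range
   of the Lipschitz bound. *)
pose T2 := Num.max T1 (Num.max T0 (T + 1)).
have T12 : T1 <= T2 by rewrite le_max lexx.
have T02 : T0 <= T2 by rewrite !le_max lexx orbT.
have TT2 : T + 1 <= T2 by rewrite !le_max lexx !orbT.
have [_ T2_1 /andP[FT2 _]] := near1 T2 T12.
exists (F T2).
  rewrite -(pmulr_lgt0 _ (lt_le_trans ltr01 T2_1)).
  by apply: lt_le_trans FT2; rewrite divr_gt0.
move=> a /andP[a0 aF].
pose E := [set t | F t <= a].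
have lbE : lbound E T2.
  move=> t Et; rewrite leNgt; apply/negP => tT.
  by have := le_lt_trans (le_trans (niF (ltW tT)) Et) aF; rewrite ltxx.
have E0 : E !=set0.
  pose t := Num.max T1 (2 * c / a).
  have Tt : T1 <= t by rewrite le_max lexx.
  have [_ t1 /andP[_ Ft]] := near1 t Tt.
  exists t; rewrite /E/= -(ler_pM2r (lt_le_trans ltr01 t1)) (le_trans Ft)//.
  by rewrite [leRHS]mulrC -ler_pdivrMr// le_max lexx orbT.
have hE : has_inf E by split=> //; exists T2.
set q := upper_quantile F a; have qE : q = inf E by [].
have qT2 : T2 <= q by exact: lb_le_inf.
have L1 : 0 < `|L| + 1 by rewrite ltr_wpDl.
have lip s t : T <= s -> s <= t -> F s - F t <= (`|L| + 1) * (t - s).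
  move=> Ts st; apply: (le_trans (lipF Ts st)); rewrite ler_wpM2r ?subr_ge0//.
  by have := ler_norm L; lra.
split; first exact: le_trans qT2.
(* If F q > a, an element of [E] close to q would still have tail above a; if F q < a, a point
   slightly to the left of q would already belong to [E]. *)
apply/eqP; rewrite eq_le; apply/andP; split; rewrite leNgt; apply/negP => h.
  have d0 : 0 < (F q - a) / (`|L| + 1) by rewrite divr_gt0// subr_gt0.
  have [t Et tq] := inf_adherent d0 hE; rewrite -qE in tq.
  have qt : q <= t by apply: ge_inf => //; exists T2.
  rewrite -ltrBlDl ltr_pdivlMr// mulrC in tq.
  have := lip q t ltac:(lra) qt; have : F t <= a := Et.
  lra.
pose dd := Num.min 1 ((a - F q) / (`|L| + 1)).
have d0 : 0 < dd by rewrite lt_min ltr01 divr_gt0// subr_gt0.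
have d1 : dd <= 1 by rewrite ge_min lexx.
have d2 : (`|L| + 1) * dd <= a - F q.
  by rewrite -ler_pdivlMl// mulrC ge_min lexx orbT.
have := lip (q - dd) q ltac:(lra) ltac:(lra).
rewrite (_ : q - (q - dd) = dd) => [hl|]; last by ring.
have Es : E (q - dd) by rewrite /E/=; lra.
have : q <= q - dd by apply: ge_inf => //; exists T2.
lra.
Qed.

Lemma quantile_expansion (T0 : R) : exists B' a0, [/\ 0 <= B', 0 < a0 &
  forall a, 0 < a < a0 -> let q := upper_quantile F a in
  [/\ T0 <= q, F q = a, `|q - (c / a + A / c * ln a^-1)| <= B',
      `|ln q / q ^+ 2 - (a / c) ^+ 2 * ln a^-1| <= B' * a ^+ 2 &
      q ^- 2 <= B' * a ^+ 2]].
Proof.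
have [B' [T' inv]] := inverse_expansion.
have [a0 a00 qP] := upper_quantileP (Num.max T0 T').
exists `|B'|, a0; split => // a aa q.
have [] := qP a aa; rewrite ge_max -/q => /andP[q0 q1] Fq.
have [h1 h2 h3] := inv q q1; rewrite Fq in h1 h2 h3.
have BB : B' * a ^+ 2 <= `|B'| * a ^+ 2 by rewrite ler_wpM2r ?sqr_ge0// ler_norm.
split=> //; [exact: le_trans h1 (ler_norm _)|exact: le_trans h2 BB|exact: le_trans h3 BB].
Qed.

End quantile_expansion.

(** * Calculus of logarithmic error terms *)

Section log_expansions.
Context (R : realType).
Implicit Types (f g : R -> R) (A B c e k t T : R).

Definition log_close e f g := exists B T, forall t, T <= t ->
  `|f t - g t| <= B / t ^+ 2 + e * (ln t / t ^+ 2).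

Lemma log_closeD e1 e2 f1 f2 g1 g2 : log_close e1 f1 g1 -> log_close e2 f2 g2 ->
  log_close (e1 + e2) (fun t => f1 t + f2 t) (fun t => g1 t + g2 t).
Proof.
move=> [B1 [T1 h1]] [B2 [T2 h2]]; exists (B1 + B2), (Num.max T1 T2) => t.
rewrite ge_max => /andP[/h1 {}h1 /h2 {}h2].
rewrite opprD addrACA (le_trans (ler_normD _ _))// !mulrDl addrACA.
exact: lerD.
Qed.

Lemma log_close_trans e1 e2 f g h : log_close e1 f g -> log_close e2 g h ->
  log_close (e1 + e2) f h.
Proof.
move=> [B1 [T1 h1]] [B2 [T2 h2]]; exists (B1 + B2), (Num.max T1 T2) => t.
rewrite ge_max => /andP[/h1 {}h1 /h2 {}h2].
rewrite -(subrKA (g t)) (le_trans (ler_normD _ _))// !mulrDl addrACA.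
exact: lerD.
Qed.

Lemma log_closeZ k e f g : log_close e f g ->
  log_close (`|k| * e) (fun t => k * f t) (fun t => k * g t).
Proof.
move=> [B [T h]]; exists (`|k| * B), T => t /h {}h.
by rewrite -mulrBr normrM -!mulrA -mulrDr ler_wpM2l.
Qed.

Lemma log_close_le e1 e2 f g : e1 <= e2 -> log_close e1 f g -> log_close e2 f g.
Proof.
move=> ee [B [T h]]; exists B, (Num.max T 1) => t.
rewrite ge_max => /andP[/h {}h t1]; apply: (le_trans h); rewrite lerD2l ler_wpM2r//.
by rewrite divr_ge0 ?ln_ge0// exprn_ge0//; lra.
Qed.

Lemma log_close0 f g : log_close 0 f g <->
  exists B T, forall t, T <= t -> `|f t - g t| <= B / t ^+ 2.
Proof.
by split=> -[B [T h]]; exists B, T => t /h; rewrite mul0r addr0.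
Qed.

Lemma log_close_sum (I : Type) (r : seq I) (P : pred I) (e : I -> R) (f g : I -> R -> R) :
  (forall i, P i -> log_close (e i) (f i) (g i)) ->
  log_close (\sum_(i <- r | P i) e i) (fun t => \sum_(i <- r | P i) f i t)
    (fun t => \sum_(i <- r | P i) g i t).
Proof.
move=> h; elim: r => [|i r ih].
  by exists 0, 0 => t _; rewrite !big_nil subrr normr0 !mul0r addr0.
have [Pi|Pi] := boolP (P i).
  have := log_closeD (h i Pi) ih; rewrite big_cons Pi.
  by congr log_close; apply/funext => t; rewrite big_cons Pi.
have -> : (fun t => \sum_(k <- i :: r | P k) f k t) = (fun t => \sum_(k <- r | P k) f k t).
  by apply/funext => t; rewrite big_cons (negbTE Pi).
have -> : (fun t => \sum_(k <- i :: r | P k) g k t) = (fun t => \sum_(k <- r | P k) g k t).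
  by apply/funext => t; rewrite big_cons (negbTE Pi).
by rewrite big_cons (negbTE Pi).
Qed.

Lemma log_close_eqaddo f g : (forall e, 0 < e -> log_close e f g) ->
  f = g +o_ (+oo_ R) (fun t => ln t / t ^+ 2).
Proof.
move=> h; apply/eqaddoP => e e0.
have e2 : 0 < e / 2 by rewrite divr_gt0.
have [B [T hT]] := h _ e2.
near=> t.
have Tt : T <= t by near: t; apply: nbhs_pinfty_ge; exact: num_real.
have t1 : 1 <= t by near: t; apply: nbhs_pinfty_ge; exact: num_real.
(* Beyond this point B <= (e / 2) ln t, so that the t^-2 term is absorbed by the logarithmic one. *)
have tB : expR (B / (e / 2)) <= t by near: t; apply: nbhs_pinfty_ge; exact: num_real.
have t0 : 0 < t by lra.
have l0 : 0 <= ln t by exact: ln_ge0.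
rewrite [leLHS](_ : _ = `|f t - g t|)// (le_trans (hT t Tt))//.
rewrite [`|ln t / _|]ger0_norm; last by rewrite divr_ge0// exprn_ge0// ltW.
rewrite (mulrA (e / 2)) -mulrDl (mulrA e) ler_pM2r ?invr_gt0 ?exprn_gt0//.
have : B / (e / 2) <= ln t by rewrite -(expRK (B / (e / 2))) ler_ln ?posrE ?expR_gt0.
by rewrite ler_pdivrMr//; lra.
Unshelve. all: by end_near. Qed.

Lemma log_close_eqaddO f g : log_close 0 f g ->
  f = g +O_ (+oo_ R) (fun t => t ^- 2).
Proof.
move=> /log_close0[B [T h]]; apply/eqaddOP.
exists B; split; first exact: num_real.
move=> B' BB'; near=> t.
have Tt : T <= t by near: t; apply: nbhs_pinfty_ge; exact: num_real.
have t1 : 1 <= t by near: t; apply: nbhs_pinfty_ge; exact: num_real.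
rewrite [leLHS](_ : _ = `|f t - g t|)// (le_trans (h t Tt))//.
rewrite [`|_ ^- 2|]ger0_norm ?invr_ge0 ?sqr_ge0// ler_wpM2r ?invr_ge0 ?sqr_ge0//.
exact: ltW.
Unshelve. all: by end_near. Qed.

Definition log_close_at0 e f g := exists B a0, 0 < a0 /\ forall a, 0 < a < a0 ->
  `|f a - g a| <= B * a ^+ 2 + e * (a ^+ 2 * ln a^-1).

Lemma log_close_at0_eqaddo f g : (forall e, 0 < e -> log_close_at0 e f g) ->
  f = g +o_ ((0 : R)^'+) (fun a => a ^+ 2 * ln a^-1).
Proof.
move=> h; apply/eqaddoP => e e0.
have e2 : 0 < e / 2 by rewrite divr_gt0.
have [B [a0 [a00 hT]]] := h _ e2.
near=> a.
have ap : 0 < a by near: a; exact: nbhs_right_gt.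
have aa : a < a0 by near: a; exact: nbhs_right_lt.
have a1 : a <= 1 by near: a; exact: nbhs_right_le.
have aB : a <= expR (- (B / (e / 2))) by near: a; apply: nbhs_right_le; exact: expR_gt0.
have l0 : 0 <= ln a^-1 by rewrite ln_ge0// invf_ge1.
rewrite [leLHS](_ : _ = `|f a - g a|)// (le_trans (hT a _)) ?ap//.
rewrite [`|_ * ln _|]ger0_norm; last by rewrite mulr_ge0// sqr_ge0.
have : B / (e / 2) <= ln a^-1.
  rewrite lnV ?posrE// lerNr -(expRK (- (B / (e / 2)))) ler_ln ?posrE ?expR_gt0//.
rewrite ler_pdivrMr// => hB.
rewrite (mulrCA (e / 2)) (mulrCA e) (mulrC B) -mulrDr ler_pM2l ?exprn_gt0//.
lra.
Unshelve. all: by end_near. Qed.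

Lemma log_close_at0_eqaddO f g : log_close_at0 0 f g ->
  f = g +O_ ((0 : R)^'+) (fun a => a ^+ 2).
Proof.
move=> [B [a0 [a00 h]]]; apply/eqaddOP.
exists B; split; first exact: num_real.
move=> B' BB'; near=> a.
have ap : 0 < a by near: a; exact: nbhs_right_gt.
have aa : a < a0 by near: a; exact: nbhs_right_lt.
rewrite [leLHS](_ : _ = `|f a - g a|)// (le_trans (h a _)) ?ap//.
rewrite [`|_ ^+ 2|]ger0_norm ?sqr_ge0// mul0r addr0 ler_wpM2r ?sqr_ge0//.
exact: ltW.
Unshelve. all: by end_near. Qed.

Lemma bounded_eqaddO1 f g B a0 : 0 < a0 ->
  (forall a, 0 < a < a0 -> `|f a - g a| <= B) ->
  f = g +O_ ((0 : R)^'+) (fun _ => 1 : R).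
Proof.
move=> a00 h; apply/eqaddOP.
exists B; split; first exact: num_real.
move=> B' BB'; near=> a.
have ap : 0 < a by near: a; exact: nbhs_right_gt.
have aa : a < a0 by near: a; exact: nbhs_right_lt.
rewrite [leLHS](_ : _ = `|f a - g a|)// (le_trans (h a _)) ?ap//.
rewrite normr1 mulr1; exact: ltW.
Unshelve. all: by end_near. Qed.

End log_expansions.

(** * Calibration and quantile differences from tail expansions *)

Section tail_quantiles.
Context (R : realType).
Implicit Types (F G : R -> R) (A B c e k t T : R).

Definition tail_regular F := (forall s t, s <= t -> F t <= F s) /\
  exists L T, forall s t, T <= s -> s <= t -> F s - F t <= L * (t - s).

Definition tail_expansion F c A :=
  log_close 0 F (fun t => c / t + A * (ln t / t ^+ 2)).

Lemma tail_quantile F c A T0 : 0 < c -> tail_regular F -> tail_expansion F c A ->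
  exists B a0, [/\ 0 <= B, 0 < a0 &
  forall a, 0 < a < a0 -> let q := upper_quantile F a in
  [/\ T0 <= q, F q = a, `|q - (c / a + A / c * ln a^-1)| <= B,
      `|ln q / q ^+ 2 - (a / c) ^+ 2 * ln a^-1| <= B * a ^+ 2 &
      q ^- 2 <= B * a ^+ 2]].
Proof.
move=> c0 [Fni [L [T1 lip]]] /log_close0[B [T2 h]].
apply: (@quantile_expansion _ F c A B (Num.max T1 T2) c0 _ Fni L).
  by move=> t; rewrite ge_max => /andP[_ /h].
by move=> s t; rewrite ge_max => /andP[/lip +] _; exact.
Qed.

(** At the quantile q of [F] one has F q = a, so the calibration error is G - F evaluated at q. Only
    [F] is inverted, and only through ln q / q^2 = (a / c)^2 ln (1 / a) + O(a^2). *)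
Lemma calibration_expansion F G c A e k : 0 < c -> 0 <= e ->
  tail_regular F -> tail_expansion F c A ->
  log_close e (fun t => G t - F t) (fun t => k * (ln t / t ^+ 2)) ->
  log_close_at0 (e / c ^+ 2) (fun a => G (upper_quantile F a) - a)
    (fun a => k / c ^+ 2 * (a ^+ 2 * ln a^-1)).
Proof.
move=> c0 e0 rF xF [B [T h]].
have [B1 [a0 [B10 a00 qP]]] := tail_quantile T c0 rF xF.
exists (`|B| * B1 + e * B1 + `|k| * B1), a0; split => // a aa.
have [Tq Fq _ lnq q2] := qP a aa.
have := h _ Tq; rewrite Fq; set q := upper_quantile F a in Tq lnq q2 * => hq.
have E : (a / c) ^+ 2 * ln a^-1 = c ^- 2 * (a ^+ 2 * ln a^-1).
  by rewrite exprMn exprVn; ring.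
rewrite E in lnq.
set x := a ^+ 2 * ln a^-1 in lnq *; set y := ln q / q ^+ 2 in lnq hq.
have -> : G q - a - k / c ^+ 2 * x = (G q - a - k * y) + k * (y - c ^- 2 * x) by ring.
apply: (le_trans (ler_normD _ _)).
have h1 : `|k * (y - c ^- 2 * x)| <= `|k| * B1 * a ^+ 2.
  by rewrite normrM -mulrA ler_wpM2l.
have h2 : B / q ^+ 2 <= `|B| * B1 * a ^+ 2.
  rewrite -mulrA; apply: le_trans (ler_wpM2l (normr_ge0 B) q2).
  by rewrite ler_wpM2r ?invr_ge0 ?sqr_ge0// ler_norm.
have h3 : e * y <= e * B1 * a ^+ 2 + e / c ^+ 2 * x.
  rewrite -!mulrA -mulrDr ler_wpM2l//.
  by move: lnq => /(le_trans (ler_norm _)); lra.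
rewrite !mulrDl; lra.
Qed.

Lemma quantile_difference F G c A A' : 0 < c ->
  tail_regular F -> tail_expansion F c A -> tail_regular G -> tail_expansion G c A' ->
  exists B a0, 0 < a0 /\ forall a, 0 < a < a0 ->
    `|upper_quantile G a - upper_quantile F a - (A' - A) / c * ln a^-1| <= B.
Proof.
move=> c0 rF xF rG xG.
have [B1 [a1 [_ a10 q1]]] := tail_quantile 0 c0 rF xF.
have [B2 [a2 [_ a20 q2]]] := tail_quantile 0 c0 rG xG.
exists (B2 + B1), (Num.min a1 a2); rewrite lt_min a10 a20; split => // a.
rewrite lt_min => /and3P[a0 aa1 aa2].
have [|_ _ h1 _ _] := q1 a; first by rewrite a0.
have [|_ _ h2 _ _] := q2 a; first by rewrite a0.
set x := upper_quantile F a in h1 *; set y := upper_quantile G a in h2 *.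
have -> : y - x - (A' - A) / c * ln a^-1 =
  (y - (c / a + A' / c * ln a^-1)) - (x - (c / a + A / c * ln a^-1)) by ring.
by rewrite (le_trans (ler_normB _ _))// lerD.
Qed.

End tail_quantiles.

(** * Tail expansion of the aggregate under one law *)

Section law_expansion.
Context (R : realType) (m : nat).
Local Notation RB := (measurableTypeR R).
Local Notation Pi := (indep_copula R m).
Variables (Q : probability (m.-tuple RB) R) (M u0 : R).
Hypotheses (Qm : uniform_margins Q) (M0 : 0 <= M) (u01 : 0 < u0 < 1).
Hypothesis QM : dominated Q M u0.

Lemma pair_event_eps (lam a b : R) (i j : 'I_m) : i != j ->
  0 < a <= 1 -> 0 < b <= 1 ->
  (forall e, 0 < e -> exists2 s, 0 < s <= 1 & pair_close Q lam i j s e) ->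
  forall e, 0 < e -> log_close e (fun t => pr Q (pair_event a b t i j))
    (fun t => 2 * a * b * lam * (ln t / t ^+ 2)).
Proof.
move=> ij a01 b01 close e e0.
(* Closeness e / 2 is relative to a probability of order 2 a b ln t / t^2 with a b <= 1, which
   amounts to at most e in the scale of [log_close]. *)
have [s s01 sc] := close (e / 2) ltac:(lra).
have [B HB] := indep_pair_event_asymp ij a01 b01.
have h0 : log_close 0 (fun t => pr Pi (pair_event a b t i j))
    (fun t => 2 * a * b * (ln t / t ^+ 2)).
  by apply/log_close0; exists B, 4.
apply: (@log_close_le _ (e / 2 * (2 * a * b) + `|lam| * 0)).
  rewrite mulr0 addr0 (_ : _ * _ = e * (a * b)) ?ler_piMr ?(ltW e0)//; last by field.
  have /andP[a0 a1] := a01; have /andP[b0 b1] := b01.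
  by rewrite mulr_ile1// ltW.
apply: (log_close_trans (g := fun t => lam * pr Pi (pair_event a b t i j))); last first.
  have := log_closeZ lam h0.
  by congr log_close; apply/funext => t; ring.
exists ((M + `|lam|) * (4 / s) + e / 2 * B), (Num.max 4 (Num.max (2 / u0) (2 / s))) => t.
rewrite !ge_max => /and3P[t4 tu ts].
have e2 : 0 <= e / 2 by lra.
have /= := pair_deviation_eps Qm M0 u01 QM ij a01 b01 e2 s01 sc tu ts.
move=> /le_trans; apply.
have hP : pr Pi (pair_event a b t i j) <= B / t ^+ 2 + 2 * a * b * (ln t / t ^+ 2).
  by have := HB t t4 => /(le_trans (ler_norm _)); lra.
have := ler_wpM2l e2 hP; lra.
Qed.

Lemma pair_event_dyadic (lam a b s0 W : R) (om : nat -> R) (i j : 'I_m) : i != j ->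
  0 < a <= 1 -> 0 < b <= 1 -> 0 < s0 <= 1 -> (forall k, 0 <= om k) ->
  (forall N, \sum_(k < N) om k <= W) ->
  (forall k, pair_close Q lam i j (s0 / 2 ^+ k) (om k)) ->
  log_close 0 (fun t => pr Q (pair_event a b t i j))
    (fun t => 2 * a * b * lam * (ln t / t ^+ 2)).
Proof.
move=> ij a01 b01 s01 om0 omW close.
have [B HB] := indep_pair_event_asymp ij a01 b01.
have h0 : log_close 0 (fun t => pr Pi (pair_event a b t i j))
    (fun t => 2 * a * b * (ln t / t ^+ 2)).
  by apply/log_close0; exists B, 4.
rewrite -[X in log_close X](_ : 0 + `|lam| * 0 = 0); last by rewrite mulr0 addr0.
apply: (log_close_trans (g := fun t => lam * pr Pi (pair_event a b t i j))); last first.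
  have := log_closeZ lam h0.
  by congr log_close; apply/funext => t; ring.
apply/log_close0; eexists; exists (Num.max (2 / u0) (2 / s0)) => t.
rewrite !ge_max => /andP[tu ts].
exact: (pair_deviation_dyadic Qm M0 u01 QM ij a01 b01 s01 om0 omW close tu ts).
Qed.

Variables (w : 'I_m -> R) (S : statistic) (lam : 'I_m -> 'I_m -> R).
Hypotheses (w0 : forall i, 0 < w i) (w1 : \sum_i w i = 1).
Let c := scale_const R S.
Let L := \sum_(i < m) \sum_(j < m | (i < j)%N) lam i j * w i * w j.

Let w01 := weight_le1 w0 w1.

Let a01 : forall i, 0 < c * w i <= 1 := scaled_weight_le1 S w01.

Lemma survival_regular : tail_regular (survival S w Q).
Proof.
split; first by move=> s t; exact: survival_nonincreasing.
exists (M * m%:R ^+ 3), (m%:R / u0 + 1) => s t.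
exact: survival_increment.
Qed.

Lemma survival_of_pairs (e : 'I_m -> 'I_m -> R) :
  (forall i j : 'I_m, (i < j)%N -> log_close (e i j)
    (fun t => pr Q (pair_event (c * w i) (c * w j) t i j))
    (fun t => 2 * (c * w i) * (c * w j) * lam i j * (ln t / t ^+ 2))) ->
  log_close (\sum_(i < m) \sum_(j < m | (i < j)%N) e i j) (survival S w Q)
    (fun t => c / t + 2 * c ^+ 2 * L * (ln t / t ^+ 2)).
Proof.
move=> h.
have [B [T HB]] := survival_expansion Qm M0 u01 QM S w0 w1.
rewrite -[X in log_close X]add0r.
apply: log_close_trans.
  by apply/log_close0; exists B, T; exact: HB.
rewrite -[X in log_close X]add0r; apply: log_closeD.
  by exists 0, 0 => t _; rewrite subrr normr0 !mul0r addr0.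
have E t : 2 * c ^+ 2 * L * (ln t / t ^+ 2) = \sum_(i < m) \sum_(j < m | (i < j)%N)
    2 * (c * w i) * (c * w j) * lam i j * (ln t / t ^+ 2).
  rewrite /L mulr_sumr mulr_suml; apply: eq_bigr => i _.
  by rewrite mulr_sumr mulr_suml; apply: eq_bigr => j _; ring.
rewrite (funext E); apply: log_close_sum => i _; apply: log_close_sum => j ij.
exact: h.
Qed.

Lemma survival_expansion_eps :
  (forall i j : 'I_m, (i < j)%N -> forall e, 0 < e ->
    exists2 s, 0 < s <= 1 & pair_close Q (lam i j) i j s e) ->
  forall e, 0 < e -> log_close e (survival S w Q)
    (fun t => c / t + 2 * c ^+ 2 * L * (ln t / t ^+ 2)).
Proof.
move=> h e e0.
(* [N] counts the pairs; dividing by [N + 1] also covers the case of no pair. *)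
pose N : R := \sum_(i < m) \sum_(j < m | (i < j)%N) 1.
have N0 : 0 <= N by apply: sumr_ge0 => i _; apply: sumr_ge0.
have N1 : 0 < N + 1 by lra.
pose e' := e / (N + 1); have e'0 : 0 < e' by rewrite divr_gt0.
apply: (@log_close_le _ (\sum_(i < m) \sum_(j < m | (i < j)%N) e')).
  rewrite (_ : \sum_(i < m) _ = e' * N); last first.
    rewrite mulr_sumr; apply: eq_bigr => i _.
    by rewrite mulr_sumr; apply: eq_bigr => j _; rewrite mulr1.
  rewrite /e' mulrAC ler_pdivrMr// ler_wpM2l ?(ltW e0)//; lra.
apply: survival_of_pairs => i j ij.
apply: pair_event_eps => //; try exact: a01.
  by rewrite neq_ltn ij.
exact: h.
Qed.

Lemma survival_expansion_dyadic :
  (forall i j : 'I_m, (i < j)%N -> exists (s0 W : R) (om : nat -> R), [/\ 0 < s0 <= 1, forall k, 0 <= om k,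
    forall N, \sum_(k < N) om k <= W &
    forall k, pair_close Q (lam i j) i j (s0 / 2 ^+ k) (om k)]) ->
  tail_expansion (survival S w Q) c (2 * c ^+ 2 * L).
Proof.
move=> h; rewrite /tail_expansion.
have := @survival_of_pairs (fun _ _ => 0).
rewrite big1; last by move=> i _; rewrite big1.
apply => i j ij; have [s0 [W [om [s01 om0 omW close]]]] := h i j ij.
apply: (pair_event_dyadic _ _ _ s01 om0 omW close); try exact: a01.
by rewrite neq_ltn ij.
Qed.

End law_expansion.

Theorem mainTheorem6 (R : realType) (m : nat)
    (d : measure_display) (Omega : measurableType d) (P : probability Omega R)
    (U : {RV P >-> m.-tuple (measurableTypeR R)})
    (w : 'I_m -> R)
    (c : forall I : {set 'I_m}, #|I|.-tuple (measurableTypeR R) -> R)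
    (u0 : R) (M : {set 'I_m} -> R) (lam : 'I_m -> 'I_m -> R) :
  (forall (i : 'I_m) (A : set (measurableTypeR R)), measurable A ->
     P [set x | A (tnth (U x) i)] = uniform_prob (@ltr01 R) A) ->
  (forall i : 'I_m, 0 < w i) ->
  \sum_(i < m) w i = 1 ->
  0 < u0 < 1 ->
  (forall I : {set 'I_m}, (2 <= #|I|)%N ->
     is_density (pushforward (distribution P U) (marginal I)) (c I)) ->
  (forall I : {set 'I_m}, (2 <= #|I|)%N ->
     (ess_sup_on (min_le u0) (c I) <= (M I)%:E)%E) ->
  (forall i j : 'I_m, (i < j)%N ->
     ess_sup_on (corner s) (c [set i; j]%SET) @[s --> 0^'+] --> (lam i j)%:E /\
     ess_inf_on (corner s) (c [set i; j]%SET) @[s --> 0^'+] --> (lam i j)%:E) ->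
  forall S : statistic,
  let C := distribution P U in
  let Pi := indep_copula R m in
  let K := \sum_(i < m) \sum_(j < m | (i < j)%N)
             (lam i j - 1) * w i * w j in
  let cS := scale_const R S in
  [/\ (fun t : R => survival S w C t - survival S w Pi t) =
        (fun t => 2 * cS ^+ 2 * K * (ln t / t ^+ 2))
        +o_ (+oo_ R) (fun t : R => ln t / t ^+ 2),
      (fun a : R => calibration S w C a) =
        (fun a => 2 * K * (a ^+ 2 * ln a^-1))
        +o_ ((0 : R)^'+) (fun a : R => a ^+ 2 * ln a^-1) &
      (forall i j : 'I_m, (i < j)%N ->
         (\int[@lebesgue_measure R]_(s in `]0%R, u0[)
            (osc (c [set i; j]%SET) (lam i j) s * (s^-1)%R%:E) < +oo)%E) ->
      [/\ (fun t : R => survival S w C t - survival S w Pi t) =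
            (fun t => 2 * cS ^+ 2 * K * (ln t / t ^+ 2))
            +O_ (+oo_ R) (fun t : R => t ^- 2),
          (fun a : R => calibration S w C a) =
            (fun a => 2 * K * (a ^+ 2 * ln a^-1))
            +O_ ((0 : R)^'+) (fun a : R => a ^+ 2) &
          (fun a : R => quantile S w C a - quantile S w Pi a) =
            (fun a => 2 * cS * K * ln a^-1)
            +O_ ((0 : R)^'+) (fun _ : R => 1 : R)]].
Proof.
move=> margins w0 w1 u01 dens bound lims S C Pi K cS.
have c0 : 0 < cS := scale_const_gt0 R S.
have u0_gt0 : 0 < u0 by case/andP: u01.
have u0_lt1 : u0 < 1 by case/andP: u01.
have Cm : uniform_margins C := margins.
have [M' M'0 CM] : exists2 M', 0 <= M' & dominated C M' u0.
  have [m1|m2] := leqP m 1.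
    by exists 1 => //; exact: uniform_margins_dominated1.
  have I2 : (2 <= #|[set: 'I_m]%SET|)%N by rewrite cardsT card_ord.
  exists `|M [set: 'I_m]%SET| => //.
  apply: (density_dominated (dens _ I2)).
  by rewrite (le_trans (bound _ I2))// lee_fin ler_norm.
have Pim : uniform_margins Pi := @indep_uniform_margins R m.
have PiM : dominated Pi 1 u0 := @indep_dominated R m u0.
have card2 (i j : 'I_m) : (i < j)%N -> (2 <= #|[set i; j]%SET|)%N.
  by move=> ij; rewrite cards2 neq_ltn ij.
have rC : tail_regular (survival S w C) := survival_regular Cm M'0 u01 CM S w0 w1.
have rPi : tail_regular (survival S w Pi) := survival_regular Pim ler01 u01 PiM S w0 w1.
pose L (l : 'I_m -> 'I_m -> R) :=
  2 * cS ^+ 2 * \sum_(i < m) \sum_(j < m | (i < j)%N) l i j * w i * w j.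
(* Independence satisfies the closeness condition with limit 1 and error 0 at every scale, so its
   expansion has the sharp remainder without any Dini condition. *)
have xPi : tail_expansion (survival S w Pi) cS (L (fun _ _ => 1)).
  apply: (survival_expansion_dyadic Pim ler01 u01 PiM S w0 w1) => i j ij.
  exists 1, 0, (fun _ => 0); split=> //; first by rewrite ltr01 lexx.
    by move=> N; rewrite big1.
  by move=> k G mG _; rewrite !mul1r subrr normr0 mul0r.
have LK : L lam - L (fun _ _ => 1) = 2 * cS ^+ 2 * K.
  rewrite -mulrBr -sumrB; congr (_ * _); apply: eq_bigr => i _.
  by rewrite -sumrB; apply: eq_bigr => j _; ring.
have difference e : log_close e (survival S w C)
      (fun t => cS / t + L lam * (ln t / t ^+ 2)) ->
    log_close e (fun t => survival S w C t - survival S w Pi t)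
      (fun t => 2 * cS ^+ 2 * K * (ln t / t ^+ 2)).
  move=> xC; have := log_closeD xC (log_closeZ (-1) xPi).
  rewrite mulr0 addr0 -LK => h; move: h; congr log_close; apply/funext => t; ring.
have calib e : 0 <= e -> log_close e (fun t => survival S w C t - survival S w Pi t)
      (fun t => 2 * cS ^+ 2 * K * (ln t / t ^+ 2)) ->
    log_close_at0 (e / cS ^+ 2) (calibration S w C)
      (fun a => 2 * K * (a ^+ 2 * ln a^-1)).
  move=> e0 /(calibration_expansion c0 e0 rPi xPi).
  by congr log_close_at0; apply/funext => a; field; exact/lt0r_neq0.
have eps e : 0 < e -> log_close e (fun t => survival S w C t - survival S w Pi t)
      (fun t => 2 * cS ^+ 2 * K * (ln t / t ^+ 2)).
  move=> e0; apply: difference.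
  apply: (survival_expansion_eps Cm M'0 u01 CM S w0 w1) => // i j ij.
  have [hsup hinf] := lims i j ij.
  exact: (limit_pair_close (dens _ (card2 i j ij)) hsup hinf).
split.
- exact: log_close_eqaddo.
- apply: log_close_at0_eqaddo => e e0.
  (* The factor [cS ^+ 2] undoes the division made in [calib]. *)
  have e1 : 0 < e * cS ^+ 2 by rewrite mulr_gt0// exprn_gt0.
  have := calib _ (ltW e1) (eps _ e1).
  by rewrite mulfK// expf_neq0// gt_eqF.
move=> dini.
have xC : tail_expansion (survival S w C) cS (L lam).
  apply: (survival_expansion_dyadic Cm M'0 u01 CM S w0 w1) => i j ij.
  have dij := dens _ (card2 i j ij); have bij := bound _ (card2 i j ij).
  have [W [om [om0 oscom omW]]] := osc_dyadic_sums dij u01 bij (dini i j ij).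
  exists (u0 / 2), W, om; split=> //; first by apply/andP; split; lra.
  move=> k; have [h1 h2] := osc_le_bounds (oscom k).
  exact: (density_pair_close dij h1 h2).
split.
- exact/log_close_eqaddO/difference.
- apply: log_close_at0_eqaddO.
  by have := calib 0 (lexx _) (difference _ xC); rewrite mul0r.
- have [B [a0 [a00 h]]] := quantile_difference c0 rPi xPi rC xC.
  apply: (bounded_eqaddO1 a00 (B := B)) => a /h.
  rewrite LK (_ : 2 * cS ^+ 2 * K / cS = 2 * cS * K)//.
  by field; exact/lt0r_neq0.
Qed.
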